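(* On each filtered probability space $(\Omega,\mathcal{F},(\mathcal{F}_t)_{t\geq 0},\mathbb{P})$ that supports a one-dimensional standard Brownian motion $W$ and an independent real-valued random variable $\zeta$, there exists a solution $X$ of the equation $$\mathrm{d}X(t)=\mathbf{1}_{\{X(t)>0\}}\,\mathrm{d}W(t),\qquad 0\le t<\infty,$$ which satisfies $X(0)=\zeta$ and is adapted to the filtration $\big(\mathcal{F}^{(\zeta,W)}_t\big)_{t\ge 0}$ generated by $(\zeta,W)$. Moreover, $X$ is the unique process with these properties (up to indistinguishability), and the law of every weak solution to this equation with the same initial distribution (that is, the distribution of $\zeta$) coincides with the law of $X$.
   Context: The filtration generated by $(\zeta,W)$ is $\mathcal{F}^{(\zeta,W)}_t=\sigma(\zeta,\,W(s):0\le s\le t)$. A solution of the equation with $X(0)=\zeta$ and driving Brownian motion $W$ is an adapted process $X$ with continuous paths such that, with probability one, $X(t)=\zeta+\int_0^t\mathbf{1}_{\{X(s)>0\}}\,\mathrm{d}W(s)$ for all $t\ge 0$. A weak solution with initial distribution $\mu$ consists of some filtered probability space together with a continuous adapted process $Y$ and a standard Brownian motion $B$ relative to the filtration of that space, such that $Y(0)$ has distribution $\mu$ and, with probability one, $Y(t)=Y(0)+\int_0^t\mathbf{1}_{\{Y(s)>0\}}\,\mathrm{d}B(s)$ for all $t\ge0$. Its law is the law of $Y$ on $C([0,\infty);\mathbb{R})$. *)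

(* Defs.v *)
(* Processes are functions [X : R -> Omega -> R] of which only the values at
   times [t >= 0] matter. *)
From HB Require Import structures.
From mathcomp Require Import all_boot all_order all_algebra.
From mathcomp Require Import all_classical all_reals all_analysis.
Set Implicit Arguments.
Unset Strict Implicit.
Unset Printing Implicit Defensive.
Import Order.TTheory GRing.Theory Num.Theory.
Import numFieldNormedType.Exports.
Local Open Scope classical_set_scope.
Local Open Scope ring_scope.

Section Filtrations.
Context (R : realType) d (Omega : measurableType d) (P : probability Omega R).
Implicit Types (F : R -> set_system Omega) (X W : R -> Omega -> R).

(* The sigma-algebra generated by a real-valued [f]. *)
Definition sigma_of (f : Omega -> R) : set_system Omega :=
  preimage_set_system [set: Omega] f measurable.

Definition independent_systems (G H : set_system Omega) : Prop :=
  forall A B, G A -> H B -> P (A `&` B) = (P A * P B)%E.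

(* No completeness or right-continuity is required. *)
Definition is_filtration F : Prop :=
  [/\ forall t, 0 <= t -> sigma_algebra [set: Omega] (F t),
      forall t, 0 <= t -> F t `<=` measurable
    & forall s t, 0 <= s -> s <= t -> F s `<=` F t].

Definition adapted F X : Prop :=
  forall t, 0 <= t -> sigma_of (X t) `<=` F t.

Definition continuous_paths X : Prop :=
  forall w, {within `[0, +oo[, continuous (fun t => X t w)}.

Definition indistinguishable X Y : Prop :=
  {ae P, forall w, forall t, 0 <= t -> X t w = Y t w}.

Definition sigma_process W : set_system Omega :=
  <<s \bigcup_(s in `[0, +oo[) sigma_of (W s) >>.

Definition generated_filtration (zeta : Omega -> R) W : R -> set_system Omega :=
  fun t => <<s sigma_of zeta `|` \bigcup_(s in `[0, t]) sigma_of (W s) >>.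

(* [normal_prob m s] is parameterized by the standard deviation [s]. *)
Definition is_brownian F W : Prop :=
  [/\ continuous_paths W,
      adapted F W,
      {ae P, forall w, W 0 w = 0},
      forall s t, 0 <= s -> s < t ->
        independent_systems (F s) (sigma_of (W t \- W s))
    & forall s t, 0 <= s -> s < t -> forall A : set R, measurable A ->
        P ((W t \- W s) @^-1` A) = normal_prob 0 (Num.sqrt (t - s)) A].

(* The process sum_(i < n) xi_i 1_(]t_i, t_(i+1)]) with bounded,
   F_(t_i)-measurable coefficients xi_i. *)
Record simple_process F := SimpleProcess {
  sp_size : nat;
  sp_time : nat -> R;
  sp_coef : nat -> Omega -> R;
  sp_time_ge0 : 0 <= sp_time 0;
  sp_time_le : forall i, (i < sp_size)%N -> sp_time i <= sp_time i.+1;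
  sp_coef_adapted : forall i, (i < sp_size)%N ->
    sigma_of (sp_coef i) `<=` F (sp_time i);
  sp_coef_bounded : exists C : R, forall i w, (i < sp_size)%N ->
    `|sp_coef i w| <= C }.

Definition simple_val F (H : simple_process F) (s : R) (w : Omega) : R :=
  \sum_(i < sp_size H)
    sp_coef H i w * \1_(`]sp_time H i, sp_time H i.+1]) s.

Definition simple_integral F W (H : simple_process F) (t : R) (w : Omega) : R :=
  \sum_(i < sp_size H) sp_coef H i w *
    (W (Num.min t (sp_time H i.+1)) w - W (Num.min t (sp_time H i)) w).

(* [I] is a continuous version of the Ito integral of [H] against [W]: the
   L^2-limit of the elementary integrals of simple processes converging to [H]
   in L^2([0, T] x Omega) for every [T].  When [W] is a Brownian motion for [F]
   and [H] is jointly measurable, Ito's isometry makes [I] unique up to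
   indistinguishability and independent of the approximating sequence.  [I] is
   not required to be adapted: a continuous version need only be adapted to the
   completion of [F]. *)
Definition is_ito_integral F W (H I : R -> Omega -> R) : Prop :=
  [/\ continuous_paths I,
      forall t, 0 <= t -> measurable_fun [set: Omega] (I t)
    & exists Hn : nat -> simple_process F,
        (forall T : R, 0 <= T ->
          (fun n => \int[P]_w \int[lebesgue_measure]_(s in `[0%R, T])
             ((simple_val (Hn n) s w - H s w) ^+ 2)%R%:E)%E @ \oo --> 0%E) /\
        (forall t : R, 0 <= t ->
          (fun n => \int[P]_w
             ((simple_integral W (Hn n) t w - I t w) ^+ 2)%R%:E)%E
             @ \oo --> 0%E)].

(* dX(t) = 1_{X(t) > 0} dW(t), X(0) = zeta, on (Omega, F, P). *)
Definition is_solution F (zeta : Omega -> R) W X : Prop :=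
  [/\ continuous_paths X,
      adapted F X
    & exists I : R -> Omega -> R,
        is_ito_integral F W (fun s w => \1_[set x : R | 0 < x] (X s w)) I /\
        {ae P, forall w, forall t, 0 <= t -> X t w = zeta w + I t w}].

Definition is_weak_solution F (mu : set R -> \bar R) B Y : Prop :=
  [/\ is_filtration F,
      is_brownian F B,
      is_solution F (Y 0) B Y
    & forall A : set R, measurable A -> P (Y 0 @^-1` A) = mu A].

End Filtrations.

Definition half_line (R : realType) : Type := set_type (`[0, +oo[ : set R).
HB.instance Definition _ (R : realType) :=
  Topological.copy (half_line R) (set_type (`[0, +oo[ : set R)).

(* C([0, oo); R) with the compact-open topology, i.e. that of uniform
   convergence on compact sets. *)
Definition path_space (R : realType) : Type := continuousType (half_line R) R.
HB.instance Definition _ (R : realType) := Choice.on (path_space R).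
HB.instance Definition _ (R : realType) := Topological.copy (path_space R)
  (initial_topology
    (fun f : path_space R => (f : half_line R -> R)
       : {compact-open, half_line R -> R})).

Definition borel_paths (R : realType) : set_system (path_space R) :=
  <<s @open (path_space R) >>.

(* The law on C([0, oo); R) of a process with continuous paths: the event is
   the preimage of [A] under [w |-> X(., w)]. *)
Definition path_law (R : realType) d (Omega : measurableType d)
    (P : probability Omega R) (X : R -> Omega -> R)
    (A : set (path_space R)) : \bar R :=
  P [set w | exists2 f : path_space R, A f &
       forall t : half_line R, (f : half_line R -> R) t = X (set_val t) w].

(* Main.v *)
(** With [Z = zeta + W - W(0)], the solution is [Z] stopped when it first reaches
    ]-oo, 0].  Elementary integrals along finer and finer grids converge to it in
    L^2 by Ito's isometry, so it is a solution.  Conversely, the stochastic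
    integral is local: on the event that a solution [X] stays in a closed set on
    which [x |-> 1_{x > 0}] equals [c], its increments are those of [c W].  Hence
    [X] moves with [W] while positive and is constant while nonpositive; and once
    at [0] it stays there, by optional stopping, since it is a nonnegative
    martingale.  So every solution is the same functional of the path of [Z],
    whose law is determined by the law of [zeta] and the Markov property; laws on
    the path space are determined by the evaluations, because countably many
    rational boxes form a base of the compact-open topology. *)
Require Import Defs.
From HB Require Import structures.
From mathcomp Require Import all_boot all_order all_algebra.
From mathcomp Require Import all_classical all_reals all_analysis.
From mathcomp Require Import measurable_realfun.
From mathcomp Require Import ring lra.
Set Implicit Arguments.
Unset Strict Implicit.
Unset Printing Implicit Defensive.
Import Order.TTheory GRing.Theory Num.Theory.
Import numFieldNormedType.Exports.
Local Open Scope classical_set_scope.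
Local Open Scope ring_scope.

(** * Gaussian moments and sub-sigma-algebras *)

(** [F] may be neither complete nor right-continuous, and stochastic integrals are only L^2 limits
    of elementary ones. Hence no random time enters an integrand: optional stopping and locality are
    proved on deterministic grids whose mesh then tends to 0, and the encoding of [hits] makes the
    stopped path adapted to the raw filtration. Almost sure statements are gathered at rational
    times and countably many thresholds, so that one null set suffices; a deterministic lemma on
    continuous paths, [stopped_unique], does the rest. Positivity becomes [n.+1%:R^-1 <= X], because
    locality asks for a closed set, and absorption works on [zeta] in [[0, K]], because [zeta] may
    fail to be integrable. For a weak solution, independence of [Y 0] and the driving noise comes
    from the increments being independent of [F' 0]. The statements about [driving_path] and
    [stopped_process] are therefore made for a general filtration and an [F 0]-measurable [zeta]:
    they apply both to [generated_filtration] on the given space and to the space of any weak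
    solution. *)

Section normal_moments.
Context {R : realType}.
Local Notation mu := (@lebesgue_measure R).

Lemma normal_pdf_scale (s x : R) : 0 < s ->
  normal_pdf 0 s (s * x) * s = normal_pdf 0 1 x.
Proof.
move=> s0; rewrite !normal_pdfE ?gt_eqF//.
rewrite /normal_peak /normal_fun !subr0 expr1n mul1r.
have -> : - (s * x) ^+ 2 / (s ^+ 2 *+ 2) = - x ^+ 2 / (1 *+ 2).
  by rewrite -[s ^+ 2 *+ 2]mulr_natr; field; rewrite gt_eqF.
rewrite -[s ^+ 2 * pi *+ 2]mulrnAr sqrtrM ?sqr_ge0// sqrtr_sqr gtr0_norm//.
rewrite invfM mulrAC; congr (_ * _).
by rewrite mulrAC mulVf ?mul1r// gt_eqF.
Qed.

Local Open Scope ereal_scope.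

(** The Radon-Nikodym derivative of [normal_prob] agrees almost everywhere with the density, because
    both have the same integral over every measurable set. *)
Lemma ge0_integral_normal_prob (s : R) (f : R -> \bar R) :
  measurable_fun [set: R] f -> (forall x, 0 <= f x) ->
  \int[normal_prob 0 s]_x f x = \int[mu]_x (f x * (normal_pdf 0 s x)%:E).
Proof.
move=> mf f0.
have dom := @normal_prob_dominates R 0%R s.
rewrite -(Radon_Nikodym_SigmaFinite.change_of_variables dom)//.
have mpdf : measurable_fun [set: R] (EFin \o normal_pdf 0 s).
  apply/measurable_EFinP; exact: measurable_normal_pdf.
apply: ae_eq_integral => //.
- apply: emeasurable_funM => //.
  exact: measurable_int (Radon_Nikodym_SigmaFinite.f_integrable dom).
- exact: emeasurable_funM.
- apply: ae_eqe_mul2l => /=.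
  apply: integral_ae_eq => //=.
  + exact: Radon_Nikodym_SigmaFinite.f_integrable.
  + by move=> E _ mE; rewrite -Radon_Nikodym_SigmaFinite.f_integral.
Qed.

(** Cutting at 0 and substituting [- x] on a half-line exchanges the two halves. *)
Lemma ge0_integral_opp (G : R -> R) : continuous G -> (forall x, 0 <= G x)%R ->
  \int[mu]_x (G x)%:E = \int[mu]_x (G (- x))%:E.
Proof.
have split (g : R -> R) : continuous g -> (forall x, 0 <= g x)%R ->
    \int[mu]_x (g x)%:E = \int[mu]_(x in `]-oo, 0%R]) (g x)%:E +
      \int[mu]_(x in `[0%R, +oo[) (g x)%:E.
  move=> cg g0.
  have mg : measurable_fun [set: R] (EFin \o g).
    apply/measurable_EFinP; exact: continuous_measurable_fun.
  rewrite -integral_itv_obnd_cbnd; last exact: measurable_funTS.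
  rewrite -ge0_integral_setU//=.
  - by rewrite -setCitvl setUv.
  - exact: measurable_funTS.
  - by move=> x _; rewrite lee_fin.
  - by rewrite -setCitvl; apply/disj_setPCl.
have half (g : R -> R) : continuous g -> (forall x, 0 <= g x)%R ->
    \int[mu]_(x in `]-oo, 0%R]) (g x)%:E =
    \int[mu]_(x in `[0%R, +oo[) (g (- x)%R)%:E.
  move=> cg g0; rewrite -{1}oppr0 ge0_integration_by_substitutionNy//.
  exact: continuous_subspaceT.
move=> cG G0.
have cGN : continuous (fun x : R => G (- x)%R).
  by move=> x; apply: continuous_comp; [exact: opp_continuous|exact: cG].
rewrite split// (split (fun x : R => G (- x)%R))// half// (half (fun x : R => G (- x)%R))//.
by rewrite addeC; congr (_ + _); apply: eq_integral => x _; rewrite opprK.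
Qed.

Lemma normal_second_momentZ (s : R) : (0 < s)%R ->
  \int[normal_prob 0 s]_x (x ^+ 2)%:E =
  (s ^+ 2)%:E * \int[normal_prob 0 1]_x (x ^+ 2)%:E.
Proof.
move=> s0.
have msq : measurable_fun [set: R] (fun x : R => (x ^+ 2)%:E).
  apply/measurable_EFinP; exact: exprn_measurable.
rewrite !ge0_integral_normal_prob//; try by move=> x; rewrite lee_fin sqr_ge0.
have dF (x : R) : is_derive x (1 : R)%R (fun x : R => s * x)%R s.
  by apply: is_derive_eq; rewrite scaler1.
have F' : (fun x : R => s * x)%R^`()%classic = cst s.
  by apply/funext => x; rewrite derive1E; exact: derive_val.
have mg : measurable_fun [set: R] (fun x : R => (x ^+ 2)%:E * (normal_pdf 0 1 x)%:E).
  by apply: emeasurable_funM => //; apply/measurable_EFinP; exact: measurable_normal_pdf.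
rewrite -ge0_integralZl//; first last.
- by rewrite lee_fin sqr_ge0.
- by move=> x _; rewrite mule_ge0// lee_fin ?sqr_ge0// normal_pdf_ge0.
have sn0 : s != 0%R by rewrite gt_eqF.
under [LHS]eq_integral do rewrite -EFinM.
rewrite (@increasing_ge0_integration_by_substitutionT _ (fun x : R => s * x)%R
   (fun x => x ^+ 2 * normal_pdf 0 s x)%R)//.
- apply: eq_integral => x _; rewrite F'/= -!EFinM; congr EFin.
  by rewrite !fctE /= -(normal_pdf_scale x s0) exprMn !mulrA.
- by move=> x y xy; rewrite ltr_pM2l.
- by rewrite F'; exact: cst_continuous.
- by rewrite F'; exact: is_cvg_cst.
- by rewrite F'; exact: is_cvg_cst.
- by apply/gt0_cvgMrNy => //; exact: cvg_id.
- by apply/gt0_cvgMry => //; exact: cvg_id.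
- move=> x; apply: cvgM; first exact: exprn_continuous.
  exact: continuous_normal_pdf.
- by move=> x; rewrite mulr_ge0 ?sqr_ge0 ?normal_pdf_ge0.
Qed.

Lemma normal_second_moment_lty :
  \int[normal_prob 0 (1 : R)]_x (x ^+ 2)%:E < +oo.
Proof.
rewrite ge0_integral_normal_prob//; last 2 first.
- apply/measurable_EFinP; exact: exprn_measurable.
- by move=> x; rewrite lee_fin sqr_ge0.
(* The density of variance 2 decays like [expR (- (x ^+ 2 / 4))] and dominates, because
   [x ^+ 2 <= 4 * expR (x ^+ 2 / 4)]; hence the 4 in [K], while the peaks convert the
   normalizations. *)
pose s : R := Num.sqrt 2.
have s0 : s != 0%R by rewrite gt_eqF// sqrtr_gt0.
pose K : R := (4 * normal_peak 1 / normal_peak s)%R.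
have K0 : (0 <= K)%R by rewrite divr_ge0 ?mulr_ge0 ?normal_peak_ge0.
have mpdf t : measurable_fun [set: R] (EFin \o normal_pdf 0 t).
  apply/measurable_EFinP; exact: measurable_normal_pdf.
apply: (@le_lt_trans _ _ (\int[mu]_x (K%:E * (normal_pdf 0 s x)%:E))).
  apply: ge0_le_integral => //.
  - by move=> x _; rewrite mule_ge0// lee_fin ?sqr_ge0 ?normal_pdf_ge0.
  - apply: emeasurable_funM; last exact: mpdf.
    apply/measurable_EFinP; exact: exprn_measurable.
  - by apply: emeasurable_funM => //; exact: mpdf.
  move=> x _; rewrite -!EFinM lee_fin !normal_pdfE ?oner_eq0//.
  rewrite [leRHS]mulrA /K mulfVK ?gt_eqF ?normal_peak_gt0//.
  rewrite mulrCA -[leRHS]mulrA [leRHS]mulrCA ler_pM2l ?normal_peak_gt0 ?oner_eq0//.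
  rewrite /normal_fun !subr0 sqr_sqrtr// expr1n.
  have -> : (- x ^+ 2 / (1 *+ 2) = - (x ^+ 2 / 4) + - (x ^+ 2 / 4))%R by field.
  have -> : (- x ^+ 2 / (2 *+ 2) = - (x ^+ 2 / 4))%R by field.
  rewrite expRD mulrA ler_pM2r ?expR_gt0// expRN ler_pdivrMr ?expR_gt0//.
  have := expR_ge1Dx (x ^+ 2 / 4)%R; lra.
have pdf0 x : [set: R] x -> 0 <= (EFin \o normal_pdf 0 s) x.
  by move=> _; rewrite lee_fin normal_pdf_ge0.
rewrite ge0_integralZl//; try exact: mpdf; try exact: pdf0.
by rewrite integral_normal_pdf mule1 ltry.
Qed.

(* The second moment of N(0, 1); that it equals 1 is never needed. *)
Definition normal_m2 : R := fine (\int[normal_prob 0 (1 : R)]_x (x ^+ 2)%:E).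

Lemma normal_m2_ge0 : (0 <= normal_m2)%R.
Proof. by rewrite fine_ge0// integral_ge0// => x _; rewrite lee_fin sqr_ge0. Qed.

Lemma normal_second_moment (s : R) : (0 < s)%R ->
  \int[normal_prob 0 s]_x (x ^+ 2)%:E = (normal_m2 * s ^+ 2)%:E.
Proof.
move=> s0; rewrite normal_second_momentZ// muleC [RHS]EFinM /normal_m2 fineK//.
rewrite ge0_fin_numE ?normal_second_moment_lty//.
by apply: integral_ge0 => x _; rewrite lee_fin sqr_ge0.
Qed.

(** The positive and the negative part have equal integrals by reflection. The bound
    [Num.max x 0 <= 1 + x ^+ 2] makes them finite, so that their difference is 0 and not an
    indeterminate form. *)
Lemma normal_mean (s : R) : (0 < s)%R -> \int[normal_prob 0 s]_x x%:E = 0.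
Proof.
move=> s0; have sn0 : s != 0%R by rewrite gt_eqF.
have mE : measurable_fun [set: R] (fun x : R => x%:E) by exact/measurable_EFinP.
rewrite integralE.
rewrite !ge0_integral_normal_prob//.
2: exact: measurable_funeneg.
2: exact: measurable_funepos.
rewrite [X in X - _](_ : _ = \int[mu]_x (Num.max x 0 * normal_pdf 0 s x)%:E).
2: by apply: eq_integral => x _; rewrite funeposE -EFin_max -EFinM.
rewrite [X in _ - X](_ : _ = \int[mu]_x (Num.max x 0 * normal_pdf 0 s x)%:E).
  rewrite subee// ge0_fin_numE; last first.
    by apply: integral_ge0 => x _; rewrite lee_fin mulr_ge0 ?normal_pdf_ge0 ?le_max ?lexx ?orbT.
  have mpdf t : measurable_fun [set: R] (normal_pdf 0 t).
    exact: measurable_normal_pdf.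
  apply: (@le_lt_trans _ _ (\int[mu]_x ((1 + x ^+ 2) * normal_pdf 0 s x)%:E)).
    apply: ge0_le_integral => //.
    - by move=> x _; rewrite lee_fin mulr_ge0 ?normal_pdf_ge0 ?le_max ?lexx ?orbT.
    - apply/measurable_EFinP; apply: measurable_funM => //.
        by apply: (@measurable_maxr _ _ _ _ id (cst 0%R)) => //; exact: measurable_cst.
      exact: mpdf.
    - apply/measurable_EFinP; apply: measurable_funM; last exact: mpdf.
      by apply: measurable_funD => //; exact: exprn_measurable.
    move=> x _; rewrite lee_fin ler_wpM2r ?normal_pdf_ge0//.
    by have := sqr_ge0 (x - 1)%R; rewrite ge_max; nra.
  under eq_integral do rewrite EFinM.
  rewrite -ge0_integral_normal_prob; last 2 first.
  - by apply/measurable_EFinP; apply: measurable_funD => //; exact: exprn_measurable.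
  - by move=> x; rewrite lee_fin addr_ge0 ?sqr_ge0.
  under eq_integral do rewrite EFinD.
  rewrite ge0_integralD//=; last 2 first.
  - by move=> x _; rewrite lee_fin sqr_ge0.
  - by apply/measurable_EFinP; exact: exprn_measurable.
  rewrite normal_second_moment// integral_cst//=.
  by rewrite mul1e [normal_prob _ _ _]probability_setT -EFinD ltry.
rewrite ge0_integral_opp; last 2 first.
- move=> x; apply: cvgM; last exact: continuous_normal_pdf.
  by apply: continuous_max => //; exact: cst_continuous.
- by move=> x; rewrite mulr_ge0 ?normal_pdf_ge0 ?le_max ?lexx ?orbT.
apply: eq_integral => x _; rewrite funenegE -EFinN -EFin_max -EFinM.
by rewrite !normal_pdfE// /normal_fun !subr0 sqrrN.
Qed.
End normal_moments.

Section sub_sigma_algebras.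
Context (R : realType) (T : pointedType).
Implicit Types (G : set_system T) (f g : T -> R).

(** Stated on [g_sigma_algebraType G] so that the closure properties of measurable functions apply
    to a sub-sigma-algebra; [smeasP] returns to preimages when [G] is a sigma-algebra. *)
Definition smeas G f :=
  measurable_fun [set: g_sigma_algebraType G] (f : g_sigma_algebraType G -> R).

Lemma smeasP G f : sigma_algebra [set: T] G ->
  smeas G f <-> preimage_set_system [set: T] f measurable `<=` G.
Proof.
move=> sG; split=> [mf A [B mB <-]|H].
  by have := mf measurableT B mB; rewrite /measurable/= (sigma_algebra_id sG).
move=> _ B mB; rewrite /measurable/= (sigma_algebra_id sG).
by apply: H; exists B.
Qed.

Lemma smeas_set G f (B : set R) : sigma_algebra [set: T] G -> smeas G f ->
  measurable B -> G (f @^-1` B).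
Proof. by move=> sG /(smeasP _ sG) H mB; apply: H; exists B => //; rewrite setTI. Qed.

Lemma smeas_sub G H f : G `<=` H -> smeas G f -> smeas H f.
Proof.
move=> GH mf _ B mB; have := mf measurableT B mB.
exact: sub_sigma_algebra2.
Qed.

Lemma smeas_indic G (A : set T) : G A -> smeas G (\1_A).
Proof.
move=> GA; apply: (@measurable_indic _ (g_sigma_algebraType G) R setT A).
exact: sub_sigma_algebra.
Qed.

Lemma smeas_cst G (c : R) : smeas G (cst c).
Proof. exact: measurable_cst. Qed.

Lemma smeasD G f g : smeas G f -> smeas G g -> smeas G (fun w => f w + g w).
Proof. exact: measurable_funD. Qed.

Lemma smeasB G f g : smeas G f -> smeas G g -> smeas G (fun w => f w - g w).
Proof. exact: measurable_funB. Qed.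

Lemma smeasM G f g : smeas G f -> smeas G g -> smeas G (fun w => f w * g w).
Proof. exact: measurable_funM. Qed.
End sub_sigma_algebras.

Lemma smeas_measurable (R : realType) d (T : measurableType d) (G : set_system T)
  (f : T -> R) : G `<=` measurable -> smeas G f -> measurable_fun [set: T] f.
Proof.
move=> GT mf _ B mB; have := mf measurableT B mB.
apply: smallest_sub => //; exact: sigma_algebra_measurable.
Qed.

(** * Integrals of functions of independent variables *)

Section independence.
Context (R : realType) d (T : measurableType d) (P : probability T R).
Local Open Scope ereal_scope.

(** The product formula on rectangles identifies the law of [(U, V)] with the product of the law of
    [U] and [N]; Tonelli concludes. As [N] is a parameter, a normal law can be plugged in
    directly. *)
Lemma ge0_integral_indep d1 d2 (T1 : measurableType d1) (T2 : measurableType d2)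
  (U : T -> T1) (V : T -> T2) (N : probability T2 R) (f : T1 * T2 -> \bar R) :
  measurable_fun [set: T] U -> measurable_fun [set: T] V ->
  (forall A B, measurable A -> measurable B ->
    P (U @^-1` A `&` V @^-1` B) = P (U @^-1` A) * N B) ->
  measurable_fun [set: T1 * T2] f -> (forall x, 0 <= f x) ->
  \int[P]_w f (U w, V w) = \int[P]_w \int[N]_y f (U w, y).
Proof.
move=> mU mV PN mf f0.
have mUV : measurable_fun [set: T] (fun w => (U w, V w)).
  exact: measurable_fun_pair.
pose U' : {mfun T >-> T1} := HB.pack U (isMeasurableFun.Build _ _ _ _ _ mU).
pose UV : {mfun T >-> (T1 * T2)%type} := HB.pack (fun w => (U w, V w))
   (isMeasurableFun.Build _ _ _ _ _ mUV).
have E C : measurable C -> (distribution P U' \x N) C = distribution P UV C.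
  by apply: (product_measure_unique (m' := distribution P UV)) => A B; exact: PN.
rewrite -(@ge0_integral_distribution _ _ _ _ _ P UV)//.
rewrite (eq_measure_integral (distribution P U' \x N)%E); last first.
  by move=> A mA _; apply/esym; exact: E.
rewrite fubini_tonelli1// /fubini_F.
rewrite (@ge0_integral_distribution _ _ _ _ _ P U')//.
  exact: measurable_fun_fubini_tonelli_F.
by move=> x; apply: integral_ge0.
Qed.

Lemma integrable_distribution (X : {mfun T >-> R}) :
  P.-integrable [set: T] (EFin \o X) ->
  (distribution P X).-integrable [set: R] (fun y : R => y%:E).
Proof.
move=> /integrableP[mX iX]; apply/integrableP; split; first exact/measurable_EFinP.
by rewrite ge0_integral_distribution//; exact: measurableT_comp.
Qed.

(** The formula is first obtained for nonnegative functions of [U] and [V]; with absolute values it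
    gives the integrability that Fubini needs for the signed product. *)
Lemma indep_integralM (U V : T -> R) :
  P.-integrable [set: T] (EFin \o U) -> P.-integrable [set: T] (EFin \o V) ->
  independent_systems P (sigma_of U) (sigma_of V) ->
  P.-integrable [set: T] (fun w => (U w * V w)%:E) /\
  \int[P]_w (U w * V w)%:E = \int[P]_w (U w)%:E * \int[P]_w (V w)%:E.
Proof.
move=> iU iV UV.
have mU : measurable_fun [set: T] U by apply/measurable_EFinP; exact: measurable_int iU.
have mV : measurable_fun [set: T] V by apply/measurable_EFinP; exact: measurable_int iV.
pose V' : {mfun T >-> R} := HB.pack V (isMeasurableFun.Build _ _ _ _ _ mV).
have PN A B : measurable A -> measurable B ->
    P (U @^-1` A `&` V @^-1` B) = P (U @^-1` A) * distribution P V' B.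
  move=> mA mB; apply: UV; [exists A|exists B] => //; exact: setTI.
have key (f g : R -> R) : measurable_fun [set: R] f -> measurable_fun [set: R] g ->
   (forall x, 0 <= f x)%R -> (forall x, 0 <= g x)%R ->
   \int[P]_w (f (U w) * g (V w))%:E = \int[P]_w (f (U w))%:E * \int[P]_w (g (V w))%:E.
  move=> mf mg f0 g0.
  rewrite (ge0_integral_indep (f := fun x => (f x.1 * g x.2)%:E) mU mV PN)//; last 2 first.
  - apply/measurable_EFinP; apply: measurable_funM; exact: measurableT_comp.
  - by move=> x; rewrite lee_fin mulr_ge0.
  transitivity (\int[P]_w ((f (U w))%:E * \int[P]_v (g (V v))%:E)).
    apply: eq_integral => w _ /=.
    under eq_integral do rewrite EFinM.
    rewrite ge0_integralZl//; first last.
    - by rewrite lee_fin.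
    - by move=> x _; rewrite lee_fin.
    - by apply/measurable_EFinP.
    rewrite (@ge0_integral_distribution _ _ _ _ _ P V' (fun x => (g x)%:E))//.
    by apply/measurable_EFinP.
  rewrite ge0_integralZr//.
  - by apply/measurable_EFinP; exact: measurableT_comp.
  - by move=> x _; rewrite lee_fin.
  - by apply: integral_ge0 => x _; rewrite lee_fin.
have iUV : P.-integrable [set: T] (fun w => (U w * V w)%:E).
  apply/integrableP; split.
    by apply/measurable_EFinP; exact: measurable_funM.
  under eq_integral do rewrite abse_EFin normrM.
  rewrite (key (fun x => `|x|%R) (fun x => `|x|%R))//.
  move/integrableP : iU => [_ /= iU]; move/integrableP : iV => [_ /= iV].
  by rewrite lte_mul_pinfty// ?ge0_fin_numE//; exact: integral_ge0.
split => //.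
pose U' : {mfun T >-> R} := HB.pack U (isMeasurableFun.Build _ _ _ _ _ mU).
have mUV : measurable_fun [set: T] (fun w => (U w, V w)).
  exact: measurable_fun_pair.
pose UV' : {mfun T >-> (R * R)%type} := HB.pack (fun w => (U w, V w))
   (isMeasurableFun.Build _ _ _ _ _ mUV).
have E C : measurable C ->
    (distribution P U' \x distribution P V') C = distribution P UV' C.
  by apply: (product_measure_unique (m' := distribution P UV')) => A B; exact: PN.
pose m (x : R * R) := (x.1 * x.2)%:E.
have mm : measurable_fun [set: R * R] m.
  by apply/measurable_EFinP; exact: measurable_funM.
have Em f : \int[distribution P U' \x distribution P V']_x f x =
    \int[distribution P UV']_x f x.
  by apply: eq_measure_integral => A mA _; exact: E.
rewrite -(@integral_distribution _ _ _ _ _ P UV' m)// -Em.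
rewrite -integral12_prod_meas1; last first.
  apply/integrableP; split=> //; rewrite Em.
  rewrite ge0_integral_distribution//; last exact: measurableT_comp.
  by move/integrableP : iUV => [].
rewrite /fubini_F /m/=.
have NV : (distribution P V').-integrable [set: R] (fun y : R => y%:E).
  exact: integrable_distribution.
have VE : \int[distribution P V']_y y%:E = \int[P]_w (V w)%:E.
  by rewrite integral_distribution.
under eq_integral do under eq_integral do rewrite EFinM.
transitivity (\int[distribution P U']_x (x%:E * \int[P]_w (V w)%:E)).
  by apply: eq_integral => x _; rewrite integralZl// VE.
have fV : \int[P]_w (V w)%:E \is a fin_num by exact: integrable_fin_num.
rewrite -(fineK fV) integralZr//; last first.
  exact: integrable_distribution.
by rewrite integral_distribution.
Qed.
End independence.

(** * Ito's isometry for elementary integrands *)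

Section brownian_increments.
Context (R : realType) d (Omega : measurableType d) (P : probability Omega R).
Context (F : R -> set_system Omega) (W : R -> Omega -> R).
Hypotheses (hF : is_filtration F) (hW : is_brownian P F W).
Local Open Scope ereal_scope.

Let sF (t : R) : (0 <= t)%R -> sigma_algebra [set: Omega] (F t).
Proof. by case: hF => h _ _; exact: h. Qed.

Let Fm (t : R) : (0 <= t)%R -> F t `<=` measurable.
Proof. by case: hF => _ h _; exact: h. Qed.

Let Fle (s t : R) : (0 <= s)%R -> (s <= t)%R -> F s `<=` F t.
Proof. by case: hF => _ _; exact. Qed.

Lemma brownian_smeas (t : R) : (0 <= t)%R -> smeas (F t) (W t).
Proof. by move=> t0; apply/smeasP; [exact: sF|case: hW => _ + _ _ _; exact]. Qed.

Lemma brownian_measurable (t : R) : (0 <= t)%R -> measurable_fun [set: Omega] (W t).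
Proof. by move=> t0; apply: smeas_measurable (brownian_smeas t0); exact: Fm. Qed.

Lemma increment_measurable (s t : R) : (0 <= s)%R -> (0 <= t)%R ->
  measurable_fun [set: Omega] (fun w => W t w - W s w)%R.
Proof. by move=> s0 t0; apply: measurable_funB; exact: brownian_measurable. Qed.

Lemma ge0_integral_increment (s t : R) (f : R -> \bar R) : (0 <= s)%R -> (s < t)%R ->
  measurable_fun [set: R] f -> (forall x, 0 <= f x) ->
  \int[P]_w f (W t w - W s w)%R = \int[normal_prob 0 (Num.sqrt (t - s))]_x f x.
Proof.
move=> s0 st mf f0.
have mD := increment_measurable s0 (le_trans s0 (ltW st)).
(* [normal_prob] lives on [measurableTypeR R], whose display differs from that of [R]. *)
have mD' : measurable_fun [set: Omega]
    ((fun w => W t w - W s w)%R : Omega -> measurableTypeR R) by exact: mD.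
pose D : {mfun Omega >-> measurableTypeR R} :=
  HB.pack (fun w => W t w - W s w : measurableTypeR R)%R
    (isMeasurableFun.Build _ _ _ _ _ mD').
rewrite -(@ge0_integral_distribution _ _ _ _ _ P D f)//.
apply: eq_measure_integral => A mA _.
by case: hW => _ _ _ _; apply.
Qed.

Lemma increment_sqr (s t : R) : (0 <= s)%R -> (s <= t)%R ->
  \int[P]_w ((W t w - W s w) ^+ 2)%:E = (normal_m2 * (t - s))%:E.
Proof.
move=> s0; rewrite le_eqVlt => /predU1P[<-|st].
  under eq_integral do rewrite subrr expr0n/=.
  by rewrite integral0 subrr mulr0.
rewrite (ge0_integral_increment (f := fun x => (x ^+ 2)%:E))//.
- by rewrite normal_second_moment ?sqrtr_gt0 ?subr_gt0// sqr_sqrtr// subr_ge0 ltW.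
- by apply/measurable_EFinP; exact: exprn_measurable.
- by move=> x; rewrite lee_fin sqr_ge0.
Qed.

Lemma increment_sqr_integrable (s t : R) : (0 <= s)%R -> (s <= t)%R ->
  P.-integrable [set: Omega] (fun w => ((W t w - W s w) ^+ 2)%:E).
Proof.
move=> s0 st; apply/integrableP; split.
  apply/measurable_EFinP; apply: measurable_funX.
  exact: (increment_measurable s0 (le_trans s0 st)).
under eq_integral do rewrite abse_EFin ger0_norm ?sqr_ge0//.
by rewrite increment_sqr// ltry.
Qed.

Lemma integrable_le1sqr d' (T : measurableType d') (Q : probability T R) (f : T -> R) :
  measurable_fun [set: T] f ->
  Q.-integrable [set: T] (fun w => (f w ^+ 2)%:E) ->
  Q.-integrable [set: T] (EFin \o f).
Proof.
move=> mf i2.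
have := integrableD measurableT i2 (finite_measure_integrable_cst Q 1%R measurableT).
apply: le_integrable => //; first exact/measurable_EFinP.
move=> x _ /=; rewrite lee_fin [leRHS]ger0_norm ?addr_ge0 ?sqr_ge0//.
have := sqr_ge0 (`|f x| - 1)%R; have := normr_ge0 (f x).
by rewrite -(real_normK (num_real (f x))); nra.
Qed.

Lemma increment_integrable (s t : R) : (0 <= s)%R -> (s <= t)%R ->
  P.-integrable [set: Omega] (fun w => (W t w - W s w)%:E).
Proof.
move=> s0 st; apply: integrable_le1sqr; last exact: increment_sqr_integrable.
exact: (increment_measurable s0 (le_trans s0 st)).
Qed.

Lemma increment_mean (s t : R) : (0 <= s)%R -> (s <= t)%R ->
  \int[P]_w (W t w - W s w)%:E = 0.
Proof.
move=> s0; rewrite le_eqVlt => /predU1P[<-|st].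
  by under eq_integral do rewrite subrr; rewrite integral0.
(* The transfer to the normal law is for nonnegative functions, so the two parts are transferred
   separately. *)
rewrite integralE.
under eq_integral do rewrite funeposE -EFin_max.
under [X in _ - X]eq_integral do rewrite funenegE -EFinN -EFin_max.
have mm : measurable_fun [set: R] (fun x : R => Num.max x 0%R).
  by apply: (@measurable_maxr _ _ _ _ id (cst 0%R)) => //; exact: measurable_cst.
have mmN : measurable_fun [set: R] (fun x : R => Num.max (- x)%R 0%R).
  exact: (measurableT_comp mm (@oppr_measurable R setT)).
rewrite (ge0_integral_increment (f := fun x => (Num.max x 0%R)%:E))//; last 2 first.
- exact/measurable_EFinP.
- by move=> x; rewrite lee_fin le_max lexx orbT.
rewrite (ge0_integral_increment (f := fun x => (Num.max (- x) 0)%:E)%R)//; last 2 first.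
- exact/measurable_EFinP.
- by move=> x; rewrite lee_fin le_max lexx orbT.
have := @normal_mean R (Num.sqrt (t - s)); rewrite integralE.
under eq_integral do rewrite funeposE -EFin_max.
have -> : \int[normal_prob 0 (Num.sqrt (t - s))]_x EFin^\- x =
    \int[normal_prob 0 (Num.sqrt (t - s))]_x (Num.max (- x) 0)%:E.
  by apply: eq_integral => x _; rewrite funenegE -EFinN -EFin_max.
by apply; rewrite sqrtr_gt0 subr_gt0.
Qed.

Let incr_indep (s t : R) (f g : Omega -> R) (h : R -> R) : (0 <= s)%R -> (s < t)%R ->
  smeas (F s) f -> measurable_fun [set: R] h ->
  (forall w, g w = h (W t w - W s w)%R) ->
  independent_systems P (sigma_of f) (sigma_of g).
Proof.
move=> s0 st /(smeasP _ (sF s0)) Ff mh gh A _ /Ff FA [C mC <-].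
case: hW => _ _ _ hI _; apply: (hI s t s0 st) => //.
exists (h @^-1` C).
  by rewrite -[X in measurable X]setTI; exact: mh.
by rewrite !setTI; apply/seteqP; split => w /=; rewrite gh.
Qed.

Lemma martingale_increment (s t : R) (f : Omega -> R) : (0 <= s)%R -> (s <= t)%R ->
  smeas (F s) f -> P.-integrable [set: Omega] (EFin \o f) ->
  P.-integrable [set: Omega] (fun w => (f w * (W t w - W s w))%:E) /\
  \int[P]_w (f w * (W t w - W s w))%:E = 0.
Proof.
move=> s0; rewrite le_eqVlt => /predU1P[<-|st] Ff fi.
  have -> : (fun w => (f w * (W s w - W s w))%:E) = cst 0.
    by apply/funext => w; rewrite subrr mulr0.
  by rewrite integral0; split => //; exact: integrable0.
have [//|||iM ->] := @indep_integralM _ _ _ P f (fun w => W t w - W s w)%R.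
- by apply: increment_integrable => //; exact: ltW.
- exact: (incr_indep (h := id) s0 st Ff).
by split => //; rewrite increment_mean ?mule0// ltW.
Qed.

Lemma conditional_variance_increment (s t : R) (f : Omega -> R) : (0 <= s)%R -> (s <= t)%R ->
  smeas (F s) f -> P.-integrable [set: Omega] (EFin \o f) ->
  P.-integrable [set: Omega] (fun w => (f w * (W t w - W s w) ^+ 2)%:E) /\
  \int[P]_w (f w * (W t w - W s w) ^+ 2)%:E =
    (normal_m2 * (t - s))%:E * \int[P]_w (f w)%:E.
Proof.
move=> s0; rewrite le_eqVlt => /predU1P[<-|st] Ff fi.
  have -> : (fun w => (f w * (W s w - W s w) ^+ 2)%:E) = cst 0.
    by apply/funext => w; rewrite subrr expr0n mulr0.
  by rewrite integral0 subrr mulr0 mul0e; split => //; exact: integrable0.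
have [//|||iM ->] := @indep_integralM _ _ _ P f (fun w => (W t w - W s w) ^+ 2)%R.
- by apply: increment_sqr_integrable => //; exact: ltW.
- by apply: (incr_indep (h := fun x => x ^+ 2)%R s0 st Ff) => //; exact: exprn_measurable.
by split => //; rewrite increment_sqr ?(ltW st)// muleC.
Qed.
End brownian_increments.

Section ito_isometry.
Context (R : realType) d (Omega : measurableType d) (P : probability Omega R).
Context (F : R -> set_system Omega) (W : R -> Omega -> R).
Hypotheses (hF : is_filtration F) (hW : is_brownian P F W).
Local Notation mu := (@lebesgue_measure R).

(* The elementary integrand [coef] on the time interval ]lo, hi]; the
   intervals of a family of atoms may overlap. *)
Record atom := Atom { lo : R; hi : R; coef : Omega -> R }.

Definition adapted_atom (e : atom) :=
  [/\ 0 <= lo e, lo e <= hi e, smeas (F (lo e)) (coef e)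
    & exists C : R, forall w, `|coef e w| <= C].

Definition atom_int (e : atom) (w : Omega) := coef e w * (W (hi e) w - W (lo e) w).

Definition atom_val (e : atom) (s : R) (w : Omega) :=
  coef e w * \1_(`]lo e, hi e]) s.

(** The length of the intersection of the two time intervals. *)
Definition overlap (e1 e2 : atom) :=
  Num.max 0 (Num.min (hi e1) (hi e2) - Num.max (lo e1) (lo e2)).

Lemma overlapC e1 e2 : overlap e1 e2 = overlap e2 e1.
Proof. by rewrite /overlap minC maxC [Num.max (lo _) _]maxC maxC. Qed.

Local Open Scope ereal_scope.

Let Fm (t : R) : (0 <= t)%R -> F t `<=` measurable.
Proof. by case: hF => _ h _; exact: h. Qed.

Let Fle (s t : R) : (0 <= s)%R -> (s <= t)%R -> F s `<=` F t.
Proof. by case: hF => _ _; exact. Qed.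

Lemma smeas_bounded_integrable (t C : R) (f : Omega -> R) : (0 <= t)%R ->
  smeas (F t) f -> (forall w, `|f w| <= C)%R ->
  P.-integrable [set: Omega] (EFin \o f).
Proof.
move=> t0 mf fC; apply: measurable_bounded_integrable => //.
- by rewrite (le_lt_trans (probability_le1 P measurableT))// ltry.
- by apply: smeas_measurable mf; exact: Fm.
- exists C; split; first exact: num_real.
  by move=> x Cx w _; exact: le_trans (fC w) (ltW Cx).
Qed.

Lemma adapted_atom_measurable e : adapted_atom e ->
  measurable_fun [set: Omega] (coef e).
Proof. by move=> [e0 _ me _]; apply: smeas_measurable me; exact: Fm. Qed.

Lemma integrable_bounded_mul (C : R) (f g : Omega -> R) :
  measurable_fun [set: Omega] f -> (forall w, `|f w| <= C)%R ->
  P.-integrable [set: Omega] (EFin \o g) ->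
  P.-integrable [set: Omega] (fun w => (f w * g w)%:E).
Proof.
move=> mf fC gi; apply: (integrableMr measurableT mf _ gi).
exists C; split; first exact: num_real.
by move=> x Cx w _; exact: le_trans (fC w) (ltW Cx).
Qed.

(** Write [W c - W a] as [(W b - W a) + (W c - W b)]: the first part gives the conditional variance,
    and the second has mean zero against anything known at time [b]. *)
Lemma increment_pair (a b c : R) (f : Omega -> R) (C : R) :
  (0 <= a)%R -> (a <= b)%R -> (b <= c)%R ->
  smeas (F a) f -> (forall w, `|f w| <= C)%R ->
  P.-integrable [set: Omega]
    (fun w => (f w * (W b w - W a w) * (W c w - W a w))%:E) /\
  \int[P]_w (f w * (W b w - W a w) * (W c w - W a w))%:E =
    (normal_m2 * (b - a))%:E * \int[P]_w (f w)%:E.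
Proof.
move=> a0 ab bc mf fC; have b0 := le_trans a0 ab.
have fi := smeas_bounded_integrable a0 mf fC.
have [i1 E1] := conditional_variance_increment hF hW a0 ab mf fi.
have Fb : smeas (F b) (fun w => f w * (W b w - W a w))%R.
  apply: smeasM; first by apply: smeas_sub mf; exact: Fle.
  apply: smeasB; first exact: (brownian_smeas hF hW).
  by apply: (smeas_sub (Fle a0 ab)); exact: (brownian_smeas hF hW).
have [i0 _] := martingale_increment hF hW a0 ab mf fi.
have [i2 E2] := martingale_increment hF hW b0 bc Fb i0.
have eq : (fun w => (f w * (W b w - W a w) * (W c w - W a w))%:E) =
    (fun w => (f w * (W b w - W a w) ^+ 2)%:E) \+
    (fun w => (f w * (W b w - W a w) * (W c w - W b w))%:E).
  by apply/funext => w /=; rewrite -EFinD; congr EFin; ring.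
split; first by rewrite eq; exact: integrableD.
by rewrite eq integralD// E1 E2 adde0.
Qed.

Lemma atom_isometry e1 e2 : adapted_atom e1 -> adapted_atom e2 ->
  P.-integrable [set: Omega] (fun w => (atom_int e1 w * atom_int e2 w)%:E) /\
  \int[P]_w (atom_int e1 w * atom_int e2 w)%:E =
    (normal_m2 * overlap e1 e2)%:E * \int[P]_w (coef e1 w * coef e2 w)%:E.
Proof.
wlog le12 : e1 e2 / (lo e1 <= lo e2)%R => [wlg a1 a2|].
  have [le12|/ltW le21] := leP (lo e1) (lo e2); first exact: wlg.
  have [] := wlg _ _ le21 a2 a1.
  rewrite overlapC.
  under eq_integral do rewrite mulrC.
  under [X in _ = _ * X -> _]eq_integral do rewrite mulrC.
  by under eq_fun do rewrite mulrC.
move=> [l1 lh1 m1 [C1 b1]] [l2 lh2 m2 [C2 b2]].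
pose f w := (coef e1 w * coef e2 w)%R.
have mf : smeas (F (lo e2)) f.
  by apply: smeasM => //; apply: smeas_sub m1; exact: Fle.
have fC w : (`|f w| <= C1 * C2)%R by rewrite normrM ler_pM.
have fi := smeas_bounded_integrable l2 mf fC.
(* The first interval is cut at [lo e2]: what [W] does on it up to [m] is known at time [lo e2],
   hence uncorrelated with the increment of [e2]. *)
pose m := Num.min (hi e1) (lo e2).
have lm : (lo e1 <= m)%R by rewrite le_min lh1.
have ml : (m <= lo e2)%R by rewrite ge_min lexx orbT.
have [i1 E1] : P.-integrable [set: Omega]
     (fun w => (f w * (W m w - W (lo e1) w) * (W (hi e2) w - W (lo e2) w))%:E) /\
   \int[P]_w (f w * (W m w - W (lo e1) w) * (W (hi e2) w - W (lo e2) w))%:E = 0.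
  apply: (martingale_increment hF hW) => //.
    apply: smeasM => //; apply: smeasB.
      by apply: (smeas_sub (Fle (le_trans l1 lm) ml)); exact: (brownian_smeas hF hW (le_trans l1 lm)).
    by apply: (smeas_sub (Fle l1 le12)); exact: (brownian_smeas hF hW).
  apply: (integrable_bounded_mul _ fC (increment_integrable hF hW l1 lm)).
  by apply: smeas_measurable mf; exact: Fm.
have [h12|h12] := leP (hi e1) (lo e2).
  have mE : m = hi e1 by rewrite /m min_l.
  have -> : overlap e1 e2 = 0%R.
    apply/max_l; rewrite subr_le0 ge_min le_max.
    by rewrite h12 orbT.
  rewrite mulr0 mul0e.
  have eq : (fun w => (atom_int e1 w * atom_int e2 w)%:E) =
      (fun w => (f w * (W m w - W (lo e1) w) * (W (hi e2) w - W (lo e2) w))%:E).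
    by apply/funext => w; rewrite mE /f /atom_int; congr EFin; ring.
  by rewrite eq.
have mE : m = lo e2 by rewrite /m min_r// ltW.
(* After [lo e2] both increments start together and their product is symmetric in the two end
   points, which may therefore be sorted. *)
pose b := Num.min (hi e1) (hi e2); pose c := Num.max (hi e1) (hi e2).
have lb : (lo e2 <= b)%R by rewrite le_min lh2 ltW.
have bc : (b <= c)%R by rewrite ge_min le_max lexx.
have [i2 E2] := increment_pair l2 lb bc mf fC.
have eq : (fun w => (atom_int e1 w * atom_int e2 w)%:E) =
    (fun w => (f w * (W m w - W (lo e1) w) * (W (hi e2) w - W (lo e2) w))%:E) \+
    (fun w => (f w * (W b w - W (lo e2) w) * (W c w - W (lo e2) w))%:E).
  apply/funext => w /=; rewrite -EFinD mE /f /atom_int /b /c; congr EFin.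
  by have [_|_] := leP (hi e1) (hi e2); ring.
split; first by rewrite eq; exact: integrableD.
rewrite eq integralD// E1 E2 add0e /overlap (max_r le12) -/b max_r//.
by rewrite subr_ge0.
Qed.

Lemma integral_overlap (T : R) (e1 e2 : atom) : (0 <= lo e1)%R ->
  (hi e1 <= T)%R ->
  mu.-integrable `[0%R, T] (fun s =>
    (\1_(`]lo e1, hi e1]) s * \1_(`]lo e2, hi e2]) s : R)%:E) /\
  \int[mu]_(s in `[0%R, T])
    (\1_(`]lo e1, hi e1]) s * \1_(`]lo e2, hi e2]) s : R)%:E =
  (overlap e1 e2)%:E.
Proof.
move=> l1 h1.
pose I := `]Num.max (lo e1) (lo e2), Num.min (hi e1) (hi e2)]%classic.
have eq : (fun s => (\1_(`]lo e1, hi e1]) s * \1_(`]lo e2, hi e2]) s : R)%:E) =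
    (fun s => (\1_I s)%:E).
  apply/funext => s; congr EFin; rewrite !indicE -natrM mulnb; congr (_%:R).
  by rewrite !mem_setE !in_itv/= gt_max le_min andbACA.
rewrite eq.
have mI : measurable I by exact: measurable_itv.
split.
  exact: (integrableS measurableT _ _ (@integrable_indic_itv R _ _ _ _)).
rewrite integral_indic// setIidl; last first.
  move=> s; rewrite /I/= !in_itv/= gt_max le_min => /andP[/andP[a _] /andP[b _]].
  by rewrite (le_trans l1 (ltW a)) (le_trans b h1).
rewrite [LHS]lebesgue_measure_itv/= lte_fin /overlap.
set M := Num.max (lo e1) _; set m := Num.min _ _.
have [h|h] := ltP M m; first by rewrite max_r// subr_ge0 ltW.
by rewrite max_l// subr_le0.
Qed.

Section atom_sums.
Context (I : finType) (e : I -> atom) (T : R).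
Hypothesis ae : forall i, adapted_atom (e i).
Hypothesis hT : forall i, (hi (e i) <= T)%R.

(** Expanding the squares reduces both sides to pairs of atoms. Since atoms may overlap, integrands
    living on different grids are combined without a common refinement. *)
Lemma ito_isometry :
  \int[P]_w ((\sum_i atom_int (e i) w) ^+ 2)%:E =
  normal_m2%:E * \int[P]_w \int[mu]_(s in `[0%R, T])
     ((\sum_i atom_val (e i) s w) ^+ 2)%:E.
Proof.
have sqr_sum (x : I -> R) :
    ((\sum_i x i) ^+ 2 = \sum_(p : I * I) x p.1 * x p.2)%R.
  by rewrite expr2 big_distrlr/= pair_big.
under eq_integral do rewrite sqr_sum -sumEFin.
rewrite integral_sum//; last by move=> p; exact: (atom_isometry (ae p.1) (ae p.2)).1.
have mc i : measurable_fun [set: Omega] (coef (e i)) by exact: adapted_atom_measurable.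
transitivity (normal_m2%:E * \int[P]_w (\sum_(p : I * I)
    (overlap (e p.1) (e p.2))%:E * (coef (e p.1) w * coef (e p.2) w)%:E)).
  have ic (p : I * I) : P.-integrable [set: Omega]
      (fun w => (coef (e p.1) w * coef (e p.2) w)%:E).
    case: (ae p.1) => [l0 _ m1 [C1 b1]]; case: (ae p.2) => l0' _ m2 [C2 b2].
    apply: (integrable_bounded_mul (C := C1)) => //.
    exact: smeas_bounded_integrable m2 b2.
  rewrite integral_sum//; last by move=> p; exact: integrableZl.
  rewrite fin_num_sume_distrr//; last first.
    move=> p q _ _; apply: fin_num_adde_defl.
    by apply: integrable_fin_num => //; exact: integrableZl.
  apply: eq_bigr => p _; rewrite (atom_isometry (ae p.1) (ae p.2)).2.
  by rewrite integralZl// muleA -EFinM.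
congr (_ * _); apply: eq_integral => w _.
have io (p : I * I) := integral_overlap (e p.2) (let: And4 h _ _ _ := ae p.1 in h) (hT p.1).
transitivity (\int[mu]_(s in `[0%R, T]) \sum_(p : I * I)
   ((coef (e p.1) w * coef (e p.2) w)%:E * 
   (\1_(`]lo (e p.1), hi (e p.1)]) s * \1_(`]lo (e p.2), hi (e p.2)]) s : R)%:E)).
  rewrite integral_sum//; last by move=> p; apply: integrableZl => //; exact: (io p).1.
  apply: eq_bigr => p _; rewrite integralZl//; last exact: (io p).1.
  by rewrite (io p).2 muleC.
apply: eq_integral => s _; rewrite sqr_sum -sumEFin; apply: eq_bigr => p _.
by rewrite -EFinM /atom_val; congr EFin; ring.
Qed.
End atom_sums.
End ito_isometry.

(** * Stopping a path at the nonpositive half-line *)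

Section paths.
Context {R : realType}.
Implicit Types (p q : R -> R) (s t : R) (C : set R).

(** Freezing the path at its value at 0 for negative times turns continuity on the half-line into
    continuity on the line, the form in which all path arguments are carried out. *)
Lemma within_ge0_continuous p :
  {within `[0, +oo[, continuous p} -> continuous (fun t => p (Num.max 0 t)).
Proof.
move=> cp x.
have mc : continuous (fun t : R => Num.max 0 t).
  by move=> y; apply: continuous_max; [exact: cst_continuous|exact: cvg_id].
have /(_ (Num.max 0 x)) := cp.
rewrite /continuous_at /= => cpx U /cpx /=.
rewrite /nbhs/= -nbhs_subspace_in; last first.
  by rewrite /= in_itv/= le_max lexx.
move=> H; have Hm := mc x _ H.
change (\forall t \near x, U (p (Num.max 0 t))).
refine (@filterS R (nbhs (x : R)) _ _ _ _ Hm) => y /=; apply.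
by rewrite in_itv/= le_max lexx.
Qed.

Lemma continuous_within_ge0 p q : continuous q ->
  (forall t, 0 <= t -> p t = q t) -> {within `[0, +oo[, continuous p}.
Proof.
move=> cq pq; have : {within `[0, +oo[, continuous q} by exact: continuous_subspaceT.
apply: subspace_eq_continuous => t; rewrite inE/= in_itv/= andbT => t0.
exact/esym/pq.
Qed.

Lemma near_dist (x : R) (Q : R -> Prop) : (\forall y \near x, Q y) ->
  exists2 e : R, 0 < e & forall y, `|x - y| < e -> Q y.
Proof. by move=> /nbhs_ballP[e /= e0 he]; exists e. Qed.

Lemma archi_inv_lt (x : R) : 0 < x -> exists n : nat, n.+1%:R^-1 < x.
Proof.
move=> x0; exists (Num.trunc x^-1).
rewrite invf_plt ?posrE//.
exact: truncnS_gt.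
Qed.

Lemma first_hit q C s : continuous q -> closed C -> 0 <= s -> C (q s) ->
  exists tau : R, [/\ 0 <= tau, tau <= s, C (q tau)
    & forall r : R, 0 <= r -> r < tau -> ~ C (q r)].
Proof.
move=> cq cC s0 Cs.
pose S := [set r : R | 0 <= r] `&` q @^-1` C.
have cS : closed S.
  apply: closedI; first exact: closed_ge.
  by apply: preimage_closed => // x _; exact: cq.
have S0 : S !=set0 by exists s.
have lS : has_lbound S by exists 0 => r [].
have hS : has_inf S by [].
have SI : S (inf S).
  apply: (itv_closed_infimums S0 cS); split; first by move=> x Sx; exact: ge_inf.
  by move=> x Sx; exact: lb_le_inf.
exists (inf S); split.
- by case: SI.
- exact: ge_inf.
- by case: SI.
- by move=> r r0 rS Cr; have := ge_inf lS (conj r0 Cr); rewrite leNgt rS.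
Qed.

Lemma last_hit q C s t : continuous q -> closed C -> s <= t -> C (q s) ->
  exists tau : R, [/\ s <= tau, tau <= t, C (q tau)
    & forall r : R, tau < r -> r <= t -> ~ C (q r)].
Proof.
move=> cq cC st Cs.
have cqt : continuous (fun r => q (t - r)).
  move=> x; apply: (@continuous_comp _ _ _ (fun r => t - r) q); last exact: cq.
  by apply: cvgB; [exact: cvg_cst|exact: cvg_id].
have [||tau [tau0 taus Ct h]] := @first_hit _ C (t - s) cqt cC.
- by rewrite subr_ge0.
- by rewrite subKr.
exists (t - tau); split => //; [lra|lra|].
move=> r tr rt Cr; apply: (h (t - r)); [lra|lra|].
by rewrite subKr.
Qed.

Lemma first_hit_le0 q (tau : R) : continuous q -> 0 < q 0 -> 0 <= tau -> q tau <= 0 ->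
  (forall r : R, 0 <= r -> r < tau -> 0 < q r) -> q tau = 0.
Proof.
move=> cq q0 tau0 qtau h; apply/eqP; rewrite eq_le qtau/= leNgt; apply/negP => qt.
have tp : 0 < tau by rewrite lt_neqAle tau0 andbT; apply/negP => /eqP e; move: q0 qt; rewrite e; lra.
have [e e0 he] := near_dist (cvgr_lt (q tau) (cq tau) 0 qt).
(* If [q tau < 0], then [q] is already negative slightly before [tau], against the positivity
   there. *)
pose r := Num.max 0 (tau - e / 2).
have [r0 rt] : 0 <= r /\ r < tau.
  by split; [rewrite le_max lexx|rewrite gt_max tp/=; lra].
have : q r < 0.
  apply: he; rewrite gtr0_norm; last by rewrite subr_gt0.
  have : tau - e / 2 <= r by rewrite le_max lexx orbT.
  lra.
by have := h r r0 rt; lra.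
Qed.

(* [stopped p] is [p] stopped when it first reaches ]-oo, 0]: its value is then
   [p 0] if [p 0 <= 0] and [0] otherwise.  Rational times keep [hits] and [stopped]
   measurable for the cylinder sigma-algebra. *)
Definition hits p t : Prop :=
  forall n : nat, exists r : rat,
    [/\ 0 <= (ratr r : R), ratr r <= t & p (ratr r) < n.+1%:R^-1].

Definition stopped p t : R := if `[< hits p t >] then Num.min (p 0) 0 else p t.

(** One way is compactness: a positive minimum over [[0, t]] would exceed some [n.+1%:R^-1]. The
    other way picks rational times of [[0, t]] close to the hitting time. *)
Lemma hitsP p q t : continuous q -> (forall s, 0 <= s -> p s = q s) -> 0 <= t ->
  hits p t <-> exists s, [/\ 0 <= s, s <= t & q s <= 0].
Proof.
move=> cq pq t0; split => [h|[s [s0 st qs]] n].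
  have [|c /itvP ct qc] := @EVT_min R q 0 t t0; first exact: continuous_subspaceT.
  exists c; split; [by rewrite ct|by rewrite ct|].
  rewrite leNgt; apply/negP => qc0.
  have [n] := archi_inv_lt qc0.
  have [r [r0 rt]] := h n; rewrite pq// => qr nq.
  have := qc (ratr r); rewrite in_itv/= r0 rt => /(_ isT).
  by move: qr nq; move: n.+1%:R^-1 => v; lra.
have n0 : 0 < n.+1%:R^-1 :> R by rewrite invr_gt0.
have [e e0 he] := near_dist (cvgr_lt (q s) (cq s) _ (le_lt_trans qs n0)).
(* No rational lies strictly inside [[0, 0]]; there the rational 0 itself serves. *)
have [t00|tp] := eqVneq t 0.
  exists 0; rewrite rmorph0; split => //.
  have s00 : s = 0 by lra.
  by rewrite pq// -s00 (le_lt_trans qs).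
have t0' : 0 < t by rewrite lt_neqAle eq_sym tp.
have lt : Num.max 0 (s - e) < Num.min t (s + e).
  by rewrite gt_max !lt_min t0'/=; apply/and3P; split; lra.
have [r] := rat_in_itvoo lt.
rewrite in_itv/= gt_max lt_min => /andP[/andP[r0 r1] /andP[r2 r3]].
exists r; split; [exact: ltW|exact: ltW|].
rewrite pq ?ltW//; apply: he; rewrite ltr_norml; lra.
Qed.

Lemma stopped_ext p q : (forall t, 0 <= t -> p t = q t) ->
  forall t, 0 <= t -> stopped p t = stopped q t.
Proof.
move=> pq t t0; rewrite /stopped; have -> : hits p t = hits q t.
  by apply/propext; split => h n; have [r [r0 rt pr]] := h n; exists r; split => //;
     [rewrite -pq|rewrite pq].
by rewrite !pq.
Qed.

(** At the hitting time the path sits at [q 0] if it starts nonpositive (then [tau = 0]) and at 0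
    otherwise. So the absorbed value [Num.min (q 0) 0] is known without knowing [tau], and [stopped]
    can be defined without any hitting time. *)
Lemma stoppedE p q : continuous q -> (forall s, 0 <= s -> p s = q s) ->
  ((forall t, 0 <= t -> 0 < q t) /\ (forall t, 0 <= t -> stopped p t = q t)) \/
  exists tau : R, [/\ 0 <= tau, q tau = Num.min (q 0) 0,
    forall r : R, 0 <= r -> r < tau -> 0 < q r &
    forall t, 0 <= t -> stopped p t = q (Num.min t tau)].
Proof.
move=> cq pq.
have [[s [s0 qs]]|nh] := pselect (exists s : R, 0 <= s /\ q s <= 0); last first.
  have q0 t : 0 <= t -> 0 < q t.
    by move=> t0; rewrite ltNge; apply/negP => qt; apply: nh; exists t.
  left; split=> // t t0; rewrite /stopped asboolF ?pq// => /(hitsP cq pq t0)[s [s0 _ qs]].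
  by apply: nh; exists s.
right.
have [tau [tau0 _ Ct h]] := first_hit cq (@closed_le R 0) s0 qs.
have h' (r : R) : 0 <= r -> r < tau -> 0 < q r.
  by move=> r0 rt; rewrite ltNge; apply/negP; exact: h.
have qtau : q tau = Num.min (q 0) 0.
  have [q0|q0] := leP (q 0) 0.
    have -> // : tau = 0.
    apply/eqP; rewrite eq_le tau0 andbT leNgt; apply/negP => tp.
    by have := h' 0 (lexx _) tp; lra.
  exact: first_hit_le0.
exists tau; split => // t t0.
rewrite /stopped; have [tt|tt] := leP tau t.
  by rewrite asboolT ?pq//; apply/(hitsP cq pq t0); exists tau.
rewrite asboolF ?pq// => /(hitsP cq pq t0)[r [r0 rt qr]].
have := h' r r0 (le_lt_trans rt tt); lra.
Qed.

Lemma stopped_continuous p :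
  {within `[0, +oo[, continuous p} -> {within `[0, +oo[, continuous (stopped p)}.
Proof.
move=> /within_ge0_continuous; set q := fun t => p _ => cq.
have pq s : 0 <= s -> p s = q s by move=> s0; rewrite /q max_r.
have [[_ h]|[tau [_ _ _ h]]] := stoppedE cq pq.
  exact: continuous_within_ge0 h.
apply: continuous_within_ge0 h => x.
apply: (@continuous_comp _ _ _ (fun t => Num.min t tau) q); last exact: cq.
by apply: continuous_min; [exact: cvg_id|exact: cst_continuous].
Qed.

Lemma stopped0 p : stopped p 0 = p 0.
Proof.
rewrite /stopped; case: asboolP => // h; apply/min_l.
rewrite leNgt; apply/negP => p0.
have [n] := archi_inv_lt p0.
have [r [r0 rt]] := h n.
have -> : ratr r = 0 :> R by apply/eqP; rewrite eq_le r0 rt.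
by move: n.+1%:R^-1 => v; lra.
Qed.
End paths.

Section cylinders.
Context {R : realType}.

(** [J] is [[0, t]] when adaptedness is at stake and [[0, +oo[] for laws. *)
Definition cylinders (J : set R) : set_system (R -> R) :=
  <<s \bigcup_(u in J) preimage_set_system [set: R -> R] (@^~ u) (@measurable _ R) >>.

Lemma cylinders_eval (J : set R) (u : R) : J u -> smeas (cylinders J) (fun p : R -> R => p u).
Proof.
move=> Ju; apply/smeasP; first exact: smallest_sigma_algebra.
by move=> A HA; apply: sub_sigma_algebra; exists u.
Qed.

Lemma stopped_smeas (J : set R) (t : R) : 0 <= t -> `[0, t] `<=` J ->
  smeas (cylinders J) (fun p => stopped p t).
Proof.
move=> t0 tJ.
have J0 : J 0 by apply: tJ; rewrite /= in_itv/= lexx.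
have Jt : J t by apply: tJ; rewrite /= in_itv/= lexx andbT.
rewrite /smeas /stopped; apply: measurable_fun_ifT; last 2 first.
- apply: (@measurable_minr _ (g_sigma_algebraType (cylinders J)) R setT (fun p : R -> R => p 0) (cst 0)).
    exact: cylinders_eval.
  exact: measurable_cst.
- exact: cylinders_eval.
apply: (measurable_fun_bool true); rewrite setTI.
have -> : (fun p : R -> R => `[< hits p t >]) @^-1` [set true] =
    \bigcap_n \bigcup_(r : rat) [set p : R -> R |
      [/\ 0 <= (ratr r : R), ratr r <= t & p (ratr r) < n.+1%:R^-1]].
  apply/seteqP; split => p /=.
    by move=> /asboolP h n _; have [r hr] := h n; exists r.
  by move=> h; apply/asboolP => n; have [r _ hr] := h n Logic.I; exists r.
apply: (@bigcapT_measurable _ (g_sigma_algebraType (cylinders J))) => n.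
apply: (@bigcupT_measurable_rat _ (g_sigma_algebraType (cylinders J))) => r.
have [/andP[r0 rt]|nr] := boolP ((0 <= (ratr r : R)) && (ratr r <= t)).
  have -> : [set p : R -> R |
      [/\ 0 <= (ratr r : R), ratr r <= t & p (ratr r) < n.+1%:R^-1]] =
      setT `&` (fun p : R -> R => p (ratr r)) @^-1` `]-oo, n.+1%:R^-1[.
    apply/seteqP; split => p /=; rewrite in_itv/=; first by case.
    by case.
  apply: (cylinders_eval (J := J)) => //.
  by apply: tJ; rewrite /= in_itv/= r0 rt.
rewrite [X in measurable X](_ : _ = set0)//.
by apply/seteqP; split => // p [r0 rt _]; rewrite r0 rt in nr.
Qed.

Lemma cylinders_preimage (T : Type) (G : set_system T) (J : set R)
  (Z : T -> R -> R) : sigma_algebra [set: T] G ->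
  (forall u, J u -> preimage_set_system [set: T] (fun w => Z w u) measurable `<=` G) ->
  forall E, cylinders J E -> G (Z @^-1` E).
Proof.
move=> sG ZG; apply: smallest_sub.
  have [G0 GC GU] := sG; split => [|A GA|A GA] /=.
  - by rewrite preimage_set0.
  - by rewrite setTD preimage_setC -setTD; exact: GC.
  - by rewrite preimage_bigcup; exact: GU.
move=> _ [u Ju] [B mB <-]; apply: (ZG u Ju).
by exists B.
Qed.
End cylinders.

Section independence_pi_system.
Context (R : realType) d (T : measurableType d) (P : probability T R).

(** For fixed [B], the measurable sets independent of [B] form a Dynkin system. *)
Lemma independent_pi_system (S H : set_system T) : setI_closed S ->
  S `<=` measurable -> H `<=` measurable ->
  independent_systems P S H -> independent_systems P <<s S >> H.
Proof.
move=> SI Sm Hm SH A B SA HB.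
have mB := Hm _ HB.
pose L := [set A | measurable A /\ P (A `&` B) = (P A * P B)%E].
suff : <<s S >> `<=` L by move=> /(_ A SA)[].
rewrite -setI_closed_g_dynkin_g_sigma_algebra//.
apply: smallest_sub; last by move=> C SC; split; [exact: Sm|exact: SH].
split => [|C [mC CE]|C tC LC].
- by split => //; rewrite setTI probability_setT mul1e.
- split; first exact: measurableC.
  rewrite setIC -setDE measureD//; last first.
    by rewrite (le_lt_trans (probability_le1 P _)) ?ltry.
  rewrite [X in (_ - P X)%E]setIC CE.
  by rewrite probability_setC// muleBl ?mul1e// fin_num_measure.
have mC n : measurable (C n) by case: (LC n).
split; first exact: bigcupT_measurable.
rewrite setI_bigcupl measure_bigcup//; last 2 first.
- by move=> n _; exact: measurableI.
- exact: trivIset_setIr.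
rewrite measure_bigcup//.
rewrite [RHS]muleC -(fineK (fin_num_measure P B mB)) -nneseriesZl//.
apply: eq_eseriesr => n _; rewrite fineK ?fin_num_measure// muleC.
by case: (LC n).
Qed.
End independence_pi_system.

(** * The filtration generated by the initial value and the Brownian motion *)

Section generated_filtration.
Context (R : realType) d (Omega : measurableType d) (P : probability Omega R).
Context (F : R -> set_system Omega) (W : R -> Omega -> R) (zeta : {RV P >-> R}).
Hypotheses (hF : is_filtration F) (hW : is_brownian P F W).
Local Notation G := (generated_filtration zeta W).

Lemma generated_sigma_algebra t : sigma_algebra [set: Omega] (G t).
Proof. exact: smallest_sigma_algebra. Qed.

Lemma sub_measurable (S : set_system Omega) : S `<=` measurable -> <<s S >> `<=` measurable.
Proof. by move=> h; apply: smallest_sub => //; exact: sigma_algebra_measurable. Qed.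

Lemma sigma_of_measurable (f : Omega -> R) : measurable_fun [set: Omega] f ->
  sigma_of f `<=` measurable.
Proof. by move=> mf _ [B mB <-]; exact: mf. Qed.

Lemma generated_is_filtration : is_filtration G.
Proof.
split=> [t _|t t0|s t s0 st].
- exact: generated_sigma_algebra.
- apply: sub_measurable => A [|[u /= /andP[u0 _]]].
    by apply: sigma_of_measurable; exact: measurable_funP.
  apply: sigma_of_measurable.
  exact: (brownian_measurable hF hW).
- apply: sub_sigma_algebra2; apply: setUS => A [u /= us Au]; exists u => //.
  move: us => /=; rewrite !in_itv/= => /andP[-> us]/=; exact: le_trans st.
Qed.

Lemma generated_smeas0 t : smeas (G t) zeta.
Proof.
apply/smeasP; first exact: generated_sigma_algebra.
by move=> A HA; apply: sub_sigma_algebra; left.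
Qed.

Lemma generated_smeas t u : 0 <= u -> u <= t -> smeas (G t) (W u).
Proof.
move=> u0 ut; apply/smeasP; first exact: generated_sigma_algebra.
move=> A HA; apply: sub_sigma_algebra; right; exists u => //.
by rewrite /= in_itv/= u0.
Qed.

Hypothesis hind : independent_systems P (sigma_of zeta) (sigma_process W).

(** Here the independence of [zeta] and [W] enters. Intersections of an event [A] of [zeta] with an
    event [B] of the past of [W] form a pi-system generating [G s]. Against an event [C] of the
    increment, [hind] splits off [A], the Brownian property for [F] separates [B] from [C], and
    [hind] recombines [A] with [B]. *)
Lemma brownian_generated : is_brownian P G W.
Proof.
have [Wc Wa W0 Wi Wn] := hW; split => //.
  by move=> t t0; apply/(smeasP _ (generated_sigma_algebra t)); exact: generated_smeas.
move=> s t s0 st.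
pose S := <<s \bigcup_(u in `[0, s]) sigma_of (W u) >>.
pose Pi := [set C | exists A B, [/\ sigma_of zeta A, S B & C = A `&` B]].
have sZ : sigma_algebra [set: Omega] (sigma_of zeta).
  by apply: sigma_algebra_preimage; exact: sigma_algebra_measurable.
have sS : sigma_algebra [set: Omega] S by exact: smallest_sigma_algebra.
have SF : S `<=` F s.
  apply: smallest_sub; first by case: hF => h _ _; exact: h.
  move=> A [u /=]; rewrite in_itv/= => /andP[u0 us] /(Wa u u0).
  by case: hF => _ _; apply.
have SW : S `<=` sigma_process W.
  apply: sub_sigma_algebra2 => A [u /=]; rewrite in_itv/= => /andP[u0 us] h.
  by exists u => //; rewrite /= in_itv/= u0.
have ZP A : sigma_of zeta A -> measurable A.
  by apply: sigma_of_measurable; exact: measurable_funP.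
have SP A : S A -> measurable A.
  by move=> /SF; case: hF => _ + _; apply.
have t0 := le_trans s0 (ltW st).
have DP : sigma_of (W t \- W s) `<=` measurable.
  by apply: sigma_of_measurable; exact: (increment_measurable hF hW).
have DW : sigma_of (W t \- W s) `<=` sigma_process W.
  apply/(smeasP _ (smallest_sigma_algebra _ _)).
  apply: smeasB; apply/smeasP; try exact: smallest_sigma_algebra.
    by move=> A HA; apply: sub_sigma_algebra; exists t => //; rewrite /= in_itv/= t0.
  by move=> A HA; apply: sub_sigma_algebra; exists s => //; rewrite /= in_itv/= s0.
have PiI : setI_closed Pi.
  move=> _ _ [A [B [ZA SB ->]]] [A' [B' [ZA' SB' ->]]].
  exists (A `&` A'), (B `&` B'); split; last by rewrite setIACA.
  - by have [_ _ _ + ] := (sigma_algebraP (fun X _ => @subsetT _ X)).1 sZ; apply.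
  - by have [_ _ _ + ] := (sigma_algebraP (fun X _ => @subsetT _ X)).1 sS; apply.
have T1 : sigma_of zeta setT by exists setT => //; rewrite setTI preimage_setT.
have T2 : S setT.
  by have [+ _ _ _] := (sigma_algebraP (fun X _ => @subsetT _ X)).1 sS.
have GPi : G s `<=` <<s Pi >>.
  apply: sub_sigma_algebra2 => A [ZA|SA].
    by exists A, setT; rewrite setIT.
  exists setT, A; rewrite setTI; split => //; exact: sub_sigma_algebra.
suff : independent_systems P <<s Pi >> (sigma_of (W t \- W s)).
  by move=> h A B /GPi; exact: h.
apply: independent_pi_system => //.
  by move=> _ [A [B [/ZP mA /SP mB ->]]]; exact: measurableI.
move=> _ C [A [B [ZA SB ->]]] HC.
rewrite -setIA hind//; last first.
  have [_ _ _ sI] := (sigma_algebraP (fun X _ => @subsetT _ X)).1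
    (smallest_sigma_algebra setT (\bigcup_(u in `[0, +oo[) sigma_of (W u))).
  by apply: sI; [exact: SW|exact: DW].
rewrite (Wi s t s0 st)//; last exact: SF.
by rewrite hind ?muleA//; exact: SW.
Qed.
End generated_filtration.

Section clamped_simple_process.
Context (R : realType) d (Omega : measurableType d) (P : probability Omega R).
Context (F : R -> set_system Omega) (W : R -> Omega -> R).
Hypotheses (hF : is_filtration F).

Let Fle (s t : R) : 0 <= s -> s <= t -> F s `<=` F t.
Proof. by case: hF => _ _; exact. Qed.

Lemma sp_time_nonneg (H : simple_process F) i : (i <= sp_size H)%N ->
  0 <= sp_time H i.
Proof.
elim: i => [_|i ih iH]; first exact: sp_time_ge0.
by rewrite (le_trans (ih (ltnW iH)))// sp_time_le.
Qed.

Definition clamp (a b x : R) := Num.max a (Num.min b x).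

(** For any function of time, clamping to [[a, b]] amounts to stopping at [b] minus stopping at [a],
    up to the constant [f a], which cancels in increments. This matches clamped steps with the
    difference of [simple_integral] at [b] and at [a]. *)
Lemma clampE (f : R -> R) (a b x : R) : a <= b ->
  f (clamp a b x) = f (Num.min b x) + f a - f (Num.min a x).
Proof.
move=> ab; rewrite /clamp.
have [xa|ax] := leP x a.
  by rewrite (min_r (le_trans xa ab)) (max_l xa); ring.
by rewrite max_r ?addrK// le_min ab ltW.
Qed.

(* The part on ]a, b] of the [i]-th step of [g * H].  The test makes the
   coefficient measurable at time [b] when the step begins after [b]. *)
Definition clamped_atom (g : Omega -> R) (a b : R) (H : simple_process F)
    (i : 'I_(sp_size H)) : atom R Omega :=
  Atom (clamp a b (sp_time H i)) (clamp a b (sp_time H i.+1))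
    (fun w => if sp_time H i < b then g w * sp_coef H i w else 0).

Context (g : Omega -> R) (a b C : R) (H : simple_process F).
Hypotheses (a0 : 0 <= a) (ab : a <= b).
Hypotheses (mg : smeas (F a) g) (gC : forall w, `|g w| <= C).

Lemma clamped_atom_adapted (i : 'I_(sp_size H)) : adapted_atom F (clamped_atom g a b i).
Proof.
have aa x : a <= clamp a b x by rewrite le_max lexx.
have t0 : 0 <= sp_time H i by apply: sp_time_nonneg; exact: ltnW.
split => /=.
- exact: le_trans (aa _).
- rewrite /clamp ge_max le_max lexx/= le_max; apply/orP; right.
  by rewrite le_min !ge_min lexx/= sp_time_le// orbT.
- have [tb|tb] := ltP (sp_time H i) b; last exact: smeas_cst.
  apply: smeasM; first by apply: smeas_sub mg; exact: Fle.
  apply: (@smeas_sub _ _ (F (sp_time H i))).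
    by apply: Fle => //; rewrite le_max (min_r (ltW tb)) lexx orbT.
  apply/smeasP; last exact: sp_coef_adapted.
  by case: hF => h _ _; exact: h.
- have [D hD] := sp_coef_bounded H.
  exists (C * `|D|) => w; case: ifP => _; last first.
    rewrite normr0 mulr_ge0//; exact: le_trans (gC w).
  by rewrite normrM ler_pM// (le_trans (hD i w _)) ?ler_norm.
Qed.

Lemma clamped_atom_hi (i : 'I_(sp_size H)) : hi (clamped_atom g a b i) <= b.
Proof. by rewrite /= ge_max ab ge_min lexx. Qed.

(** With its counterpart [sum_clamped_atom_val], this presents [g] times an elementary integral over
    []a, b]] as a sum of adapted atoms, whose mean and isometry are known. *)
Lemma sum_clamped_atom_int w :
  \sum_i atom_int W (clamped_atom g a b (H := H) i) w =
  g w * (simple_integral W H b w - simple_integral W H a w).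
Proof.
rewrite -sumrB mulr_sumr; apply: eq_bigr => i _.
rewrite /atom_int/= !(clampE (W^~ w) _ ab).
have [tb|tb] := ltP (sp_time H i) b; first by ring.
have tb' := le_trans tb (sp_time_le (ltn_ord i)).
have h (u : R) : b <= u -> Num.min a u = a by move=> bu; rewrite min_l// (le_trans ab).
by rewrite !min_l ?(le_trans ab)//; ring.
Qed.

Lemma sum_clamped_atom_val s w :
  \sum_i atom_val (clamped_atom g a b (H := H) i) s w =
  g w * \1_(`]a, b]) s * simple_val H s w.
Proof.
rewrite mulr_sumr; apply: eq_bigr => i _; rewrite /atom_val/= !indicE !mem_setE !in_itv/=.
have [tb|tb] := ltP (sp_time H i) b.
  rewrite -!mulrA; congr (_ * _); rewrite mulrCA; congr (_ * _).
  rewrite -natrM mulnb; congr (_%:R); congr nat_of_bool.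
  rewrite gt_max le_max (min_r (ltW tb)) le_min.
  by have [sa|sa] := leP s a => //=; exact: andbCA.
rewrite mul0r.
have [sb|sb] := leP s b; last by rewrite andbF mulr0 mul0r.
by rewrite [sp_time H i < s]ltNge (le_trans sb tb)/= !mulr0.
Qed.
End clamped_simple_process.

Lemma sqrD_le {R : realType} (x y : R) : (x + y) ^+ 2 <= 2 * x ^+ 2 + 2 * y ^+ 2.
Proof. have := sqr_ge0 (x - y); lra. Qed.

(** * Joint measurability in time and outcome *)

Section joint_measurability.
Context (R : realType) d (Omega : measurableType d).
Implicit Types X : R -> Omega -> R.
Local Notation mu := (@lebesgue_measure R).

Lemma cvg_near_le (u : nat -> R) (l : R) (v : nat -> R) :
  v @ \oo --> 0 -> (\forall n \near \oo, `|u n - l| <= v n) -> u @ \oo --> l.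
Proof.
move=> v0 uv; apply/cvgrPdist_le => e e0; near=> n.
rewrite distrC; apply: (@le_trans _ _ (v n)); first by near: n.
by near: n; exact: cvgr_le v0 _ e0.
Unshelve. all: by end_near. Qed.

(** By continuity of paths, [X] is the limit of its values at the last multiple of [n.+1%:R^-1]
    before the time. Each approximation is a single random variable on each of countably many time
    slices. *)
Lemma joint_measurable X : continuous_paths X ->
  (forall t, 0 <= t -> measurable_fun [set: Omega] (X t)) ->
  measurable_fun [set: Omega * measurableTypeR R]
    (fun z : Omega * measurableTypeR R => X (Num.max 0 z.2) z.1).
Proof.
move=> cX mX.
pose k (n : nat) (s : R) : nat := Num.trunc (n.+1%:R * Num.max 0 s).
pose Xn (n : nat) (z : Omega * measurableTypeR R) :=
  X ((k n z.2)%:R / n.+1%:R) z.1.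
have k_itv n s : (k n s)%:R <= n.+1%:R * Num.max 0 s < (k n s).+1%:R.
  by apply: truncn_itv; rewrite mulr_ge0// le_max lexx.
apply: (@measurable_fun_cvg _ _ R setT Xn); last first.
  move=> [w s] _ /=.
  have cq := within_ge0_continuous (cX w).
  have -> : (fun n => Xn n (w, s)) =
      (fun n => X (Num.max 0 ((k n s)%:R / n.+1%:R)) w).
    by apply/funext => n; rewrite max_r// divr_ge0.
  have -> : X (Num.max 0 s) w = X (Num.max 0 (Num.max 0 s)) w.
    by rewrite [in RHS]max_r// le_max lexx.
  apply: (@cvg_comp _ _ _ (fun n => (k n s)%:R / n.+1%:R : R)
    (fun t => X (Num.max 0 t) w) _ _ _ _ (cq (Num.max 0 s))).
  apply: (cvg_near_le (@cvg_harmonic R)); near=> n.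
  have n0 : 0 < n.+1%:R :> R by [].
  have /andP[k1 k2] := k_itv n s.
  rewrite distrC ger0_norm; last by rewrite subr_ge0 ler_pdivrMr// mulrC.
  rewrite -(ler_pM2r n0) mulrBl divfK ?gt_eqF// /harmonic mulVf ?gt_eqF//.
  by rewrite lerBlDr addrC natr1 mulrC ltW.
move=> n _ B mB; rewrite setTI.
have -> : Xn n @^-1` B = \bigcup_(i : nat)
    ((X (i%:R / n.+1%:R) @^-1` B) `*` (k n @^-1` [set i])).
  apply/seteqP; split => [[w s]/= h|[w s] [i _ [/= h1 h2]]].
    by exists (k n s).
  by rewrite /Xn /= h2.
apply: bigcup_measurable => i _; apply: measurableX.
  by rewrite -[X in measurable X]setTI; apply: mX => //; rewrite divr_ge0.
have -> : k n @^-1` [set i] =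
    setT `&` (fun s : R => n.+1%:R * Num.max 0 s) @^-1` `[i%:R, i.+1%:R[.
  apply/seteqP; split => s /=; rewrite in_itv/=.
    by move=> <-; split => //; exact: k_itv.
  by move=> [_ h]; apply/eqP; rewrite truncn_eq// mulr_ge0// le_max lexx.
have mm : measurable_fun [set: R] (fun s : R => n.+1%:R * Num.max 0 s).
  apply: measurable_funM; first exact: measurable_cst.
  by apply: (@measurable_maxr _ _ _ _ (cst 0) id) => //; exact: measurable_cst.
exact: mm.
Unshelve. all: by end_near. Qed.

Lemma measurable_inner_integral (f : Omega * measurableTypeR R -> \bar R) (T : R) :
  measurable_fun [set: Omega * measurableTypeR R] f -> (forall z, 0 <= f z)%E ->
  measurable_fun [set: Omega] (fun w => \int[mu]_(s in `[0%R, T]) f (w, s))%E.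
Proof.
move=> mf f0.
pose g z := (f z * (\1_(`[0, T]) z.2)%:E)%E.
have mg : measurable_fun [set: Omega * measurableTypeR R] g.
  apply: emeasurable_funM => //; apply/measurable_EFinP.
  apply: measurableT_comp; last exact: measurable_snd.
  exact: measurable_indic.
have g0 z : (0 <= g z)%E by rewrite mule_ge0.
rewrite (_ : (fun w => _) = fubini_F mu g).
  exact: measurable_fun_fubini_tonelli_F.
apply/funext => w; rewrite integral_mkcond /fubini_F; apply: eq_integral => s _.
by rewrite patchE /g/= indicE; case: ifP => _; rewrite ?mule1 ?mule0.
Qed.
End joint_measurability.

(** * Sampling the indicator of a stopped path on a uniform grid *)

Section grid.
Context {R : realType}.
Implicit Types (p q f : R -> R) (s t x : R).

Definition grid (n i : nat) : R := i%:R / n.+1%:R.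

(** That many cells of length [n.+1%:R^-1] reach the time [n.+1%:R]: one index both refines the mesh
    and extends the horizon. *)
Definition grid_size (n : nat) : nat := (n.+1 * n.+1)%N.

Definition pos1 : R -> R := \1_[set x : R | 0 < x].

Lemma pos1E x : pos1 x = (0 < x)%R%:R.
Proof. by rewrite /pos1 indicE; congr (_%:R); congr nat_of_bool; apply/idP/idP; rewrite inE. Qed.

Lemma grid_ge0 n i : 0 <= grid n i.
Proof. by rewrite divr_ge0. Qed.

Lemma grid_lt n i x : (grid n i < x) = (i%:R < x * n.+1%:R).
Proof. by rewrite ltr_pdivrMr. Qed.

Lemma grid_le n i j : (i <= j)%N -> grid n i <= grid n j.
Proof. by move=> ij; rewrite ler_pM2r ?invr_gt0// ler_nat. Qed.

Lemma gridS n i : grid n i.+1 = grid n i + n.+1%:R^-1.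
Proof. by rewrite /grid -natr1 mulrDl mul1r. Qed.

Lemma grid_last n : grid n (grid_size n) = n.+1%:R.
Proof. by rewrite /grid /grid_size natrM mulfK. Qed.

Lemma nat_threshold x : exists k : nat, forall i : nat, (i%:R < x) = (i < k)%N.
Proof.
have ex : exists i : nat, x <= i%:R.
  by exists (Num.trunc x).+1; apply/ltW/truncnS_gt.
case: (ex_minnP ex) => k xk min_k; exists k => i.
apply/idP/idP => [ix|ik].
  by rewrite -(ltr_nat R); exact: lt_le_trans xk.
by rewrite ltNge; apply/negP => /min_k; rewrite leqNgt ik.
Qed.

Lemma grid_threshold n x : exists k : nat, forall i : nat, (grid n i < x) = (i < k)%N.
Proof.
have [k hk] := nat_threshold (x * n.+1%:R).
by exists k => i; rewrite grid_lt hk.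
Qed.

Lemma step_value (c : nat -> R) n s : 0 < s -> s <= n.+1%:R ->
  exists i : nat, [/\ (i < grid_size n)%N, grid n i < s, s <= grid n i.+1 &
    \sum_(j < grid_size n) c j * \1_(`]grid n j, grid n j.+1]) s = c i].
Proof.
move=> s0 sn; have [k hk] := grid_threshold n s.
have k0 : (0 < k)%N by rewrite -hk /grid mul0r.
have kN : (k <= grid_size n)%N.
  by rewrite leqNgt -hk grid_last -leNgt.
have kE : k.-1.+1 = k by rewrite prednK.
have iN : (k.-1 < grid_size n)%N by rewrite kE.
exists k.-1; split => //.
- by rewrite hk kE.
- by rewrite leNgt hk kE ltnn.
rewrite (bigD1 (Ordinal iN))//= big1 ?addr0; last first.
  move=> j jk; rewrite indicE mem_setE in_itv/= hk leNgt hk -leqNgt.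
  have /negbTE -> : ~~ ((j < k) && (k <= j.+1))%N.
    apply: contra jk => /andP[jk kj]; apply/eqP/val_inj => /=.
    by apply/eqP; rewrite -eqSS kE eqn_leq jk.
  by rewrite mulr0.
rewrite indicE mem_setE in_itv/= hk leNgt hk kE ltnn.
by rewrite leqnn mulr1.
Qed.

Lemma step_telescope (c : nat -> bool) (k N : nat) (f : nat -> R) :
  (forall i, (i < N)%N -> c i = (i < k)%N) ->
  \sum_(i < N) (c i)%:R * (f i.+1 - f i) = f (minn N k) - f 0%N.
Proof.
elim: N => [|N ih] h; first by rewrite big_ord0 min0n subrr.
rewrite big_ord_recr /= ih; last by move=> i iN; apply: h; exact: ltnW.
rewrite h//; have [Nk|kN] := ltnP N k.
  by rewrite (minn_idPl Nk) mul1r; ring.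
by rewrite (minn_idPr (leqW kN)) mul0r addr0.
Qed.

(** The integrand along a stopped path is thus 1 before [tau] and 0 from [tau] on, which makes both
    approximations on the grid explicit. *)
Lemma stopped_cases p q : continuous q -> (forall s, 0 <= s -> p s = q s) ->
  ((forall t, 0 <= t -> 0 < stopped p t) /\
   (forall t, 0 <= t -> stopped p t = q t)) \/
  exists tau : R, [/\ 0 <= tau,
    forall t, 0 <= t -> (0 < stopped p t) = (t < tau) &
    forall t, 0 <= t -> stopped p t = q (Num.min t tau)].
Proof.
move=> cq pq; have [[q0 h]|[tau [tau0 qtau qp h]]] := stoppedE cq pq.
  by left; split => // t t0; rewrite h// q0.
right; exists tau; split => // t t0; rewrite h//.
have [tt|tt] := ltP t tau; first by rewrite qp.
by rewrite qtau; apply/negbTE; rewrite -leNgt ge_min lexx orbT.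
Qed.

(** The value sampled at the grid point [r] before [s] differs from the value at [s] only if
    [r < tau <= s], which puts [s] within one mesh after [tau]; [u] is [tau], or arbitrary if the
    path is never absorbed. *)
Lemma grid_approx_integrand p q n (T : R) : continuous q ->
  (forall s, 0 <= s -> p s = q s) -> T <= n.+1%:R ->
  exists u : R, forall s, 0 <= s -> s <= T ->
  (\sum_(i < grid_size n) pos1 (stopped p (grid n i)) *
     \1_(`]grid n i, grid n i.+1]) s - pos1 (stopped p s)) ^+ 2 <=
  \1_(`[u, u + n.+1%:R^-1]) s + \1_(`[0, 0]) s.
Proof.
move=> cq pq Tn.
have [u hu] : exists u : R, forall s r, 0 < s -> s <= T -> 0 <= r -> r < s ->
    s <= r + n.+1%:R^-1 ->
    (pos1 (stopped p r) - pos1 (stopped p s)) ^+ 2 <=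
      \1_(`[u, u + n.+1%:R^-1]) s.
  have [[h _]|[tau [tau0 h _]]] := stopped_cases cq pq.
    exists 0 => s r s0 sT r0 rs sr; rewrite !pos1E !h ?(ltW s0)//.
    by rewrite subrr expr0n.
  exists tau => s r s0 sT r0 rs sr; rewrite !pos1E !h ?(ltW s0)// indicE mem_setE in_itv/=.
  have [st|ts] := ltP s tau.
    by rewrite (lt_trans rs st) subrr expr0n/=.
  have [rt|tr] := ltP r tau; last by rewrite subrr expr0n/=.
  by rewrite subr0 expr1n (le_trans sr)// lerD2r ltW.
(* At [s = 0], which no left-open cell contains, the step function is 0 while the indicator may be
   1: hence the extra term at the point 0. *)
exists u => s; rewrite le_eqVlt => /predU1P[<- _|s0 sT].
  rewrite big1; last first.
    by move=> i _; rewrite indicE mem_setE in_itv/= ltNge grid_ge0 mulr0.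
  rewrite [X in _ <= _ + X]indicE mem_setE in_itv/= lexx/= sub0r sqrrN pos1E.
  have : 0 <= \1_(`[u, u + n.+1%:R^-1]) (0 : R) :> R by [].
  by case: (0 < _) => /=; rewrite ?expr1n ?expr0n/=; lra.
have [i [iN i1 i2 ->]] := step_value (fun i => pos1 (stopped p (grid n i))) s0 (le_trans sT Tn).
apply: le_trans (hu s (grid n i) s0 sT (grid_ge0 _ _) i1 _) _.
  by rewrite -gridS.
by rewrite lerDl.
Qed.

(** The coefficients are 1 up to a threshold and 0 afterwards, so the sum telescopes up to [r], the
    first grid point not before [tau], capped at [t] and at the horizon. The function [f] is general
    because it will be the path of [W], not [q]. *)
Lemma grid_approx_integral p q t : continuous q ->
  (forall s, 0 <= s -> p s = q s) -> 0 <= t ->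
  exists m : R, [/\ 0 <= m, stopped p t = q m &
    forall n, t <= n.+1%:R -> exists r : R,
      [/\ 0 <= r, `|r - m| <= n.+1%:R^-1 &
       forall f, \sum_(i < grid_size n) pos1 (stopped p (grid n i)) *
         (f (Num.min t (grid n i.+1)) - f (Num.min t (grid n i))) = f r - f 0]].
Proof.
move=> cq pq t0.
have sum_eq n k f : (forall i, (i < grid_size n)%N ->
      (0 < stopped p (grid n i)) = (i < k)%N) ->
    \sum_(i < grid_size n) pos1 (stopped p (grid n i)) *
      (f (Num.min t (grid n i.+1)) - f (Num.min t (grid n i))) =
    f (Num.min t (grid n (minn (grid_size n) k))) - f 0.
  move=> hk; under eq_bigr do rewrite pos1E.
  rewrite (@step_telescope (fun i => 0 < stopped p (grid n i)) k _
    (fun i => f (Num.min t (grid n i))))//.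
  have -> : grid n 0 = 0 by rewrite /grid mul0r.
  by rewrite (min_r t0).
have [[h1 h2]|[tau [tau0 h1 h2]]] := stopped_cases cq pq.
  exists t; split => //; first exact: h2.
  move=> n tn; exists t; rewrite subrr normr0; split => // f.
  rewrite (sum_eq n (grid_size n)); first by rewrite minnn grid_last min_l.
  by move=> i iN; rewrite h1 ?grid_ge0.
exists (Num.min t tau); split; [by rewrite le_min t0|exact: h2|].
move=> n tn; have [k hk] := grid_threshold n tau.
exists (Num.min t (grid n (minn (grid_size n) k))); split.
- by rewrite le_min t0 grid_ge0.
- have d0 : 0 <= n.+1%:R^-1 :> R by rewrite invr_ge0.
  have [Nk|kN] := ltnP (grid_size n) k.
    have : n.+1%:R < tau by rewrite -(grid_last n) hk.
    rewrite grid_last => nt.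
    by rewrite !min_l ?subrr ?normr0// (le_trans tn)// ltW.
  have k1 : tau <= grid n k by rewrite leNgt hk ltnn.
  have k2 : grid n k <= tau + n.+1%:R^-1.
    case: k {kN k1} hk => [|k] hk; first by rewrite /grid mul0r addr_ge0.
    by rewrite gridS lerD2r ltW// hk.
  have [tt|tt] := leP t tau; first by rewrite min_l ?subrr ?normr0// (le_trans tt).
  move: (n.+1%:R^-1) (grid n k) d0 k1 k2 => D g d0 k1 k2.
  by have [tg|tg] := leP t g; rewrite ler_norml; apply/andP; split; lra.
- by move=> f; apply: sum_eq => i _; rewrite h1 ?grid_ge0// hk.
Qed.
End grid.

Section integral_limits.
Context d (T : measurableType d) (R : realType) (Q : {measure set T -> \bar R}).
Local Open Scope ereal_scope.

(** Serves to identify the L^2 limit of the grid integrals with their pathwise limit. *)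
Lemma fatou_bound (f : nat -> T -> R) (g : T -> R) (B : \bar R) :
  (forall n, measurable_fun [set: T] (f n)) ->
  (forall x, (fun n => f n x) @ \oo --> g x) ->
  (\forall n \near \oo, \int[Q]_x ((f n x) ^+ 2)%:E <= B) ->
  \int[Q]_x ((g x) ^+ 2)%:E <= B.
Proof.
move=> mf fg fB.
have mf2 n : measurable_fun [set: T] (fun x => ((f n x) ^+ 2)%:E).
  by apply/measurable_EFinP; apply: measurable_funX.
have f0 n x : [set: T] x -> 0 <= ((f n x) ^+ 2)%:E by rewrite lee_fin sqr_ge0.
have H := fatou Q measurableT mf2 f0.
have -> : \int[Q]_x ((g x) ^+ 2)%:E =
    \int[Q]_x limn_einf (fun n => ((f n x) ^+ 2)%:E).
  apply: eq_integral => x _; apply/esym.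
  have /cvg_limn_einf_sup[-> _]// : (fun n => ((f n x) ^+ 2)%:E) @ \oo --> ((g x) ^+ 2)%:E.
  apply: cvg_EFin; first by near=> n.
  apply: (@cvg_comp _ _ _ (f^~ x) (fun y : R => y ^+ 2)%R _ _ _ (fg x)).
  exact: exprn_continuous.
apply: le_trans H _; rewrite limn_einf_lim.
apply: lime_le; first exact: is_cvg_einfs.
case: fB => N _ hN; near=> n.
apply: (@le_trans _ _ (\int[Q]_x ((f (maxn n N) x) ^+ 2)%:E)).
  by apply: ereal_inf_lbound; exists (maxn n N) => //=; exact: leq_maxl.
by apply: hN => /=; exact: leq_maxr.
Unshelve. all: by end_near. Qed.

Lemma ge0_integral_sqrD (D : set T) (f g : T -> R) : measurable D ->
  measurable_fun D f -> measurable_fun D g ->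
  \int[Q]_(x in D) ((f x + g x) ^+ 2)%:E <=
  2%:E * \int[Q]_(x in D) ((f x) ^+ 2)%:E + 2%:E * \int[Q]_(x in D) ((g x) ^+ 2)%:E.
Proof.
move=> mD mf mg.
have mf2 : measurable_fun D (fun x => ((f x) ^+ 2)%:E).
  by apply/measurable_EFinP; apply: measurable_funX.
have mg2 : measurable_fun D (fun x => ((g x) ^+ 2)%:E).
  by apply/measurable_EFinP; apply: measurable_funX.
rewrite -!ge0_integralZl//; try by move=> x _; rewrite lee_fin sqr_ge0.
rewrite -ge0_integralD//; try by move=> x _; rewrite mule_ge0// lee_fin sqr_ge0.
- apply: ge0_le_integral => //.
  + by move=> x _; rewrite lee_fin sqr_ge0.
  + by apply/measurable_EFinP; apply: measurable_funX; exact: measurable_funD.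
  + by apply: emeasurable_funD; exact: measurable_funeM.
  + by move=> x _; rewrite -!EFinM -EFinD lee_fin; exact: sqrD_le.
- exact: measurable_funeM.
- exact: measurable_funeM.
Qed.
End integral_limits.

Section simple_integrals.
Context (R : realType) d (Omega : measurableType d) (P : probability Omega R).
Context (F : R -> set_system Omega) (W : R -> Omega -> R).
Hypotheses (hF : is_filtration F) (hW : is_brownian P F W).
Local Notation mu := (@lebesgue_measure R).

Lemma sp_coef_measurable (H : simple_process F) i : (i < sp_size H)%N ->
  measurable_fun [set: Omega] (sp_coef H i).
Proof.
move=> iH; have t0 := sp_time_nonneg (ltnW iH).
have [sF Fm _] := hF.
apply: (smeas_measurable (Fm _ t0)); apply/smeasP; first exact: sF.
exact: sp_coef_adapted.
Qed.

Lemma simple_val_measurable (H : simple_process F) :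
  measurable_fun [set: Omega * measurableTypeR R]
    (fun z : Omega * measurableTypeR R => simple_val H z.2 z.1).
Proof.
apply: measurable_sum => i; apply: measurable_funM.
  by apply: measurableT_comp; [exact: sp_coef_measurable|exact: measurable_fst].
apply: (@measurableT_comp _ _ _ _ _ _ (\1_(`]sp_time H i, sp_time H i.+1]) : measurableTypeR R -> R)).
  exact: measurable_indic.
exact: measurable_snd.
Qed.

Lemma simple_val_diff_measurable (H : simple_process F) (X : R -> Omega -> R) :
  continuous_paths X -> (forall t, 0 <= t -> measurable_fun [set: Omega] (X t)) ->
  measurable_fun [set: Omega * measurableTypeR R]
    (fun z : Omega * measurableTypeR R =>
      simple_val H z.2 z.1 - pos1 (X (Num.max 0 z.2) z.1)).
Proof.
move=> cX mX; apply: measurable_funB; first exact: simple_val_measurable.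
apply: (@measurableT_comp _ _ _ _ _ _ (pos1 : R -> R)); last exact: joint_measurable.
apply: measurable_indic; rewrite -set_itvoy; exact: measurable_itv.
Qed.

Lemma simple_integral_measurable (H : simple_process F) (t : R) : 0 <= t ->
  measurable_fun [set: Omega] (simple_integral W H t).
Proof.
move=> t0; apply: measurable_sum => i; apply: measurable_funM.
  exact: sp_coef_measurable.
have h j : (j <= sp_size H)%N -> 0 <= Num.min t (sp_time H j).
  by move=> jH; rewrite le_min t0 sp_time_nonneg.
by apply: (increment_measurable hF hW); apply: h => //; exact: ltnW.
Qed.

Lemma simple_integral0 (H : simple_process F) w : simple_integral W H 0 w = 0.
Proof.
apply: big1 => i _; rewrite !min_l ?subrr ?mulr0//.
  by apply: sp_time_nonneg; exact: ltnW.
exact: sp_time_nonneg.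
Qed.

Lemma simple_val0 (H : simple_process F) w : simple_val H 0 w = 0.
Proof.
apply: big1 => i _; rewrite indicE mem_setE in_itv/= ltNge.
by rewrite sp_time_nonneg ?mulr0// ltnW.
Qed.

Lemma ito_isometry_diff (H K : simple_process F) (t : R) : 0 <= t ->
  (\int[P]_w ((simple_integral W H t w - simple_integral W K t w) ^+ 2)%:E =
  normal_m2%:E * \int[P]_w \int[mu]_(s in `[0%R, t])
     ((simple_val H s w - simple_val K s w) ^+ 2)%:E)%E.
Proof.
move=> t0.
pose e (i : 'I_(sp_size H) + 'I_(sp_size K)) : atom R Omega :=
  match i with
  | inl i => clamped_atom (cst 1) 0 t i
  | inr j => clamped_atom (cst (-1)) 0 t j
  end.
have ae i : adapted_atom F (e i).
  have b1 (w : Omega) : `|cst (1 : R) w| <= 1 by rewrite normr1.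
  have bN1 (w : Omega) : `|cst (-1 : R) w| <= 1 by rewrite normrN normr1.
  case: i => i.
    by apply: (clamped_atom_adapted hF t _ _ b1) => //; exact: smeas_cst.
  by apply: (clamped_atom_adapted hF t _ _ bN1) => //; exact: smeas_cst.
have he i : hi (e i) <= t by case: i => i; exact: clamped_atom_hi.
have := ito_isometry hF hW ae he.
under eq_integral.
  move=> w _; rewrite big_sumType/= !sum_clamped_atom_int//= !simple_integral0.
  rewrite !subr0 mul1r mulN1r; over.
move=> ->; congr (_ * _)%E; apply: eq_integral => w _; apply: eq_integral => s.
rewrite inE/= in_itv/= => /andP[s0 st].
rewrite big_sumType/= !sum_clamped_atom_val/= indicE mem_setE in_itv/= st andbT.
(* At [s = 0] the indicator of []0, t]] vanishes, but so do the step processes, whose cells are open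
   on the left. *)
move: s0; rewrite le_eqVlt => /predU1P[<-|->].
  by rewrite !simple_val0 ltxx !mulr0 addr0 subr0.
by rewrite !mulr1 mul1r mulN1r.
Qed.
End simple_integrals.


Lemma nbhs_infty_natS (R : realType) (x : R) : \forall n \near \oo, x <= n.+1%:R.
Proof.
near=> n; apply: (@le_trans _ _ n%:R); last by rewrite ler_nat.
by near: n; exact: nbhs_infty_ger.
Unshelve. all: by end_near. Qed.

Lemma pos1_le1 (R : realType) (x : R) : `|pos1 x| <= 1.
Proof. by rewrite pos1E; case: (0 < x); rewrite ?normr1 ?normr0. Qed.

(** * Existence *)

Section existence.
Context (R : realType) d (Omega : measurableType d) (P : probability Omega R).
Context (F : R -> set_system Omega) (zeta : Omega -> R) (W : R -> Omega -> R).
Hypotheses (hF : is_filtration F) (hW : is_brownian P F W) (hz : smeas (F 0) zeta).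
Local Notation mu := (@lebesgue_measure R).

(** As [W 0 = 0] only almost surely, subtracting [W 0] makes the path start at [zeta] for every
    outcome. *)
Definition driving_path (w : Omega) (s : R) : R := zeta w + (W s w - W 0 w).

Definition stopped_process (t : R) (w : Omega) : R := stopped (driving_path w) t.

Let q (w : Omega) (s : R) := driving_path w (Num.max 0 s).

Let cq w : continuous (q w).
Proof.
have cW : continuous (fun s : R => W (Num.max 0 s) w).
  by case: hW => cW _ _ _ _; exact: (within_ge0_continuous (cW w)).
move=> x; apply: cvgD; first exact: cvg_cst.
by apply: cvgB; [exact: cW|exact: cvg_cst].
Qed.

Let pq w s : 0 <= s -> driving_path w s = q w s.
Proof. by move=> s0; rewrite /q max_r. Qed.

Lemma driving_path_continuous w : {within `[0, +oo[, continuous (driving_path w)}.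
Proof. exact: (continuous_within_ge0 (@cq w) (@pq w)). Qed.

Lemma stopped_process0 w : stopped_process 0 w = zeta w.
Proof. by rewrite /stopped_process stopped0 /driving_path subrr addr0. Qed.

Lemma stopped_process_continuous : continuous_paths stopped_process.
Proof. by move=> w; apply: stopped_continuous; exact: driving_path_continuous. Qed.

Lemma driving_path_smeas t u : 0 <= u -> u <= t ->
  smeas (F t) (fun w => driving_path w u).
Proof.
move=> u0 ut; have [_ _ Fle] := hF.
apply: (smeas_sub (Fle _ _ u0 ut)); apply: smeasD.
  exact: (smeas_sub (Fle _ _ (lexx 0) u0)).
apply: smeasB; first exact: (brownian_smeas hF hW).
by apply: (smeas_sub (Fle _ _ (lexx 0) u0)); exact: (brownian_smeas hF hW).
Qed.

Lemma stopped_process_smeas t : 0 <= t -> smeas (F t) (stopped_process t).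
Proof.
move=> t0; have [sF _ _] := hF.
apply/smeasP; first exact: sF.
move=> _ [B mB <-]; rewrite setTI.
apply: (@cylinders_preimage R Omega (F t) `[0, t] driving_path (sF t t0) _
  ((fun p => stopped p t) @^-1` B)).
  move=> u; rewrite /= in_itv/= => /andP[u0 ut].
  by apply/smeasP; [exact: sF|exact: driving_path_smeas].
by apply: smeas_set mB; [exact: smallest_sigma_algebra|exact: stopped_smeas].
Qed.

Lemma stopped_process_measurable t : 0 <= t ->
  measurable_fun [set: Omega] (stopped_process t).
Proof.
move=> t0; have [_ Fm _] := hF.
exact: smeas_measurable (Fm _ t0) (stopped_process_smeas t0).
Qed.

Lemma grid_process_adapted n i : (i < grid_size n)%N ->
  sigma_of (fun w => pos1 (stopped_process (grid n i) w)) `<=` F (grid n i).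
Proof.
move=> _; have [sF _ _] := hF; apply/smeasP; first exact/sF/grid_ge0.
apply: (@measurableT_comp _ _ _ _ _ _ (pos1 : R -> R)).
  by apply: measurable_indic; rewrite -set_itvoy; exact: measurable_itv.
exact: stopped_process_smeas (grid_ge0 _ _).
Qed.

Lemma grid_process_bounded n : exists C : R, forall i w, (i < grid_size n)%N ->
  `|pos1 (stopped_process (grid n i) w)| <= C.
Proof. by exists 1 => i w _; exact: pos1_le1. Qed.

Definition grid_process (n : nat) : simple_process F :=
  @SimpleProcess _ _ _ F (grid_size n) (grid n)
    (fun i w => pos1 (stopped_process (grid n i) w))
    (grid_ge0 n 0) (fun i _ => grid_le n (leqnSn i)) (@grid_process_adapted n)
    (grid_process_bounded n).

(** The two indicators differ at most at time 0 and on an interval of one mesh length. The bound is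
    uniform in the outcome, so it survives taking the mean. *)
Lemma grid_process_error n (T : R) w : T <= n.+1%:R ->
  (\int[mu]_(s in `[0%R, T])
    ((simple_val (grid_process n) s w - pos1 (stopped_process s w)) ^+ 2)%:E <=
   (n.+1%:R^-1)%:E)%E.
Proof.
move=> Tn.
have [u hu] := grid_approx_integrand (@cq w) (@pq w) Tn.
have mi a b : measurable_fun [set: measurableTypeR R]
    ((\1_(`[a, b]) : R -> R) : measurableTypeR R -> R).
  exact: measurable_indic.
have i0 a b (s : R) : (0 <= (\1_(`[a, b]) s : R)%:E)%E by [].
rewrite (eq_integral (fun s : measurableTypeR R => ((simple_val (grid_process n) s w -
    pos1 (stopped_process (Num.max 0 (s : R)) w)) ^+ 2)%:E)); last first.
  by move=> s; rewrite inE/= in_itv/= => /andP[s0 _]; rewrite max_r.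
apply: (@le_trans _ _ (\int[mu]_(s in `[0%R, T])
    ((\1_(`[u, u + n.+1%:R^-1]) s : R)%:E + (\1_(`[0, 0]) s : R)%:E))%E).
  apply: ge0_le_integral => //.
  - by move=> s _; rewrite lee_fin sqr_ge0.
  - apply: measurable_funTS; apply/measurable_EFinP; apply: measurable_funX.
    exact: (measurableT_comp (simple_val_diff_measurable hF _
      stopped_process_continuous stopped_process_measurable) (pair1_measurable w)).
  - by apply: measurable_funTS; apply: emeasurable_funD; apply/measurable_EFinP; exact: mi.
  - move=> s; rewrite /= in_itv/= => /andP[s0 sT]; rewrite -EFinD lee_fin max_r//.
    exact: hu.
apply: (@le_trans _ _ (\int[mu]_s
    ((\1_(`[u, u + n.+1%:R^-1]) s : R)%:E + (\1_(`[0, 0]) s : R)%:E))%E).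
  apply: ge0_subset_integral => //; last by move=> s _; rewrite adde_ge0.
  by apply: emeasurable_funD; apply/measurable_EFinP; exact: mi.
rewrite ge0_integralD//; last 2 first.
- by apply/measurable_EFinP; exact: mi.
- by apply/measurable_EFinP; exact: mi.
rewrite !integral_indic// !setIT.
rewrite [X in (_ + X <= _)%E]lebesgue_measure_itv/= lte_fin ltxx.
rewrite adde0 [leLHS]lebesgue_measure_itv/= lte_fin ltrDl invr_gt0 ltr0n/=.
by rewrite -EFinD addrAC subrr add0r.
Qed.

Lemma grid_process_mean_error n (T : R) : T <= n.+1%:R ->
  (\int[P]_w \int[mu]_(s in `[0%R, T])
    ((simple_val (grid_process n) s w - pos1 (stopped_process s w)) ^+ 2)%:E <=
   (n.+1%:R^-1)%:E)%E.
Proof.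
move=> Tn.
have eq w : (\int[mu]_(s in `[0%R, T])
     ((simple_val (grid_process n) s w - pos1 (stopped_process s w)) ^+ 2)%:E =
   \int[mu]_(s in `[0%R, T]) ((simple_val (grid_process n) s w -
     pos1 (stopped_process (Num.max 0 (s : R)) w)) ^+ 2)%:E)%E.
  by apply: eq_integral => s; rewrite inE/= in_itv/= => /andP[s0 _]; rewrite max_r.
apply: (@le_trans _ _ (\int[P]_w (cst (n.+1%:R^-1)%:E w))%E); last first.
  by rewrite integral_cst// [X in (_ * X)%E]probability_setT mule1.
apply: ge0_le_integral => //.
- by move=> w _; apply: integral_ge0 => s _; rewrite lee_fin sqr_ge0.
- rewrite (funext eq).
  apply: (@measurable_inner_integral _ _ _ (fun z => ((simple_val (grid_process n) z.2 z.1 -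
     pos1 (stopped_process (Num.max 0 z.2) z.1)) ^+ 2)%:E)).
    apply/measurable_EFinP; apply: measurable_funX.
    exact: (simple_val_diff_measurable hF _ stopped_process_continuous stopped_process_measurable).
  by move=> z; rewrite lee_fin sqr_ge0.
- by move=> w _; exact: grid_process_error.
Qed.

Lemma grid_process_cauchy n m (t : R) : 0 <= t -> t <= n.+1%:R -> t <= m.+1%:R ->
  (\int[P]_w ((simple_integral W (grid_process n) t w -
     simple_integral W (grid_process m) t w) ^+ 2)%:E <=
  (normal_m2 * (2 * n.+1%:R^-1 + 2 * m.+1%:R^-1))%:E)%E.
Proof.
move=> t0 tn tm; rewrite (ito_isometry_diff hF hW _ _ t0) EFinM.
apply: lee_wpmul2l; first by rewrite lee_fin normal_m2_ge0.
pose D k w s := simple_val (grid_process k) s w -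
  pos1 (stopped_process (Num.max 0 (s : measurableTypeR R)) w).
have mD k : measurable_fun [set: Omega * measurableTypeR R] (fun z => D k z.1 z.2).
  exact: (simple_val_diff_measurable hF _ stopped_process_continuous stopped_process_measurable).
have mDw k w : measurable_fun [set: measurableTypeR R] (D k w).
  exact: (measurableT_comp (mD k) (pair1_measurable w)).
apply: (@le_trans _ _ (\int[P]_w (cst (2 * n.+1%:R^-1 + 2 * m.+1%:R^-1)%:E w))%E); last first.
  by rewrite integral_cst// [X in (_ * X)%E]probability_setT mule1.
have eq w : (\int[mu]_(s in `[0%R, t])
     ((simple_val (grid_process n) s w - simple_val (grid_process m) s w) ^+ 2)%:E =
   \int[mu]_(s in `[0%R, t]) ((D n w s - D m w s) ^+ 2)%:E)%E.
  by apply: eq_integral => s _; rewrite /D; congr ((_ ^+ 2)%:E); ring.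
apply: ge0_le_integral => //.
- by move=> w _; apply: integral_ge0 => s _; rewrite lee_fin sqr_ge0.
- rewrite (funext eq).
  apply: (@measurable_inner_integral _ _ _ (fun z => ((D n z.1 z.2 - D m z.1 z.2) ^+ 2)%:E)).
    by apply/measurable_EFinP; apply: measurable_funX; exact: measurable_funB.
  by move=> z; rewrite lee_fin sqr_ge0.
- move=> w _; rewrite eq.
  have err k : t <= k.+1%:R ->
      (\int[mu]_(s in `[0%R, t]) ((D k w s) ^+ 2)%:E <= (k.+1%:R^-1)%:E)%E.
    move=> tk; apply: le_trans (grid_process_error w tk).
    rewrite le_eqVlt; apply/orP; left; apply/eqP.
    by apply: eq_integral => s; rewrite inE/= in_itv/= => /andP[s0 _]; rewrite /D max_r.
  apply: (le_trans (@ge0_integral_sqrD _ _ _ mu `[0%R, t] (D n w) (fun s => - D m w s)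
    _ _ _)) => //.
  - exact: measurable_funTS.
  - by apply: measurable_funN; exact: measurable_funTS.
  under [X in (_ + _ * X)%E]eq_integral do rewrite sqrrN.
  apply: (@le_trans _ _ (2%:E * (n.+1%:R^-1)%:E + 2%:E * (m.+1%:R^-1)%:E)%E).
    by apply: leeD; apply: lee_wpmul2l => //; exact: err.
  by rewrite -!EFinM -EFinD.
Qed.

(** Convergence holds for every outcome: the sum is an increment of [W] from 0 to a time within one
    mesh of the stopping time capped at [t], and [W] is continuous. *)
Lemma grid_integral_cvg (t : R) w : 0 <= t ->
  (fun n => simple_integral W (grid_process n) t w) @ \oo -->
    stopped_process t w - zeta w.
Proof.
move=> t0.
have [m [m0 Xm hm]] := grid_approx_integral (@cq w) (@pq w) t0.
have -> : stopped_process t w - zeta w = W (Num.max 0 m) w - W 0 w.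
  by rewrite /stopped_process Xm /q /driving_path addrC addKr.
have cW : continuous (fun s : R => W (Num.max 0 s) w).
  by case: hW => cW _ _ _ _; exact: (within_ge0_continuous (cW w)).
apply/cvgrPdist_lt => e e0.
have [de de0 hde] := near_dist ((cvgrPdist_lt _ _).1 (cW m) e e0).
near=> n.
have tn : t <= n.+1%:R by near: n; exact: nbhs_infty_natS.
have [r [r0 rm hr]] := hm n tn.
rewrite /simple_integral/= (hr (W^~ w)).
rewrite (_ : _ - _ - _ = W (Num.max 0 m) w - W (Num.max 0 r) w); last first.
  by rewrite (max_r r0); ring.
apply: hde; rewrite distrC; apply: le_lt_trans rm _.
by near: n; exact: (near_infty_natSinv_lt (PosNum de0)).
Unshelve. all: by end_near. Qed.

Lemma stopped_process_is_solution : is_solution P F zeta W stopped_process.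
Proof.
split; first exact: stopped_process_continuous.
  move=> t t0; have [sF _ _] := hF.
  by apply/smeasP; [exact: sF|exact: stopped_process_smeas].
exists (fun t w => stopped_process t w - zeta w); split; last first.
  by apply/aeW => w t _; rewrite addrC subrK.
have mz : measurable_fun [set: Omega] zeta.
  by have [_ Fm _] := hF; exact: smeas_measurable (Fm _ (lexx 0)) hz.
have mI t : 0 <= t -> measurable_fun [set: Omega] (fun w => stopped_process t w - zeta w).
  by move=> t0; apply: measurable_funB => //; exact: stopped_process_measurable.
have h0 : (fun n : nat => (n.+1%:R^-1 : R)%:E) @ \oo --> 0%E.
  by apply: cvg_EFin; [near=> n|exact: cvg_harmonic].
split => //.
  move=> w; apply: (@continuous_within_ge0 _ _
    (fun t => stopped_process (Num.max 0 t) w - zeta w)).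
    have cX : continuous_paths stopped_process := stopped_process_continuous.
    have h := within_ge0_continuous (cX w).
    by move=> x; apply: cvgB; [exact: h|exact: cvg_cst].
  by move=> t t0; rewrite max_r.
exists grid_process; split=> [T T0|t t0].
  apply: (@squeeze_cvge _ _ _ _ (cst 0%E) _ _ _ 0%E _ h0); last exact: cvg_cst.
  near=> n; apply/andP; split.
    by apply: integral_ge0 => w _; apply: integral_ge0 => s _; rewrite lee_fin sqr_ge0.
  by apply: grid_process_mean_error; near: n; exact: nbhs_infty_natS.
(* For [m >= n] the Cauchy bound [2 * n.+1%:R^-1 + 2 * m.+1%:R^-1] is at most [4 * n.+1%:R^-1]; as
   [m] grows, Fatou's lemma carries it over to the distance from the pathwise limit. *)
have h1 : (fun n : nat => (normal_m2 * (4 * n.+1%:R^-1) : R)%:E) @ \oo --> 0%E.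
  apply: cvg_EFin; first by near=> n.
  rewrite (_ : 0 = normal_m2 * (4 * 0) :> R); last by rewrite !mulr0.
  apply: cvgM; first exact: cvg_cst.
  by apply: cvgM; [exact: cvg_cst|exact: cvg_harmonic].
apply: (@squeeze_cvge _ _ _ _ (cst 0%E) _ _ _ 0%E _ h1); last exact: cvg_cst.
near=> n; apply/andP; split.
  by apply: integral_ge0 => w _; rewrite lee_fin sqr_ge0.
have tn : t <= n.+1%:R by near: n; exact: nbhs_infty_natS.
apply: (@fatou_bound _ _ _ P (fun m w => simple_integral W (grid_process n) t w -
   simple_integral W (grid_process m) t w)).
- by move=> m; apply: measurable_funB; exact: (simple_integral_measurable hF hW).
- by move=> w; apply: cvgB; [exact: cvg_cst|exact: grid_integral_cvg].
near=> m; apply: le_trans (grid_process_cauchy t0 tn _) _.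
  apply: le_trans tn _; rewrite ler_nat ltnS; near: m; exact: nbhs_infty_ge.
rewrite lee_fin ler_wpM2l ?normal_m2_ge0//.
have : (m.+1%:R^-1 <= n.+1%:R^-1 :> R).
  by rewrite lef_pV2 ?posrE// ler_nat ltnS; near: m; exact: nbhs_infty_ge.
by move: (n.+1%:R^-1) (m.+1%:R^-1) => x y; lra.
Unshelve. all: by end_near. Qed.
End existence.

Section l2_convergence.
Context d (T : measurableType d) (R : realType) (Q : {measure set T -> \bar R}).
Implicit Types f g : nat -> T -> R.
Local Open Scope ereal_scope.

Definition l2_to0 f := (fun n => \int[Q]_x ((f n x) ^+ 2)%:E) @ \oo --> 0.

Lemma l2_to0_le f g (C : R) :
  (forall n, measurable_fun [set: T] (f n)) ->
  (forall n, measurable_fun [set: T] (g n)) ->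
  (0 <= C)%R -> (forall n x, (f n x ^+ 2 <= C * g n x ^+ 2)%R) -> l2_to0 g -> l2_to0 f.
Proof.
move=> mf mg C0 fg g0.
apply: (@squeeze_cvge _ _ _ _ (cst 0) _
  (fun n => C%:E * \int[Q]_x ((g n x) ^+ 2)%:E)).
- apply: nearW => n; apply/andP; split.
    by apply: integral_ge0 => x _; rewrite lee_fin sqr_ge0.
  rewrite -ge0_integralZl//; last 2 first.
  + by apply/measurable_EFinP; apply: measurable_funX.
  + by move=> x _; rewrite lee_fin sqr_ge0.
  apply: ge0_le_integral => //.
  + by move=> x _; rewrite lee_fin sqr_ge0.
  + by apply/measurable_EFinP; apply: measurable_funX.
  + by apply: measurable_funeM; apply/measurable_EFinP; apply: measurable_funX.
  + by move=> x _; rewrite -EFinM lee_fin.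
- exact: cvg_cst.
- by rewrite -(mule0 C%:E); apply: cvgeZl.
Qed.

Lemma l2_to0D f g :
  (forall n, measurable_fun [set: T] (f n)) ->
  (forall n, measurable_fun [set: T] (g n)) ->
  l2_to0 f -> l2_to0 g -> l2_to0 (fun n x => f n x + g n x)%R.
Proof.
move=> mf mg f0 g0.
apply: (@squeeze_cvge _ _ _ _ (cst 0) _
  (fun n => 2%:E * \int[Q]_x ((f n x) ^+ 2)%:E + 2%:E * \int[Q]_x ((g n x) ^+ 2)%:E)).
- apply: nearW => n; apply/andP; split.
    by apply: integral_ge0 => x _; rewrite lee_fin sqr_ge0.
  exact: ge0_integral_sqrD.
- exact: cvg_cst.
- rewrite -[X in _ --> X](_ : 2%:E * 0 + 2%:E * 0 = 0)%E; last by rewrite !mule0 adde0.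
  by apply: cvgeD; [rewrite !mule0|apply: cvgeZl|apply: cvgeZl].
Qed.

Lemma l2_to0_sum (N : nat) (f : 'I_N -> nat -> T -> R) :
  (forall k n, measurable_fun [set: T] (f k n)) ->
  (forall k, l2_to0 (f k)) -> l2_to0 (fun n x => \sum_(k < N) f k n x)%R.
Proof.
elim: N f => [|N ih] f mf f0.
  rewrite /l2_to0 (_ : (fun n => _) = cst 0); first exact: cvg_cst.
  apply/funext => n; apply: integral0_eq => x _; by rewrite big_ord0 expr0n.
rewrite /l2_to0; under eq_fun do under eq_integral do rewrite big_ord_recr/=.
apply: (l2_to0D (f := fun n x => \sum_(k < N) f (widen_ord (leqnSn N) k) n x)%R) => //.
- by move=> n; exact: measurable_sum.
- by apply: ih.
Qed.

Lemma ge0_integral_eq0_ae (f : T -> R) : measurable_fun [set: T] f ->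
  \int[Q]_x ((f x) ^+ 2)%:E = 0 -> {ae Q, forall x, f x = 0%R}.
Proof.
move=> mf f0.
have mf2 : measurable_fun [set: T] (fun x => ((f x) ^+ 2)%:E).
  by apply/measurable_EFinP; apply: measurable_funX.
have /(ae_eq_integral_abs _ measurableT mf2) : \int[Q]_x `|((f x) ^+ 2)%:E| = 0.
  by under eq_integral do rewrite gee0_abs ?lee_fin ?sqr_ge0//.
apply: filterS => x /(_ Logic.I) [] /eqP; rewrite sqrf_eq0 => /eqP.
by [].
Qed.
End l2_convergence.

(** * Locality of the stochastic integral *)

(* [K N] is the step process selecting the grid intervals at the beginning of
   which [X] lies in [C], and [S N] is its integral against [I - c * W].  The
   isometry bounds the second moment of [S N] by that of [K N * (1_{X > 0} - c)],
   which vanishes in the limit; when [X] stays in [C], the sum [S N] telescopes. *)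
Section locality.
Context (R : realType) d (Omega : measurableType d) (P : probability Omega R).
Context (F : R -> set_system Omega) (W X I : R -> Omega -> R).
Hypotheses (hF : is_filtration F) (hW : is_brownian P F W).
Hypotheses (cX : continuous_paths X) (aX : adapted F X).
Local Notation mu := (@lebesgue_measure R).

Let Xs (t : R) : 0 <= t -> smeas (F t) (X t).
Proof. by move=> t0; apply/smeasP; [case: hF => h _ _; exact: h|exact: aX]. Qed.

Let Xm (t : R) : 0 <= t -> measurable_fun [set: Omega] (X t).
Proof. by move=> t0; apply: smeas_measurable (Xs t0); case: hF => _ h _; exact: h. Qed.

Context (Hn : nat -> simple_process F).
Hypothesis Im : forall t, 0 <= t -> measurable_fun [set: Omega] (I t).
Hypothesis Hn_cvg : forall T : R, 0 <= T ->
  ((fun n => \int[P]_w \int[mu]_(s in `[0%R, T])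
     ((simple_val (Hn n) s w - pos1 (X s w)) ^+ 2)%:E) @ \oo --> 0)%E.
Hypothesis In_cvg : forall t : R, 0 <= t ->
  l2_to0 P (fun n w => simple_integral W (Hn n) t w - I t w).

Context (C : set R) (c a b : R).
Hypotheses (cC : closed C) (Cc : forall x, C x -> pos1 x = c).
Hypotheses (a0 : 0 <= a) (ab : a <= b).

Let b0 : 0 <= b. Proof. exact: le_trans ab. Qed.

Let mC : measurable C. Proof. exact: closed_measurable. Qed.

Let tk (N k : nat) : R := a + k%:R * ((b - a) / N.+1%:R).

Let tk_le N k l : (k <= l)%N -> tk N k <= tk N l.
Proof.
by move=> kl; rewrite lerD2l ler_wpM2r ?ler_nat// divr_ge0// subr_ge0.
Qed.

Let tk0 N : tk N 0 = a. Proof. by rewrite /tk mul0r addr0. Qed.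

Let tkN N : tk N N.+1 = b.
Proof. by rewrite /tk mulrCA mulfV ?gt_eqF// mulr1 addrC subrK. Qed.

Let tka N k : a <= tk N k. Proof. by rewrite -(tk0 N) tk_le. Qed.

Let tkb N k : (k <= N.+1)%N -> tk N k <= b.
Proof. by move=> kN; rewrite -(tkN N) tk_le. Qed.

Let tk_ge0 N k : 0 <= tk N k. Proof. exact: le_trans (tka N k). Qed.

Let tkS N k : tk N k.+1 = tk N k + (b - a) / N.+1%:R.
Proof. by rewrite /tk -natr1 mulrDl mul1r addrA. Qed.

Let g N (k : nat) (w : Omega) : R := \1_C (X (tk N k) w).

Let g_le1 N k w : `|g N k w| <= 1.
Proof. by rewrite /g indicE; case: (_ \in _); rewrite ?normr1 ?normr0. Qed.

Let g_smeas N k : smeas (F (tk N k)) (g N k).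
Proof.
apply: (@measurableT_comp _ _ _ _ _ _ (\1_C : R -> R)); last exact: Xs.
exact: measurable_indic.
Qed.

Let g_meas N k : measurable_fun [set: Omega] (g N k).
Proof.
have [_ Fm _] := hF.
exact: (smeas_measurable (Fm _ (tk_ge0 N k)) (@g_smeas N k)).
Qed.

Let S N (w : Omega) : R := \sum_(k < N.+1) g N k w *
  ((I (tk N k.+1) w - I (tk N k) w) - c * (W (tk N k.+1) w - W (tk N k) w)).

Let Sn N n (w : Omega) : R := \sum_(k < N.+1) g N k w *
  ((simple_integral W (Hn n) (tk N k.+1) w - simple_integral W (Hn n) (tk N k) w) -
   c * (W (tk N k.+1) w - W (tk N k) w)).

Let K N (s : R) (w : Omega) : R :=
  \sum_(k < N.+1) g N k w * \1_(`]tk N k, tk N k.+1]) s.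

Let Wm (t : R) : 0 <= t -> measurable_fun [set: Omega] (W t).
Proof. exact: (brownian_measurable hF hW). Qed.

Let Jm n (t : R) : 0 <= t -> measurable_fun [set: Omega] (simple_integral W (Hn n) t).
Proof. exact: (simple_integral_measurable hF hW). Qed.

Let S_meas N : measurable_fun [set: Omega] (S N).
Proof.
apply: measurable_sum => k; apply: measurable_funM => //.
apply: measurable_funB; first by apply: measurable_funB; exact: Im.
by apply: measurable_funM; [exact: measurable_cst|apply: measurable_funB; exact: Wm].
Qed.

Let Sn_meas N n : measurable_fun [set: Omega] (Sn N n).
Proof.
apply: measurable_sum => k; apply: measurable_funM => //.
apply: measurable_funB; first by apply: measurable_funB; exact: Jm.
by apply: measurable_funM; [exact: measurable_cst|apply: measurable_funB; exact: Wm].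
Qed.

Let Sn_cvg N : l2_to0 P (fun n w => S N w - Sn N n w).
Proof.
pose f (k : 'I_N.+1) n w := g N k w * (I (tk N k.+1) w - I (tk N k) w -
  (simple_integral W (Hn n) (tk N k.+1) w - simple_integral W (Hn n) (tk N k) w)).
have -> : (fun n w => S N w - Sn N n w) = (fun n w => \sum_(k < N.+1) f k n w).
  by apply/funext => n; apply/funext => w; rewrite -sumrB; apply: eq_bigr => k _;
     rewrite /f; ring.
pose h (k : nat) n w := simple_integral W (Hn n) (tk N k) w - I (tk N k) w.
have mh k n : measurable_fun [set: Omega] (h k n).
  by apply: measurable_funB; [exact: Jm|exact: Im].
apply: l2_to0_sum => [k n|k].
  apply: measurable_funM; first exact: g_meas.
  apply: measurable_funB; apply: measurable_funB;
    by [exact: Im|exact: Jm].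
have hN k' : l2_to0 P (fun n w => - h k' n w).
  have := In_cvg (tk_ge0 N k'); apply: (l2_to0_le (C := 1)) => //.
  - by move=> n; apply: measurable_funN; exact: mh.
  - by move=> n; exact: mh.
  - by move=> n x; rewrite sqrrN mul1r.
apply: (l2_to0_le (g := fun n w => - h k.+1 n w + h k n w) (C := 1)) => //.
- move=> n; apply: measurable_funM; first exact: g_meas.
  apply: measurable_funB; apply: measurable_funB;
    by [exact: Im|exact: Jm].
- by move=> n; apply: measurable_funD => //; exact: measurable_funN.
- move=> n w; rewrite /f exprMn ler_pM ?sqr_ge0//.
    by rewrite -real_normK ?num_real// expr_le1.
  by rewrite le_eqVlt; apply/orP; left; apply/eqP; rewrite /h; congr (_ ^+ 2); ring.
- apply: l2_to0D => //; first by move=> n; exact: measurable_funN.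
  exact: In_cvg.
Qed.

Let K_le1 N s w : (K N s w) ^+ 2 <= 1.
Proof.
have K0 : 0 <= K N s w by apply: sumr_ge0 => k _; rewrite mulr_ge0// /g.
rewrite expr_le1//.
(* The indicator of a cell is the difference of two threshold indicators, and these telescope. *)
apply: (@le_trans _ _ (\sum_(k < N.+1) ((tk N k < s)%R%:R - (tk N k.+1 < s)%R%:R : R))).
  apply: ler_sum => k _; apply: (@le_trans _ _ (1 * \1_(`]tk N k, tk N k.+1]) s)).
    by rewrite ler_wpM2r//; exact: le_trans (ler_norm _) (g_le1 _ _ _).
  rewrite mul1r indicE mem_setE in_itv/= [s <= _]leNgt.
  have [h|h] := ltP (tk N k.+1) s; last by rewrite subr0 andbT.
  by rewrite andbF (le_lt_trans (tk_le N (leqnSn k)) h) subrr.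
have -> : \sum_(k < N.+1) ((tk N k < s)%R%:R - (tk N k.+1 < s)%R%:R : R) =
   - \sum_(0 <= k < N.+1) ((tk N k.+1 < s)%R%:R - (tk N k < s)%R%:R : R).
  by rewrite big_mkord -sumrN; apply: eq_bigr => k _; rewrite opprB.
rewrite (telescope_sumr (fun k => (tk N k < s)%R%:R : R))// opprB.
by case: (tk N 0 < s); case: (tk N N.+1 < s); rewrite ?subr0 ?subrr ?sub0r ?lerN10 ?ler01.
Qed.

Let isometry N n :
  (\int[P]_w ((Sn N n w) ^+ 2)%:E = normal_m2%:E *
  \int[P]_w \int[mu]_(s in `[0%R, b])
    ((K N s w * (simple_val (Hn n) s w - c)) ^+ 2)%:E)%E.
Proof.
(* The first family carries [g] times [Hn n] cell by cell, the second subtracts [c] times [g]; the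
   two overlap in time, which atoms permit. *)
pose e (i : ('I_N.+1 * 'I_(sp_size (Hn n))) + 'I_N.+1) : atom R Omega :=
  match i with
  | inl p => clamped_atom (g N p.1) (tk N p.1) (tk N p.1.+1) p.2
  | inr k => Atom (tk N k) (tk N k.+1) (fun w => - c * g N k w)
  end.
have ae i : adapted_atom F (e i).
  case: i => [[k i]|k].
    exact: (clamped_atom_adapted hF _ (tk_ge0 N k) (@g_smeas N k) (@g_le1 N k)).
  split => /=; [exact: tk_ge0|exact: tk_le| |].
    by apply: smeasM; [exact: smeas_cst|exact: g_smeas].
  exists `|c| => w; rewrite normrM normrN ler_piMr//; exact: g_le1.
have he i : hi (e i) <= b.
  case: i => [[k i]|k]; last by rewrite /= tkb.
  by apply: le_trans (clamped_atom_hi _ _ _) _; [exact: tk_le|rewrite /= tkb].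
have sumE (f : atom R Omega -> R) : \sum_i f (e i) =
    \sum_(k < N.+1) ((\sum_i f (clamped_atom (g N k) (tk N k) (tk N k.+1) (H := Hn n) i)) +
      f (Atom (tk N k) (tk N k.+1) (fun w => - c * g N k w))).
  by rewrite big_sumType/= big_split/= pair_big.
have := ito_isometry hF hW ae he.
under eq_integral.
  move=> w _; rewrite (sumE (fun x => atom_int W x w)).
  under eq_bigr do rewrite sum_clamped_atom_int ?tk_le//.
  rewrite (_ : \sum_(k < N.+1) _ = Sn N n w); last first.
    by apply: eq_bigr => k _; rewrite /atom_int/=; ring.
  over.
move=> ->; congr (_ * _)%E; apply: eq_integral => w _; apply: eq_integral => s _.
rewrite (sumE (fun x => atom_val x s w)).
congr ((_ ^+ 2)%:E); rewrite mulr_suml; apply: eq_bigr => k _.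
by rewrite sum_clamped_atom_val ?tk_le// /atom_val/=; ring.
Qed.
Let H (s : R) (w : Omega) : R := pos1 (X (Num.max 0 s) w).

Let K_joint N : measurable_fun [set: Omega * measurableTypeR R]
  (fun z : Omega * measurableTypeR R => K N z.2 z.1).
Proof.
apply: measurable_sum => k; apply: measurable_funM.
  by apply: measurableT_comp; [exact: g_meas|exact: measurable_fst].
apply: (@measurableT_comp _ _ _ _ _ _ (\1_(`]tk N k, tk N k.+1]) : measurableTypeR R -> R)).
  exact: measurable_indic.
exact: measurable_snd.
Qed.

Let H_joint : measurable_fun [set: Omega * measurableTypeR R]
  (fun z : Omega * measurableTypeR R => H z.2 z.1).
Proof.
apply: (@measurableT_comp _ _ _ _ _ _ (pos1 : R -> R)); last exact: joint_measurable.
apply: measurable_indic; rewrite -set_itvoy; exact: measurable_itv.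
Qed.

Let KH_joint N : measurable_fun [set: Omega * measurableTypeR R]
  (fun z : Omega * measurableTypeR R => ((K N z.2 z.1 * (H z.2 z.1 - c)) ^+ 2)%:E).
Proof.
apply/measurable_EFinP; apply: measurable_funX; apply: measurable_funM => //.
by apply: measurable_funB => //; exact: measurable_cst.
Qed.

Let gamma N : \bar R :=
  (\int[P]_w \int[mu]_(s in `[0%R, b]) ((K N s w * (H s w - c)) ^+ 2)%:E)%E.

Let error_le N n :
  (\int[P]_w \int[mu]_(s in `[0%R, b])
    ((K N s w * (simple_val (Hn n) s w - c)) ^+ 2)%:E <=
   2%:E * (\int[P]_w \int[mu]_(s in `[0%R, b])
     ((simple_val (Hn n) s w - pos1 (X s w)) ^+ 2)%:E) + 2%:E * gamma N)%E.
Proof.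
have mD : measurable_fun [set: Omega * measurableTypeR R]
    (fun z : Omega * measurableTypeR R => ((simple_val (Hn n) z.2 z.1 - H z.2 z.1) ^+ 2)%:E).
  apply/measurable_EFinP; apply: measurable_funX.
  exact: (simple_val_diff_measurable hF (Hn n) cX Xm).
have mKn : measurable_fun [set: Omega * measurableTypeR R]
    (fun z : Omega * measurableTypeR R => ((K N z.2 z.1 * (simple_val (Hn n) z.2 z.1 - c)) ^+ 2)%:E).
  apply/measurable_EFinP; apply: measurable_funX; apply: measurable_funM => //.
  by apply: measurable_funB; [exact: simple_val_measurable|exact: measurable_cst].
have sq0 (x : R) : (0 <= (x ^+ 2)%:E)%E by rewrite lee_fin sqr_ge0.
have i0 (f : R -> R) : (0 <= \int[mu]_(s in `[0%R, b]) (f s ^+ 2)%:E)%E.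
  by apply: integral_ge0.
have mI f : measurable_fun [set: Omega * measurableTypeR R] f -> (forall z, 0 <= f z)%E ->
  measurable_fun [set: Omega] (fun w => \int[mu]_(s in `[0%R, b]) f (w, s))%E.
  exact: measurable_inner_integral.
have -> : (\int[P]_w \int[mu]_(s in `[0%R, b])
     ((simple_val (Hn n) s w - pos1 (X s w)) ^+ 2)%:E =
   \int[P]_w \int[mu]_(s in `[0%R, b])
     ((simple_val (Hn n) s w - H s w) ^+ 2)%:E)%E.
  apply: eq_integral => w _; apply: eq_integral => s.
  by rewrite inE/= in_itv/= => /andP[s0 _]; rewrite /H max_r.
rewrite -!ge0_integralZl//; last 2 first.
- exact: (mI _ (KH_joint N)).
- exact: (mI _ mD).
rewrite -ge0_integralD//; last 4 first.
- by move=> w _; rewrite mule_ge0.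
- by apply: measurable_funeM; exact: (mI _ mD).
- by move=> w _; rewrite mule_ge0.
- by apply: measurable_funeM; exact: (mI _ (KH_joint N)).
apply: ge0_le_integral => //.
- exact: (mI _ mKn).
- by apply: emeasurable_funD; apply: measurable_funeM; [exact: (mI _ mD)|exact: (mI _ (KH_joint N))].
move=> w _.
have mw f : measurable_fun [set: Omega * measurableTypeR R] f ->
    measurable_fun [set: measurableTypeR R] (fun s => f (w, s) : \bar R).
  by move=> mf; exact: measurableT_comp mf (pair1_measurable w).
rewrite -!ge0_integralZl//; last 2 first.
- by apply: measurable_funTS; exact: (mw _ (KH_joint N)).
- by apply: measurable_funTS; exact: (mw _ mD).
rewrite -ge0_integralD//; last 4 first.
- by move=> s _; rewrite mule_ge0.
- by apply: measurable_funTS; apply: measurable_funeM; exact: (mw _ mD).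
- by move=> s _; rewrite mule_ge0.
- by apply: measurable_funTS; apply: measurable_funeM; exact: (mw _ (KH_joint N)).
apply: ge0_le_integral => //.
- by apply: measurable_funTS; exact: (mw _ mKn).
- by apply: measurable_funTS; apply: emeasurable_funD; apply: measurable_funeM;
    [exact: (mw _ mD)|exact: (mw _ (KH_joint N))].
move=> s _; rewrite -!EFinM -EFinD lee_fin.
rewrite (_ : K N s w * (simple_val (Hn n) s w - c) =
  K N s w * (simple_val (Hn n) s w - H s w) + K N s w * (H s w - c)); last by ring.
apply: le_trans (sqrD_le _ _) _; rewrite lerD2r ler_pM2l// exprMn.
by rewrite ler_piMl ?sqr_ge0// K_le1.
Qed.

Let S_le N : (\int[P]_w ((S N w) ^+ 2)%:E <= (4 * normal_m2)%:E * gamma N)%E.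
Proof.
have m20 : 0 <= normal_m2 :> R by exact: normal_m2_ge0.
(* A square is split twice: along [S = (S - Sn) + Sn], and, after the isometry, along
   [Hn - c = (Hn - H) + (H - c)]. This produces the factor 4 in front of [gamma]; the other terms
   vanish as [n] grows. *)
pose u n := (2%:E * (\int[P]_w ((S N w - Sn N n w) ^+ 2)%:E) +
  (2 * normal_m2)%:E * (2%:E * (\int[P]_w \int[mu]_(s in `[0%R, b])
     ((simple_val (Hn n) s w - pos1 (X s w)) ^+ 2)%:E) + 2%:E * gamma N))%E.
have Su n : (\int[P]_w ((S N w) ^+ 2)%:E <= u n)%E.
  rewrite (_ : (fun w => _) = fun w => ((S N w - Sn N n w + Sn N n w) ^+ 2)%:E); last first.
    by apply/funext => w; rewrite subrK.
  apply: le_trans (ge0_integral_sqrD P measurableT _ (Sn_meas N n)) _.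
    by apply: measurable_funB; [exact: S_meas|exact: Sn_meas].
  rewrite /u leeD2l// isometry muleA -EFinM; apply: lee_wpmul2l; last exact: error_le.
  by rewrite lee_fin mulr_ge0.
have ulim : u @ \oo --> ((4 * normal_m2)%:E * gamma N)%E.
  have -> : ((4 * normal_m2)%:E * gamma N =
      2%:E * 0 + (2 * normal_m2)%:E * (2%:E * 0 + 2%:E * gamma N))%E.
    by rewrite !mule0 !add0e muleA -EFinM; congr (_%:E * _)%E; ring.
  apply: cvgeD.
  - by rewrite mule0; case: (_ * _)%E.
  - by apply: cvgeZl => //; exact: Sn_cvg.
  apply: cvgeZl => //; apply: cvgeD.
  - by rewrite mule0; case: (_ * _)%E.
  - by apply: cvgeZl => //; exact: Hn_cvg.
  - exact: cvg_cst.
rewrite -(cvg_lim _ ulim)//; apply: lime_ge.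
  by apply/cvg_ex; eexists; exact: ulim.
by apply: nearW => n; exact: Su.
Qed.

(** If [X s w] lies in [C], the second factor is 0. Otherwise, [C] being closed, the path avoids [C]
    around [s], so on a fine grid the cell containing [s] starts outside [C] and is not selected. *)
Let K_eventually0 s w : 0 <= s -> \forall N \near \oo, K N s w * (H s w - c) = 0.
Proof.
move=> s0; have HE : H s w = pos1 (X s w) by rewrite /H max_r.
have [XC|XC] := pselect (C (X s w)).
  by apply: nearW => N; rewrite HE (Cc XC) subrr mulr0.
have cq := within_ge0_continuous (@cX w).
have oC : nbhs s [set u | ~ C (X (Num.max 0 u) w)].
  have oC : nbhs (X (Num.max 0 s) w) (~` C).
    by rewrite max_r//; apply: open_nbhs_nbhs; split => //; exact: closed_openC.
  exact: (cq s _ oC).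
have [e /= e0 he] := oC.
have cvg0 : (fun N : nat => (b - a) * N.+1%:R^-1) @ \oo --> (0 : R).
  by rewrite -(mulr0 (b - a)); apply: cvgM; [exact: cvg_cst|exact: cvg_harmonic].
near=> N; rewrite (_ : K N s w = 0) ?mul0r//; apply: big1 => k _.
rewrite indicE mem_setE in_itv/= tkS; have [/andP[h1 h2]|] := boolP (_ && _); last first.
  by rewrite mulr0.
rewrite /g indicE memNset ?mul0r//.
have := he (tk N k); rewrite /= max_r//; apply.
rewrite /ball/= ger0_norm ?subr_ge0; last exact: ltW.
apply: (@le_lt_trans _ _ ((b - a) / N.+1%:R)); first by rewrite lerBlDl.
by near: N; exact: (cvgr_lt _ cvg0).
Unshelve. all: by end_near. Qed.

Let D : R := (1 + `|c|) ^+ 2.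

Let KH_le N s w : (K N s w * (H s w - c)) ^+ 2 <= D.
Proof.
rewrite exprMn; apply: (@le_trans _ _ ((H s w - c) ^+ 2)).
  by rewrite ler_piMl ?sqr_ge0// K_le1.
rewrite /D -real_normK ?num_real// lerXn2r ?nnegrE ?addr_ge0//.
apply: le_trans (ler_normB _ _) _; rewrite lerD2r; exact: pos1_le1.
Qed.

(** Dominated convergence, in time for each outcome and then over the outcomes. *)
Let gamma_cvg : (gamma @ \oo --> 0)%E.
Proof.
have D0 : 0 <= D by exact: sqr_ge0.
have sq0 (x : R) : (0 <= (x ^+ 2)%:E)%E by rewrite lee_fin sqr_ge0.
have mw N w : measurable_fun [set: measurableTypeR R]
    (fun s => ((K N s w * (H s w - c)) ^+ 2)%:E).
  exact: measurableT_comp (KH_joint N) (pair1_measurable w).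
have inner w : ((fun N => \int[mu]_(s in `[0%R, b]) ((K N s w * (H s w - c)) ^+ 2)%:E) @ \oo --> 0)%E.
  have -> : (0 = \int[mu]_(s in `[0%R, b]) (cst 0 s))%E by rewrite integral0.
  apply: (@dominated_cvg _ _ _ mu _ _ _ _ (fun=> D%:E)) => //.
  - by move=> N; apply: measurable_funTS; exact: mw.
  - move=> s; rewrite /= in_itv/= => /andP[s0 _].
    apply: cvg_near_cst; apply: filterS (K_eventually0 w s0) => N ->.
    by rewrite expr0n.
  - apply/integrableP; split; first exact: measurable_cst.
    rewrite integral_cst//= lebesgue_measure_itv/=.
    by case: ifP => _; rewrite -?EFinD -?EFinM ?mule0 ltry.
  - by move=> N s _; rewrite gee0_abs// lee_fin KH_le.
have -> : (0 = \int[P]_w (cst 0 w))%E by rewrite integral0.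
apply: (@dominated_cvg _ _ _ P _ _ _ _ (fun=> (D * b)%:E)) => //.
- by move=> N; exact: (measurable_inner_integral _ (KH_joint N)).
- apply/integrableP; split; first exact: measurable_cst.
  by rewrite integral_cst//= probability_setT mule1 ltry.
- move=> N w _; rewrite gee0_abs; last by apply: integral_ge0.
  apply: (@le_trans _ _ (\int[mu]_(s in `[0%R, b]) (cst D%:E s))%E).
    apply: ge0_le_integral => //.
    + by apply: measurable_funTS; exact: mw.
    + by move=> s _; rewrite lee_fin KH_le.
  rewrite integral_cst//= lebesgue_measure_itv/= lte_fin.
  have [_|bn0] := ltP 0 b; first by rewrite sube0 -EFinM.
  by rewrite mule0 lee_fin mulr_ge0.
Qed.

Lemma integral_local : {ae P, forall w,
  (forall s, a <= s -> s <= b -> C (X s w)) -> I b w - I a w = c * (W b w - W a w)}.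
Proof.
(* The event of the claim concerns uncountably many times; [E] is a measurable event containing it.
   On [E] every coefficient [g] is 1, so that [S N] telescopes for all [N] at once. *)
pose E := \bigcap_N \bigcap_(k in `I_N.+2) (X (tk N k) @^-1` C).
pose f w := \1_E w * (I b w - I a w - c * (W b w - W a w)).
have mE : measurable E.
  apply: bigcap_measurable => // N _; apply: bigcap_measurable => [|k _]; first by exists 0%N.
  by rewrite -[X in measurable X]setTI; apply: Xm.
have mf : measurable_fun [set: Omega] f.
  apply: measurable_funM; first exact: measurable_indic.
  apply: measurable_funB; first by apply: measurable_funB; exact: Im.
  by apply: measurable_funM; [exact: measurable_cst|apply: measurable_funB; exact: Wm].
have fS N w : f w ^+ 2 <= S N w ^+ 2.
  rewrite /f indicE; have [|_] := boolP (w \in E); last by rewrite mul0r expr0n sqr_ge0.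
  rewrite inE => Ew; rewrite mul1r le_eqVlt; apply/orP; left; apply/eqP; congr (_ ^+ 2).
  rewrite /S; under eq_bigr.
    move=> k _; rewrite /g indicE mem_set ?mul1r; last by apply: Ew => //=; exact: ltnW (ltn_ord k).
    over.
  rewrite sumrB -mulr_sumr -!(big_mkord xpredT (fun k => _ (tk N k.+1) w - _ (tk N k) w)).
  rewrite (telescope_sumr (fun k => I (tk N k) w))// (telescope_sumr (fun k => W (tk N k) w))//.
  by rewrite tk0 tkN.
have f0 : (\int[P]_w ((f w) ^+ 2)%:E = 0)%E.
  apply/eqP; rewrite eq_le; apply/andP; split; last first.
    by apply: integral_ge0 => w _; rewrite lee_fin sqr_ge0.
  have m20 : 0 <= normal_m2 :> R by exact: normal_m2_ge0.
  have ulim : ((fun N => (4 * normal_m2)%:E * gamma N) @ \oo --> 0)%E.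
    by rewrite -(mule0 (4 * normal_m2)%:E); apply: cvgeZl.
  rewrite -(cvg_lim _ ulim)//; apply: lime_ge.
    by apply/cvg_ex; eexists; exact: ulim.
  apply: nearW => N; apply: le_trans (S_le N).
  apply: ge0_le_integral => //.
  - by move=> w _; rewrite lee_fin sqr_ge0.
  - by apply/measurable_EFinP; apply: measurable_funX.
  - by apply/measurable_EFinP; apply: measurable_funX; exact: S_meas.
  - by move=> w _; rewrite lee_fin fS.
apply: filterS (ge0_integral_eq0_ae mf f0) => w; rewrite /f => fw h.
apply/eqP; rewrite -subr_eq0; apply/eqP; rewrite -[LHS]mul1r -[RHS]fw; congr (_ * _).
rewrite indicE mem_set// => N _ k kN /=.
by apply: h; [exact: tka|exact: (@tkb N k kN)].
Qed.
End locality.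

(** * Mean of the increments of the stochastic integral *)

Section martingale.
Context (R : realType) d (Omega : measurableType d) (P : probability Omega R).
Context (F : R -> set_system Omega) (W I : R -> Omega -> R).
Hypotheses (hF : is_filtration F) (hW : is_brownian P F W).
Context (Hn : nat -> simple_process F).
Hypothesis Im : forall t, 0 <= t -> measurable_fun [set: Omega] (I t).
Hypothesis In_cvg : forall t : R, 0 <= t ->
  l2_to0 P (fun n w => simple_integral W (Hn n) t w - I t w).
Context (a b : R) (g : Omega -> R).
Hypotheses (a0 : 0 <= a) (ab : a <= b).
Hypotheses (mg : smeas (F a) g) (g1 : forall w, `|g w| <= 1).
Local Open Scope ereal_scope.

Let b0 : (0 <= b)%R. Proof. exact: le_trans ab. Qed.

Let gm : measurable_fun [set: Omega] g.
Proof. by apply: smeas_measurable mg; case: hF => _ h _; exact: h. Qed.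

Let J n w := (g w * (simple_integral W (Hn n) b w - simple_integral W (Hn n) a w))%R.

Let G w := (g w * (I b w - I a w))%R.

Let Jm n : measurable_fun [set: Omega] (J n).
Proof.
by apply: measurable_funM => //; apply: measurable_funB; exact: (simple_integral_measurable hF hW).
Qed.

Let Gm : measurable_fun [set: Omega] G.
Proof. by apply: measurable_funM => //; apply: measurable_funB; exact: Im. Qed.

Let J_mean n : P.-integrable [set: Omega] (EFin \o J n) /\ \int[P]_w (J n w)%:E = 0.
Proof.
pose e i := clamped_atom g a b (H := Hn n) i.
have ae i : adapted_atom F (e i) by exact: (clamped_atom_adapted hF _ a0 mg g1).
have ei i : P.-integrable [set: Omega] (fun w => (atom_int W (e i) w)%:E) /\
    \int[P]_w (atom_int W (e i) w)%:E = 0.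
  have [l0 lh cm [C cC]] := ae i.
  apply: (martingale_increment hF hW) => //.
  exact: (smeas_bounded_integrable P hF l0 cm cC).
have JE : EFin \o J n = fun w => \sum_i (atom_int W (e i) w)%:E.
  by apply/funext => w; rewrite /= /J -sum_clamped_atom_int// sumEFin.
have Ji : P.-integrable [set: Omega] (EFin \o J n).
  rewrite JE; apply: integrable_sum => //.
  by move=> i _; have [] := ei i.
split => //.
rewrite -[LHS]/(\int[P]_w (EFin \o J n) w) JE.
rewrite integral_sum//; last by move=> i; have [] := ei i.
by apply: big1 => i _; have [] := ei i.
Qed.

Let JG_cvg : l2_to0 P (fun n w => J n w - G w)%R.
Proof.
pose h t n w := (simple_integral W (Hn n) t w - I t w)%R.
have mh t n : (0 <= t)%R -> measurable_fun [set: Omega] (h t n).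
  by move=> t0; apply: measurable_funB; [exact: (simple_integral_measurable hF hW)|exact: Im].
have hN t : (0 <= t)%R -> l2_to0 P (fun n w => - h t n w)%R.
  move=> t0; have := In_cvg t0; apply: (l2_to0_le (C := 1)) => //.
  - by move=> n; apply: measurable_funN; exact: mh.
  - by move=> n; exact: mh.
  - by move=> n x; rewrite sqrrN mul1r.
apply: (l2_to0_le (g := fun n w => (h b n w + (- h a n w))%R) (C := 1)) => //.
- by move=> n; apply: measurable_funB; [exact: Jm|exact: Gm].
- by move=> n; apply: measurable_funD; [exact: mh|apply: measurable_funN; exact: mh].
- move=> n w; rewrite /J /G -mulrBr exprMn ler_pM ?sqr_ge0//.
    by rewrite -real_normK ?num_real// expr_le1.
  by rewrite le_eqVlt; apply/orP; left; apply/eqP; rewrite /h; congr (_ ^+ 2)%R; ring.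
- apply: l2_to0D => //.
  + by move=> n; exact: mh.
  + by move=> n; apply: measurable_funN; exact: mh.
  + exact: In_cvg.
  + exact: hN.
Qed.

(** Elementary integrals have mean zero, and L^2 convergence on a probability space implies
    convergence of means. *)
Lemma integral_increment_mean : P.-integrable [set: Omega] (EFin \o G) /\
  \int[P]_w (G w)%:E = 0.
Proof.
have dm n : measurable_fun [set: Omega] (fun w => J n w - G w)%R.
  by apply: measurable_funB; [exact: Jm|exact: Gm].
(* Convergence to 0 among extended reals makes the L^2 distances finite from some index on; one such
   index already yields the integrability of [G]. *)
have fin : \forall n \near \oo, P.-integrable [set: Omega] (fun w => (J n w - G w)%:E).
  have := JG_cvg => /fine_cvgP[+ _]; apply: filterS => n fn.
  apply: integrable_le1sqr => //; apply/integrableP; split.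
    by apply/measurable_EFinP; apply: measurable_funX.
  under eq_integral do rewrite gee0_abs ?lee_fin ?sqr_ge0//.
  by rewrite ltey_eq fn.
have Gi : P.-integrable [set: Omega] (EFin \o G).
  have [n _ /(_ n (leqnn n)) di] := fin.
  have := integrableB measurableT (J_mean n).1 di.
  by apply: eq_integrable => // w _; rewrite /= -EFinB; congr (_%:E); ring.
split => //.
have fG : \int[P]_w (G w)%:E \is a fin_num by exact: integrable_fin_num.
suff h (e : R) : (0 < e)%R -> `|\int[P]_w (G w)%:E| <= e%:E.
  apply/eqP; rewrite -abse_eq0 eq_le abse_ge0 andbT; apply/lee_addgt0Pr => e e0.
  by rewrite add0e; exact: h.
move=> e0.
(* Passage from L^2 to L^1 through [x <= e / 2 + 2 / e * x ^+ 2], a weak form of the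
   arithmetic-geometric mean inequality. *)
have ub n : P.-integrable [set: Omega] (fun w => (J n w - G w)%:E) ->
    `|\int[P]_w (G w)%:E| <= (e / 2)%:E + (2 / e)%:E * \int[P]_w ((J n w - G w) ^+ 2)%:E.
  move=> di; have [Ji J0] := J_mean n.
  have -> : \int[P]_w (G w)%:E = - \int[P]_w (J n w - G w)%:E.
    under [in RHS]eq_integral do rewrite EFinB.
    by rewrite integralB// J0 sub0e oppeK.
  rewrite abseN; apply: le_trans (le_abse_integral _ measurableT _) _.
    exact/measurable_EFinP.
  rewrite -ge0_integralZl//; last 3 first.
  - by apply/measurable_EFinP; apply: measurable_funX.
  - by move=> w _; rewrite lee_fin sqr_ge0.
  - by rewrite lee_fin divr_ge0// ltW.
  have -> : (e / 2)%:E = \int[P]_w (cst (e / 2)%:E w).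
    by rewrite integral_cst//= probability_setT mule1.
  have m2 : measurable_fun [set: Omega] (fun w => (2 / e)%:E * ((J n w - G w) ^+ 2)%:E).
    by apply: measurable_funeM; apply/measurable_EFinP; apply: measurable_funX.
  have p2 w : 0 <= (2 / e)%:E * ((J n w - G w) ^+ 2)%:E.
    by rewrite -EFinM lee_fin mulr_ge0 ?sqr_ge0// divr_ge0// ltW.
  rewrite -ge0_integralD//; last by move=> w _; rewrite lee_fin divr_ge0// ltW.
  apply: ge0_le_integral => //.
  - by apply: measurableT_comp => //; exact/measurable_EFinP.
  - by apply: emeasurable_funD.
  move=> w _; rewrite abse_EFin -EFinM -EFinD lee_fin.
  rewrite -(real_normK (num_real (J n w - G w))).
  set x := `|_|%R; rewrite -(ler_pM2l e0).
  rewrite (_ : e * (e / 2 + 2 / e * x ^+ 2) = e ^+ 2 / 2 + 2 * x ^+ 2)%R; last first.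
    by field; rewrite gt_eqF.
  have := sqr_ge0 (e - 2 * x)%R; nra.
have ulim : (fun n => (e / 2)%:E + (2 / e)%:E * \int[P]_w ((J n w - G w) ^+ 2)%:E) @ \oo
    --> (e / 2)%:E.
  rewrite -[X in _ --> X]adde0 -(mule0 (2 / e)%:E); apply: cvgeD => //.
  - exact: cvg_cst.
  - exact: cvgeZl.
apply: (@le_trans _ _ (e / 2)%:E); last by rewrite lee_fin ler_pdivrMr// ler_peMr ?ler1n// ltW.
rewrite -(cvg_lim _ ulim)//; apply: lime_ge.
  by apply/cvg_ex; eexists; exact: ulim.
by apply: filterS fin => n; exact: ub.
Qed.
End martingale.

(** * Uniqueness *)

Section path_uniqueness.
Context {R : realType}.
Implicit Types (f q D : R -> R).

Lemma dense_closed f (C : set R) (a b : R) : continuous f -> closed C -> a < b ->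
  (forall r : rat, a < ratr r -> ratr r < b -> C (f (ratr r))) ->
  forall x, a <= x -> x <= b -> C (f x).
Proof.
move=> cf cC ab h x ax xb; apply: contrapT => nC.
have oC : nbhs (f x) (~` C) by apply: open_nbhs_nbhs; split => //; exact: closed_openC.
have /near_dist[e e0 he] := cf x _ oC.
have lt : Num.max a (x - e) < Num.min b (x + e).
  by rewrite gt_max !lt_min ab/=; apply/and3P; split; lra.
have [r] := rat_in_itvoo lt.
rewrite in_itv/= gt_max lt_min => /andP[/andP[r0 r1] /andP[r2 r3]].
apply: (he (ratr r)); last exact: h.
by rewrite ltr_norml; apply/andP; split; lra.
Qed.

Lemma dense_constant f (a b c : R) : continuous f -> a < b ->
  (forall r : rat, a < ratr r -> ratr r < b -> f (ratr r) = c) ->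
  forall x, a <= x -> x <= b -> f x = c.
Proof. by move=> cf; exact: dense_closed (@closed_eq R c). Qed.

(** Almost surely one controls only rational time intervals. All rational times of []a, b[] share
    the value at one of them, and continuity extends it to the end points. *)
Lemma locally_constant f (Q : R -> Prop) (a b : R) : continuous f -> a <= b -> 0 <= a ->
  (forall r r' : rat, 0 <= ratr r :> R -> ratr r <= ratr r' :> R ->
    (forall s, ratr r <= s -> s <= ratr r' -> Q s) -> f (ratr r') = f (ratr r)) ->
  (forall s, a <= s -> s <= b -> Q s) -> f b = f a.
Proof.
move=> cf; rewrite le_eqVlt => /predU1P[->//|ab] a0 h Qab.
have [r0] := rat_in_itvoo ab; rewrite in_itv/= => /andP[ar0 r0b].
have H x : a <= x -> x <= b -> f x = f (ratr r0).
  apply: (dense_constant cf ab) => r ar rb.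
  have [rr|/ltW rr] := leP (ratr r : R) (ratr r0).
    apply/esym; apply: h => //; first by lra.
    by move=> s s1 s2; apply: Qab; lra.
  apply: h => //; first by lra.
  by move=> s s1 s2; apply: Qab; lra.
by rewrite !H//; exact: ltW.
Qed.

(** After its last time [sg] with [q sg >= 0], a path that becomes negative would stay below 0;
    there it is constant, so it could not have left the value [q sg]. *)
Lemma nonneg_path q : continuous q ->
  (forall r r' : rat, 0 <= ratr r :> R -> ratr r <= ratr r' :> R ->
    (forall s, ratr r <= s -> s <= ratr r' -> q s <= 0) -> q (ratr r') = q (ratr r)) ->
  0 <= q 0 -> forall t, 0 <= t -> 0 <= q t.
Proof.
move=> cq hN q0 t t0; rewrite leNgt; apply/negP => qt.
have [sg [sg0 sgt Cs h]] := last_hit cq (@closed_ge R 0) t0 q0.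
have h' (r : R) : sg < r -> r <= t -> q r < 0.
  by move=> r0 rt; rewrite ltNge; apply/negP; exact: h.
have sgt' : sg < t.
  by rewrite lt_neqAle sgt andbT; apply/negP => /eqP e; move: Cs qt; rewrite e/=; lra.
have qs : q sg <= 0.
  rewrite leNgt; apply/negP => qs.
  have [e e0 he] := near_dist (cvgr_gt (q sg) (cq sg) 0 qs).
  pose r := Num.min t (sg + e / 2).
  have [r1 r2] : sg < r /\ r <= t.
    by split; [rewrite lt_min sgt'/=; lra|rewrite ge_min lexx].
  have : 0 < q r.
    apply: he; rewrite distrC gtr0_norm; last by rewrite subr_gt0.
    have : r <= sg + e / 2 by rewrite ge_min lexx orbT.
    lra.
  by have := h' r r1 r2; lra.
have : q t = q sg.
  apply: (locally_constant cq sgt sg0 hN) => s.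
  rewrite le_eqVlt => /predU1P[<-//|s1 s2]; exact/ltW/h'.
by move: Cs; rewrite /=; lra.
Qed.

(** [q] stands for a path of a solution and [D] for the driving path. The hypotheses hold almost
    surely: [hN] and [hM] by locality, [hA] by optional stopping, which is available when the start
    is nonnegative, whence its premise. *)
Lemma stopped_unique q D : continuous q -> continuous D -> q 0 = D 0 ->
  (forall r r' : rat, 0 <= ratr r :> R -> ratr r <= ratr r' :> R ->
    (forall s, ratr r <= s -> s <= ratr r' -> q s <= 0) -> q (ratr r') = q (ratr r)) ->
  (forall (n : nat) (r r' : rat), 0 <= ratr r :> R -> ratr r <= ratr r' :> R ->
    (forall s, ratr r <= s -> s <= ratr r' -> n.+1%:R^-1 <= q s) ->
    q (ratr r') - D (ratr r') = q (ratr r) - D (ratr r)) ->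
  ((forall t, 0 <= t -> 0 <= q t) -> forall (r : rat) s, 0 <= s -> s <= ratr r ->
    q s = 0 -> q (ratr r) = 0) ->
  forall t, 0 <= t -> q t = stopped D t.
Proof.
move=> cq cD qD0 hN hM hA.
have N a b : 0 <= a -> a <= b -> (forall s, a <= s -> s <= b -> q s <= 0) -> q b = q a.
  by move=> a0 ab; exact: locally_constant.
have M a b : 0 <= a -> a <= b -> (forall s, a <= s -> s <= b -> 0 < q s) ->
    q b - D b = q a - D a.
  move=> a0 ab qp.
  (* A positive path has a positive minimum on [[a, b]], so it stays above some [n.+1%:R^-1], the
     form in which [hM] applies. *)
  have [|c /itvP ct qc] := @EVT_min R q a b ab; first exact: continuous_subspaceT.
  have qc0 : 0 < q c by apply: qp; rewrite ct.
  have [n nq] := archi_inv_lt qc0.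
  apply: (@locally_constant (fun t => q t - D t) (fun s => n.+1%:R^-1 <= q s) a b _ ab a0).
  - by move=> x; apply: cvgB; [exact: cq|exact: cD].
  - exact: hM.
  - move=> s s1 s2; apply: (le_trans (ltW nq)).
    by apply: qc; rewrite in_itv/= s1.
(* From a negative start the path never reaches 0: it is constant up to the first time at which it
   would. *)
have [q0|q0] := ltP (q 0) 0.
  have neg t : 0 <= t -> q t < 0.
    move=> t0; rewrite ltNge; apply/negP => qt.
    have [tau [tau0 _ Ct h]] := first_hit cq (@closed_ge R 0) t0 qt.
    have h' (r : R) : 0 <= r -> r < tau -> q r < 0.
      by move=> r0 rt; rewrite ltNge; apply/negP; exact: h.
    have qt0 : q tau <= 0.
      have := @first_hit_le0 R (fun s => - q s) tau; rewrite !oppr_le0 oppr_gt0.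
      move=> /(_ _ q0 tau0 Ct) e.
      have : - q tau = 0.
        apply: e; first by move=> x; apply: cvgN; exact: cq.
        by move=> r r0 rt; rewrite oppr_gt0; exact: h'.
      lra.
    have : q tau = q 0.
      apply: N => // s s0; rewrite le_eqVlt => /predU1P[->//|st].
      by apply: ltW; exact: h'.
    by move: Ct; rewrite /=; lra.
  move=> t t0; rewrite (N 0 t)//; last by move=> s s0 _; exact/ltW/neg.
  have [[h _]|[tau [tau0 _ h ->//]]] := stoppedE cD (fun s _ => erefl (D s)).
    by have := h 0 (lexx _); lra.
  have -> : tau = 0.
    apply/eqP; rewrite eq_le tau0 andbT leNgt; apply/negP => tp.
    by have := h 0 (lexx _) tp; lra.
  by rewrite (min_r t0).
have pos := nonneg_path cq hN q0.
have absorb s t : 0 <= s -> s <= t -> q s = 0 -> q t = 0.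
  move=> s0; rewrite le_eqVlt => /predU1P[<-//|st] qs.
  apply: (dense_constant cq st) => //; last exact: ltW.
  by move=> r /ltW sr _; exact: (hA pos r s).
have eqD t : 0 <= t -> (forall s, 0 <= s -> s < t -> 0 < q s) -> forall s, 0 <= s -> s <= t -> q s = D s.
  move=> t0 qp s s0 st.
  have E u : 0 <= u -> u < t -> q u - D u = 0.
    move=> u0 ut; rewrite (M 0 u)//; first by rewrite qD0 subrr.
    by move=> r r0 ru; apply: qp => //; exact: le_lt_trans ut.
  have : q s - D s = 0; last by lra.
  have [tp|tn] := ltP 0 t; last first.
    have -> : s = 0 by lra.
    by rewrite qD0 subrr.
  pose qd u := q u - D u.
  have cqd : continuous qd by move=> x; apply: cvgB; [exact: cq|exact: cD].
  by apply: (dense_constant cqd tp) => // r /ltW r0 rt; exact: E.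
move=> t t0.
have [[s [s0 st qs]]|nh] := pselect (exists s : R, [/\ 0 <= s, s <= t & q s <= 0]).
  have [tau [tau0 taus Ct h]] := first_hit cq (@closed_le R 0) s0 qs.
  have h' (r : R) : 0 <= r -> r < tau -> 0 < q r.
    by move=> r0 rt; rewrite ltNge; apply/negP; exact: h.
  have qtau : q tau = 0 by apply/eqP; rewrite eq_le pos// andbT; exact: Ct.
  have tt : tau <= t by exact: le_trans st.
  rewrite (absorb tau t)//.
  have Dtau : D tau = 0 by rewrite -(eqD tau)// qtau.
  have [[H _]|[sg [sg0 Dsg H ->//]]] := stoppedE cD (fun s _ => erefl (D s)).
    by have := H tau tau0; lra.
  have -> : Num.min t sg = tau.
    (* The two paths agree up to [tau]. So [sg < tau] contradicts [0 < q sg], and [tau < sg]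
       contradicts [D tau = 0]. *)
    have [lt|gt|->] := ltgtP sg tau.
    - have := h' sg sg0 lt; rewrite (eqD tau)//; last exact: ltW.
      rewrite Dsg -qD0; have [|] := leP (q 0) 0; lra.
    - by have := H tau tau0 gt; lra.
    - by rewrite min_r.
  by rewrite Dtau.
have qp s : 0 <= s -> s <= t -> 0 < q s.
  by move=> s0 st; rewrite ltNge; apply/negP => qs; apply: nh; exists s.
have eqDt s : 0 <= s -> s <= t -> q s = D s.
  by apply: (eqD t) => // r r0 /ltW rt; exact: qp.
have [[_ ->//]|[sg [sg0 Dsg _ ->//]]] := stoppedE cD (fun s _ => erefl (D s)).
  exact: eqDt.
have [|lt] := leP t sg; first by rewrite eqDt.
have := qp sg sg0 (ltW lt); rewrite eqDt//; last exact: ltW.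
by rewrite Dsg -qD0; have [|] := leP (q 0) 0; lra.
Qed.
End path_uniqueness.

Lemma ae_eq_integrable d (T : measurableType d) (R : realType)
    (Q : {measure set T -> \bar R}) (f g : T -> \bar R) :
  measurable_fun [set: T] g -> ae_eq Q [set: T] f g ->
  Q.-integrable [set: T] f -> Q.-integrable [set: T] g.
Proof.
move=> mg fg /integrableP[mf fi]; apply/integrableP; split => //.
rewrite (ae_eq_integral (fun x => `|f x|)%E)//.
- exact: measurableT_comp.
- exact: measurableT_comp.
- by apply: filterS fg => x fgx _; rewrite fgx.
Qed.

(* Optional stopping along a grid [tau]: with [A i] the event that [X] has been at
   most [e] at one of the times [tau 0], ..., [tau i], the mean of [X (tau i)] on
   [A i] is at most [e * P (A i)]. *)
Section absorption.
Context (R : realType) d (Omega : measurableType d) (P : probability Omega R).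
Context (F : R -> set_system Omega) (zeta : Omega -> R) (X I : R -> Omega -> R).
Hypotheses (hF : is_filtration F) (hz : smeas (F 0) zeta).
Hypotheses (cX : continuous_paths X) (Xs : forall t, 0 <= t -> smeas (F t) (X t)).
Hypothesis Im : forall t, 0 <= t -> measurable_fun [set: Omega] (I t).
Hypothesis XI : {ae P, forall w, forall t, 0 <= t -> X t w = zeta w + I t w}.
Hypothesis X0 : {ae P, forall w, X 0 w = zeta w}.
Hypothesis X_ge0 : {ae P, forall w, 0 <= zeta w -> forall t, 0 <= t -> 0 <= X t w}.
Hypothesis I_mean : forall a b (g : Omega -> R), 0 <= a -> a <= b ->
  smeas (F a) g -> (forall w, `|g w| <= 1) ->
  P.-integrable [set: Omega] (fun w => (g w * (I b w - I a w))%:E) /\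
  (\int[P]_w (g w * (I b w - I a w))%:E = 0)%E.

Let Fm (t : R) : 0 <= t -> F t `<=` measurable.
Proof. by case: hF => _ h _; exact: h. Qed.

Let Fle (s t : R) : 0 <= s -> s <= t -> F s `<=` F t.
Proof. by case: hF => _ _; exact. Qed.

Let Xm (t : R) : 0 <= t -> measurable_fun [set: Omega] (X t).
Proof. by move=> t0; exact: smeas_measurable (Fm t0) (Xs t0). Qed.

Section discrete.
Context (tau : nat -> R) (K e : R).
Hypotheses (tau0 : 0 <= tau 0) (tauS : forall i, tau i <= tau i.+1).

Let A i := zeta @^-1` `[0, K] `&` \bigcup_(j in `I_i.+1) (X (tau j) @^-1` `]-oo, e]).

Let tau_le i j : (i <= j)%N -> tau i <= tau j.
Proof. by move=> ij; apply: (homo_leq lexx le_trans) ij. Qed.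

Let tau_ge0 i : 0 <= tau i.
Proof. by rewrite (le_trans tau0)// tau_le. Qed.

Let A_smeas i : smeas (F (tau i)) (\1_(A i) : Omega -> R).
Proof.
have [sF _ _] := hF; apply: smeas_indic.
rewrite -(sigma_algebra_id (sF _ (tau_ge0 i))).
pose T := g_sigma_algebraType (F (tau i)).
change (@measurable _ T (A i)); apply: measurableI.
  rewrite -[X in measurable X]setTI.
  exact: (smeas_sub (Fle (lexx 0) (tau_ge0 i)) hz measurableT).
apply: bigcup_measurable => j ji; rewrite -[X in measurable X]setTI.
have ji' : (j <= i)%N by [].
exact: (smeas_sub (Fle (tau_ge0 j) (tau_le ji')) (Xs (tau_ge0 j)) measurableT).
Qed.

Let A_le1 i w : `|\1_(A i) w : R| <= 1.
Proof. by rewrite indicE; case: (_ \in _); rewrite ?normr1 ?normr0. Qed.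

Let mA i : measurable (A i).
Proof.
have := smeas_measurable (Fm (tau_ge0 i)) (@A_smeas i).
move=> /(_ measurableT [set 1] (measurable_set1 _)).
rewrite setTI (_ : _ @^-1` _ = A i)//; apply/seteqP; split => w /=.
  by rewrite indicE; case: (boolP (w \in A i)) => [/set_mem//|_ /eqP]; rewrite eq_sym oner_eq0.
by move=> Aw; rewrite indicE mem_set.
Qed.

Let incr_mean i :
  P.-integrable [set: Omega] (fun w => (\1_(A i) w * (X (tau i.+1) w - X (tau i) w))%:E) /\
  (\int[P]_w (\1_(A i) w * (X (tau i.+1) w - X (tau i) w))%:E = 0)%E.
Proof.
have [ii i0] := I_mean (tau_ge0 i) (tauS i) (@A_smeas i) (A_le1 i).
have m1 : measurable_fun [set: Omega] (fun w => (\1_(A i) w * (I (tau i.+1) w - I (tau i) w))%:E).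
  by case/integrableP: ii.
have m2 : measurable_fun [set: Omega] (fun w => (\1_(A i) w * (X (tau i.+1) w - X (tau i) w))%:E).
  apply/measurable_EFinP; apply: measurable_funM; first exact: measurable_indic.
  by apply: measurable_funB; exact: Xm.
have h : ae_eq P [set: Omega] (fun w => (\1_(A i) w * (I (tau i.+1) w - I (tau i) w))%:E)
    (fun w => (\1_(A i) w * (X (tau i.+1) w - X (tau i) w))%:E).
  apply: filterS XI => w Xw _; rewrite !Xw//; congr (_%:E); ring.
split; first by apply: (ae_eq_integrable m2 h ii).
by rewrite -(ae_eq_integral _ _ _ _ _ h).
Qed.

Let A_incr i w : A i w -> A i.+1 w.
Proof. by move=> [zw [j ji Xw]]; split => //; exists j => //; exact: leqW. Qed.

Let A_zeta i w : \1_(A i) w * `|zeta w| <= K * \1_(A i) w.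
Proof.
rewrite indicE; have [/set_mem[zK _]|_] := boolP (w \in A i); last by rewrite mul0r mulr0.
by move: zK; rewrite /= in_itv/= mul1r mulr1 => /andP[z0 zK]; rewrite ger0_norm.
Qed.

(** [X] inherits the possible lack of integrability of [zeta]; on [A i], however, [zeta] lies in
    [[0, K]], and the stochastic integral is integrable. *)
Let X_integrable i :
  P.-integrable [set: Omega] (fun w => (\1_(A i) w * X (tau i) w)%:E).
Proof.
have g1 (w : Omega) : `|cst (1 : R) w| <= 1 by rewrite /= normr1.
have [i1 _] := I_mean (lexx 0) (tau_ge0 i) (smeas_cst 1) g1.
have iz : P.-integrable [set: Omega] (fun w => (\1_(A i) w * zeta w)%:E).
  apply: (@le_integrable _ _ _ P _ measurableT _ (cst K%:E)) => //.
  - apply/measurable_EFinP; apply: measurable_funM; first exact: measurable_indic.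
    exact: smeas_measurable (Fm (lexx 0)) hz.
  - move=> w _; rewrite /= lee_fin normrM [`|\1_(A i) w|]ger0_norm//.
    apply: le_trans (A_zeta i w) _; apply: le_trans (ler_norm _) _.
    by rewrite normrM ler_piMr.
  - exact: finite_measure_integrable_cst.
have mi : measurable_fun [set: Omega] (\1_(A i) : Omega -> R) by exact: measurable_indic.
have iI := integrable_bounded_mul mi (@A_le1 i) i1.
apply: (ae_eq_integrable _ _ (integrableD measurableT iI iz)).
- apply/measurable_EFinP; apply: measurable_funM; first exact: measurable_indic.
  exact: Xm.
apply: filterS2 XI X0 => w Xw X0w _; rewrite /= -EFinD; congr (_%:E).
have := Xw 0 (lexx 0); rewrite X0w (Xw (tau i))// => h.
have -> : I 0 w = 0 by lra.
ring.
Qed.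

(** By induction: on [A i], known at time [tau i], the next increment has mean zero, and on the
    newly added event [A i.+1] minus [A i] the current value is at most [e]. *)
Let discrete_bound i : (\int[P]_w (\1_(A i) w * X (tau i) w)%:E <= e%:E * P (A i))%E.
Proof.
have i1 B : measurable B -> P.-integrable [set: Omega] (fun w => (e * \1_B w)%:E).
  move=> mB; under eq_fun do rewrite EFinM; apply: integrableZl => //.
  by apply: integrable_indic => //; rewrite ltey_eq fin_num_measure.
have E B : measurable B -> (e%:E * P B = \int[P]_w (e * \1_B w)%:E)%E.
  move=> mB; under eq_integral do rewrite EFinM.
  rewrite integralZl//; first by rewrite integral_indic// setIT.
  by apply: integrable_indic => //; rewrite ltey_eq fin_num_measure.
elim: i => [|i ih].
  rewrite E//; apply: le_integral => //; first exact: i1.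
  move=> w _; rewrite lee_fin indicE.
  have [/set_mem[_ [j]]|_] := boolP (w \in A 0); last by rewrite mul0r mulr0.
  by rewrite /= ltnS leqn0 => /eqP ->; rewrite in_itv/= mul1r mulr1.
have [di d0] := incr_mean i.
have mD : measurable (A i.+1 `\` A i) by exact: measurableD.
have hA w : \1_(A i.+1) w = \1_(A i) w + \1_(A i.+1 `\` A i) w :> R.
  rewrite !indicE in_setD; have [/set_mem Aw|_] := boolP (w \in A i).
    by rewrite mem_set ?addr0//; exact: A_incr.
  by rewrite add0r andbT.
apply: (@le_trans _ _ (\int[P]_w ((\1_(A i) w * X (tau i) w)%:E +
   (\1_(A i) w * (X (tau i.+1) w - X (tau i) w))%:E + (e * \1_(A i.+1 `\` A i) w)%:E))%E).
  apply: le_integral => //.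
  - by apply: integrableD => //; [apply: integrableD => //; exact: X_integrable|exact: i1].
  move=> w _; rewrite -!EFinD lee_fin hA mulrDl.
  rewrite [in leRHS]mulrBr addrCA subrr addr0 lerD2l indicE.
  have [/set_mem[[zw [j]]]|_] := boolP (w \in A i.+1 `\` A i); last by rewrite mul0r mulr0.
  rewrite /= ltnS leq_eqVlt => /predU1P[->|ji Xw nA].
    by rewrite in_itv/= mul1r mulr1.
  by exfalso; apply: nA; split => //; exists j.
rewrite integralD//; [|by apply: integrableD => //; exact: X_integrable|exact: i1].
rewrite integralD//.
rewrite d0 adde0 -E//.
have -> : (P (A i.+1) = P (A i) + P (A i.+1 `\` A i))%E.
  rewrite -measureU//; last by rewrite setDIK.
  congr (P _); apply/seteqP; split => [w Aw|w [/A_incr//|[]//]].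
  by have [|] := pselect (A i w); [left|right].
by rewrite muleDr ?leeD2r// ge0_adde_def// inE.
Qed.

(** Markov's inequality for [X (tau n)] on [A n], where it is almost surely nonnegative since [zeta]
    is. *)
Lemma discrete_absorption (n : nat) (dl : R) : 0 < e -> 0 < dl ->
  (P (A n `&` X (tau n) @^-1` `[dl, +oo[) <= (e / dl)%:E)%E.
Proof.
move=> e0 d0; set B := _ `&` _.
have mB : measurable B.
  by apply: measurableI => //; rewrite -[X in measurable X]setTI; exact: Xm.
have : (dl%:E * P B <= e%:E)%E.
  have -> : (dl%:E * P B = \int[P]_w (dl * \1_B w)%:E)%E.
    under eq_integral do rewrite EFinM.
    rewrite ge0_integralZl//; first by rewrite integral_indic// setIT.
    + by apply/measurable_EFinP; exact: measurable_indic.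
    + by rewrite lee_fin ltW.
  apply: (@le_trans _ _ (\int[P]_w (\1_(A n) w * X (tau n) w)%:E)%E).
    have h : ae_eq P [set: Omega] (fun w => (\1_(A n) w * X (tau n) w)%:E)
        (fun w => (\1_(A n) w * Num.max 0 (X (tau n) w))%:E).
      apply: filterS X_ge0 => w Xw _; rewrite indicE.
      have [/set_mem[]|_] := boolP (w \in A n); last by rewrite !mul0r.
      by rewrite /= in_itv/= => /andP[/Xw/(_ _ (tau_ge0 n)) X0w _] _; rewrite max_r.
    have mM : measurable_fun [set: Omega] (fun w => (\1_(A n) w * Num.max 0 (X (tau n) w))%:E).
      apply/measurable_EFinP; apply: measurable_funM; first exact: measurable_indic.
      by apply: (@measurable_maxr _ _ _ _ (cst 0)); [exact: measurable_cst|exact: Xm].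
    rewrite (ae_eq_integral _ _ _ _ _ h)//; last first.
      by case/integrableP: (X_integrable n).
    apply: ge0_le_integral => //.
    + by move=> w _; rewrite lee_fin mulr_ge0// ltW.
    + by apply/measurable_EFinP; apply: measurable_funM; [exact: measurable_cst|exact: measurable_indic].
    move=> w _; rewrite lee_fin [\1_B w]indicE.
    have [/set_mem[Aw]|_] := boolP (w \in B); last by rewrite mulr0 mulr_ge0// le_max lexx.
    by rewrite /= in_itv/= andbT indicE mem_set// mulr1 mul1r le_max => ->; rewrite orbT.
  apply: le_trans (discrete_bound n) _.
  by rewrite -[leRHS]mule1 lee_wpmul2l ?lee_fin ?probability_le1// ltW.
have fP : P B \is a fin_num by rewrite fin_num_measure.
by rewrite -(fineK fP) -EFinM !lee_fin ler_pdivlMr// mulrC.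
Qed.
End discrete.
Lemma absorption (t : R) : 0 < t -> {ae P, forall w, 0 <= zeta w ->
  forall s, 0 <= s -> s <= t -> X s w = 0 -> X t w = 0}.
Proof.
move=> t0.
(* Dyadic grids are nested, so the events [B K k m n] increase with [n], and a bound uniform in [n]
   passes to their union. *)
pose tau n (i : nat) : R := t * (i%:R / 2 ^+ n).
have p2 n : 0 < 2 ^+ n :> R by rewrite exprn_gt0.
have tau_ge0 n i : 0 <= tau n i by rewrite mulr_ge0// ?divr_ge0// ltW.
have tauS n i : tau n i <= tau n i.+1.
  by rewrite ler_pM2l// ler_pM2r ?invr_gt0// ler_nat.
have tau_last n : tau n (2 ^ n)%N = t by rewrite /tau natrX mulfV ?mulr1// gt_eqF.
have tau2 n j : tau n j = tau n.+1 j.*2.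
  rewrite /tau exprS -mul2n natrM; congr (_ * _).
  by rewrite invfM mulrACA mulfV ?mul1r// pnatr_eq0.
pose B (K k m n : nat) := (zeta @^-1` `[0, K%:R] `&`
  \bigcup_(j in `I_(2 ^ n).+1) (X (tau n j) @^-1` `]-oo, m.+1%:R^-1])) `&`
  X t @^-1` `[k.+1%:R^-1, +oo[.
have mB K k m n : measurable (B K k m n).
  apply: measurableI; last by rewrite -[X in measurable X]setTI; exact: (Xm (ltW t0)).
  apply: measurableI.
    by rewrite -[X in measurable X]setTI; exact: (smeas_measurable (Fm (lexx 0)) hz).
  apply: bigcup_measurable => j _; rewrite -[X in measurable X]setTI.
  exact: (Xm (tau_ge0 n j)).
have PB K k m n : (P (B K k m n) <= (m.+1%:R^-1 / k.+1%:R^-1)%:E)%E.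
  have := @discrete_absorption (tau n) K%:R m.+1%:R^-1 (tau_ge0 n 0) (tauS n) (2 ^ n)%N k.+1%:R^-1.
  by rewrite tau_last; apply; rewrite invr_gt0.
have B_incr K k m : {homo B K k m : n p / (n <= p)%N >-> (n <= p)%O}.
  apply: (homo_leq lexx le_trans).
  move=> n; apply/subsetPset => w [[zw [j /= jn Xj]] Xt]; split => //; split => //.
  exists j.*2; last by rewrite /= -tau2.
  by rewrite /= ltnS expnS mul2n leq_double -ltnS.
(* Outcomes for which [X] comes below every [m.+1%:R^-1] at dyadic times and yet is at least
   [k.+1%:R^-1] at time [t]. The probability is at most [k.+1%:R / m.+1%:R] for every [m], hence
   0. *)
pose N K k := \bigcap_m \bigcup_n B K k m n.
have mU K k m : measurable (\bigcup_n B K k m n) by exact: bigcup_measurable.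
have mN K k : measurable (N K k) by exact: bigcap_measurable.
have PN K k : P (N K k) = 0.
  apply/eqP; rewrite eq_le measure_ge0 andbT; apply/lee_addgt0Pr => e e0; rewrite add0e.
  have [m hm] := archi_inv_lt (divr_gt0 e0 (ltr0Sn R k)).
  apply: (@le_trans _ _ (P (\bigcup_n B K k m n))).
    by apply: le_measure; rewrite ?inE//; exact: bigcap_inf.
  have cv := @nondecreasing_cvg_mu _ _ _ P _ (mB K k m) (mU K k m) (B_incr K k m).
  rewrite -(cvg_lim _ cv)//; apply: lime_le.
    by apply/cvg_ex; eexists; exact: cv.
  apply: nearW => n; apply: le_trans (PB K k m n) _.
  by rewrite lee_fin invrK; move: hm; rewrite ltr_pdivlMr// => /ltW.
have : {ae P, forall w, forall K k : nat, ~ N K k w}.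
  apply: ae_foralln => K; apply: ae_foralln => k.
  exists (N K k); split; [exact: mN|exact: PN|] => w /=; exact: contrapT.
apply: filterS2 X_ge0 => w Xw Nw z0 s s0 st Xs0.
have Xt0 := Xw z0 t (ltW t0).
apply/eqP; rewrite eq_le Xt0 andbT leNgt; apply/negP => Xt.
have [k hk] := archi_inv_lt Xt.
pose K := (Num.trunc (zeta w)).+1.
apply: (Nw K k) => m _.
have cq := within_ge0_continuous (@cX w).
have qs : X (Num.max 0 s) w < m.+1%:R^-1 by rewrite max_r// Xs0 invr_gt0.
have [e e0 he] := near_dist (cvgr_lt (X (Num.max 0 s) w) (cq s) _ qs).
have [n hn] : exists n : nat, t / 2 ^+ n < e.
  have [n hn] := archi_inv_lt (divr_gt0 e0 t0); exists n.
  rewrite mulrC -ltr_pdivlMr//; apply: le_lt_trans hn.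
  rewrite lef_pV2 ?posrE//; by rewrite -natrX ler_nat ltn_expl.
exists n => //; split; last by rewrite /= in_itv/= andbT ltW.
split; first by rewrite /= in_itv/= z0 ltW// truncnS_gt.
(* The last dyadic time up to [s]; it is within one mesh of the zero [s], so by continuity [X] is
   below [m.+1%:R^-1] there. *)
pose j := Num.trunc (s / t * 2 ^+ n).
have x0 : 0 <= s / t * 2 ^+ n by rewrite mulr_ge0// ?divr_ge0// ltW.
have /andP[j1 j2] := truncn_itv x0.
exists j.
  rewrite /= ltnS -(ler_nat R) natrX; apply: le_trans j1 _.
  by apply: ler_piMl; [exact: ltW|rewrite ler_pdivrMr// mul1r].
have E : s = t * (s / t * 2 ^+ n / 2 ^+ n).
  by rewrite mulfK ?gt_eqF// mulrCA mulfV ?mulr1// gt_eqF.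
have ts : tau n j <= s.
  by rewrite [leRHS]E ler_pM2l// ler_pM2r// invr_gt0.
have st' : s <= tau n j + t / 2 ^+ n.
  have -> : tau n j + t / 2 ^+ n = tau n j.+1.
    by rewrite /tau -[j.+1%:R]natr1 (mulrDl j%:R) mulrDr mul1r.
  by rewrite [leLHS]E ler_pM2l// ler_pM2r ?invr_gt0// ltW.
rewrite /= in_itv/= ltW//; have := he (tau n j); rewrite max_r//; apply.
by rewrite ger0_norm ?subr_ge0//; apply: le_lt_trans hn; rewrite lerBlDl.
Qed.
End absorption.

Lemma ae_forall_rat d (T : measurableType d) (R : realType)
    (Q : {measure set T -> \bar R}) (H : rat -> T -> Prop) :
  (forall r, {ae Q, forall w, H r w}) -> {ae Q, forall w r, H r w}.
Proof.
move=> h; have : {ae Q, forall w, forall n : nat, forall r, unpickle n = Some r -> H r w}.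
  apply: ae_foralln => n; case: (unpickle n) => [r|]; last exact: nearW.
  by apply: filterS (h r) => w Hw _ [<-].
by apply: filterS => w Hw r; apply: (Hw (pickle r)); rewrite pickleK.
Qed.

Section pathwise_uniqueness.
Context (R : realType) d (Omega : measurableType d) (P : probability Omega R).
Context (F : R -> set_system Omega) (zeta : Omega -> R) (W X : R -> Omega -> R).
Hypotheses (hF : is_filtration F) (hW : is_brownian P F W) (hz : smeas (F 0) zeta).

Lemma pathwise_uniqueness : is_solution P F zeta W X ->
  {ae P, forall w, forall t, 0 <= t -> X t w = stopped_process zeta W t w}.
Proof.
move=> [cX aX [I [[cI Im [Hn [Hcvg Icvg]]] XI]]].
have Xs t : 0 <= t -> smeas (F t) (X t).
  by move=> t0; apply/smeasP; [case: hF => h _ _; exact: h|exact: aX].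
(* Elementary integrals vanish at time 0, hence so does their L^2 limit. *)
have I0 : {ae P, forall w, I 0 w = 0}.
  apply: (ge0_integral_eq0_ae (Im 0 (lexx 0))).
  have cvc : ((fun n => \int[P]_w ((simple_integral W (Hn n) 0 w - I 0 w) ^+ 2)%:E) @ \oo
      --> \int[P]_w (I 0 w ^+ 2)%:E)%E.
    under eq_fun do under eq_integral do rewrite simple_integral0 sub0r sqrrN.
    exact: cvg_cst.
  by rewrite -(cvg_lim _ cvc)//; apply: cvg_lim => //; exact: Icvg.
have X0 : {ae P, forall w, X 0 w = zeta w}.
  by apply: filterS2 XI I0 => w -> // ->; rewrite addr0.
have local C c (a b : R) := @integral_local _ _ _ _ _ _ _ _ hF hW cX aX _ Im Hcvg Icvg C c a b.
have XN : {ae P, forall w, forall r r' : rat, 0 <= ratr r :> R -> ratr r <= ratr r' :> R ->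
    (forall s : R, ratr r <= s -> s <= ratr r' -> X s w <= 0) ->
    X (ratr r') w = X (ratr r) w}.
  apply: ae_forall_rat => r; apply: ae_forall_rat => r'.
  have [r0|r0] := leP 0 (ratr r : R); last exact: nearW.
  have [rr'|rr'] := leP (ratr r) (ratr r' : R); last by apply: nearW => w.
  have p0 x : [set y : R | y <= 0] x -> pos1 x = 0 by rewrite /= pos1E leNgt => /negbTE ->.
  have := local _ 0 _ _ (@closed_le R 0) p0 r0 rr'.
  apply: filterS2 XI => w Xw Lw _ _ h; have := Lw h.
  by rewrite mul0r !Xw//; [lra|exact: le_trans rr'].
have XM : {ae P, forall w, forall (n : nat) (r r' : rat), 0 <= ratr r :> R ->
    ratr r <= ratr r' :> R ->
    (forall s : R, ratr r <= s -> s <= ratr r' -> n.+1%:R^-1 <= X s w) ->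
    X (ratr r') w - X (ratr r) w = W (ratr r') w - W (ratr r) w}.
  (* The open half-line of positive numbers is exhausted by the closed ones above [n.+1%:R^-1], on
     each of which locality applies with [c = 1]. *)
  apply: ae_foralln => n; apply: ae_forall_rat => r; apply: ae_forall_rat => r'.
  have [r0|r0] := leP 0 (ratr r : R); last exact: nearW.
  have [rr'|rr'] := leP (ratr r) (ratr r' : R); last by apply: nearW => w.
  have p1 x : [set y : R | n.+1%:R^-1 <= y] x -> pos1 x = 1.
    by rewrite /= pos1E => nx; rewrite (lt_le_trans _ nx)// invr_gt0.
  have := local _ 1 _ _ (@closed_ge R n.+1%:R^-1) p1 r0 rr'.
  apply: filterS2 XI => w Xw Lw _ _ h; have := Lw h.
  by rewrite mul1r !Xw//; [lra|exact: le_trans rr'].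
pose q w (s : R) := X (Num.max 0 s) w.
have cq w : continuous (q w) by exact: within_ge0_continuous (@cX w).
have qE w s : 0 <= s -> q w s = X s w by move=> s0; rewrite /q max_r.
have XN' w : (forall r r' : rat, 0 <= ratr r :> R -> ratr r <= ratr r' :> R ->
    (forall s : R, ratr r <= s -> s <= ratr r' -> X s w <= 0) ->
    X (ratr r') w = X (ratr r) w) ->
  forall r r' : rat, 0 <= ratr r :> R -> ratr r <= ratr r' :> R ->
    (forall s : R, ratr r <= s -> s <= ratr r' -> q w s <= 0) ->
    q w (ratr r') = q w (ratr r).
  move=> XNw r r' r0 rr' h; rewrite !qE ?(le_trans r0)//; apply: XNw => // s s1 s2.
  by rewrite -qE ?(le_trans r0)//; exact: h.
have Xpos : {ae P, forall w, 0 <= zeta w -> forall t, 0 <= t -> 0 <= X t w}.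
  apply: filterS2 XN X0 => w XNw X0w z0 t t0; rewrite -qE//.
  apply: (nonneg_path (@cq w) (XN' _ XNw)) => //.
  by rewrite qE// X0w.
have XA : {ae P, forall w, forall r : rat, 0 <= zeta w -> forall s : R, 0 <= s -> s <= ratr r ->
    X s w = 0 -> X (ratr r) w = 0}.
  apply: ae_forall_rat => r.
  have [r0|r0] := ltP 0 (ratr r : R).
    apply: (absorption hF hz cX Xs XI X0 Xpos _ r0) => a b g a0 ab mg g1.
    exact: (integral_increment_mean hF hW Im Icvg a0 ab mg g1).
  apply: nearW => w _ s s0 sr Xs0.
  by have -> : ratr r = s by apply/eqP; rewrite eq_le sr andbT (le_trans r0).
apply: filterS2 (filterI XN XM) (filterI X0 XA) => w [XNw XMw] [X0w XAw] t t0.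
pose D s := driving_path zeta W w (Num.max 0 s).
have DE s : 0 <= s -> driving_path zeta W w s = D s by move=> s0; rewrite /D max_r.
rewrite -qE// /stopped_process (stopped_ext DE)//.
apply: stopped_unique => //.
- exact: (within_ge0_continuous (@driving_path_continuous _ _ _ _ _ zeta _ hW w)).
- by rewrite qE// X0w -DE// /driving_path subrr addr0.
- exact: XN'.
- move=> n r r' r0 rr' h.
  have : X (ratr r') w - X (ratr r) w = W (ratr r') w - W (ratr r) w.
    apply: (XMw n) => // s s1 s2; rewrite -qE ?(le_trans r0)//; exact: h.
  by rewrite -!DE ?(le_trans r0)// !qE ?(le_trans r0)// /driving_path; lra.
- move=> qpos r s s0 sr qs.
  have z0 : 0 <= zeta w by rewrite -X0w -qE//; exact: qpos.
  rewrite qE ?(le_trans s0)//; apply: (XAw r z0 s) => //; by rewrite -qE.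
Qed.
End pathwise_uniqueness.

(** * Laws on the path space *)

Section path_space.
Context (R : realType).
Implicit Types (p : R -> R) (A : set (path_space R)) (l : seq (rat * rat * rat * rat)).
Local Notation cyl := (@cylinders R `[0, +oo[).

(* [traj p A]: the restriction of [p] to the half-line is a path belonging to [A]. *)
Definition traj p A : Prop := exists2 f : path_space R, A f &
  forall t : half_line R, (f : half_line R -> R) t = p (set_val t).

Lemma half_line_ge0 (t : half_line R) : 0 <= set_val t :> R.
Proof. by have := set_valP t; rewrite /= in_itv/= andbT. Qed.

Lemma traj_exists p : {within `[0, +oo[, continuous p} ->
  exists f : path_space R, forall t : half_line R, (f : half_line R -> R) t = p (set_val t).
Proof.
move=> /within_ge0_continuous cq.
have cf : continuous (fun t : half_line R => p (Num.max 0 (set_val t : R))).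
  move=> t; apply: (@continuous_comp _ _ _ (set_val : half_line R -> R)
    (fun s : R => p (Num.max 0 s))); last exact: cq.
  exact: (@initial_continuous _ _ (set_val : half_line R -> R)).
exists (mkcts cf : continuousType (half_line R) R) => t /=.
by rewrite /mkcts max_r// half_line_ge0.
Qed.

Lemma path_eq (f g : path_space R) :
  (forall t, (f : half_line R -> R) t = (g : half_line R -> R) t) -> f = g.
Proof. by move=> h; apply/continuousEP. Qed.

Lemma traj_ext p q A : (forall t, 0 <= t -> p t = q t) -> traj p A -> traj q A.
Proof.
by move=> pq [f Af fp]; exists f => // t; rewrite fp pq// half_line_ge0.
Qed.

Definition box l : set (half_line R -> R) := [set f | forall a b c d : rat,
  (a, b, c, d) \in l -> forall s : half_line R,
  ratr a <= (set_val s : R) -> (set_val s : R) <= ratr b ->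
  ratr c <= f s /\ f s <= ratr d].

(* The boxes around [g] generate a filter that converges to [g]. *)
Lemma box_nbhs (g : path_space R) (A : set {compact-open, half_line R -> R}) :
  nbhs ((g : half_line R -> R) : {compact-open, half_line R -> R}) A ->
  exists l, box l g /\ box l `<=` A.
Proof.
pose F : set_system {compact-open, half_line R -> R} :=
  [set B | exists l, box l g /\ box l `<=` B].
have FF : Filter F.
  split.
  - by exists [::]; split => // a b c d.
  - move=> B C [l [lg lB]] [l' [l'g l'C]]; exists (l ++ l'); split.
      by move=> a b c d; rewrite mem_cat => /orP[/lg|/l'g]; exact.
    move=> f lf; split.
      by apply: lB => a b c d al; apply: lf; rewrite mem_cat al.
    by apply: l'C => a b c d al; apply: lf; rewrite mem_cat al orbT.
  - by move=> B C BC [l [lg lB]]; exists l; split => //; exact: subset_trans BC.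
move: A; change (F --> ((g : half_line R -> R) : {compact-open, half_line R -> R})).
apply/compact_open_cvgP => K O cK oO gKO.
have cg : continuous (g : half_line R -> R) by exact: cts_fun.
pose K' : set R := (set_val : half_line R -> R) @` K.
have cK' : compact K'.
  apply: continuous_compact => //; apply: continuous_subspaceT.
  exact: (@initial_continuous _ _ (set_val : half_line R -> R)).
(* Boxes containing [g] whose value range lies in [O]. Continuity of [g] provides one around each
   time of [K], and the open time intervals of finitely many of them cover the compact image of
   [K]. *)
pose D : set (rat * rat * rat * rat) := [set x | box [:: x] (g : half_line R -> R) /\
  (forall z : R, ratr x.1.2 <= z -> z <= ratr x.2 -> O z)].
pose U (x : rat * rat * rat * rat) : set R :=
  [set z | ratr x.1.1.1 < z] `&` [set z | z < ratr x.1.1.2].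
move: cK'; rewrite compact_cover => /(_ _ D U)[].
- by move=> x _; apply: openI; [exact: open_gt|exact: open_lt].
- move=> _ [x Kx <-].
  have Ogx : O ((g : half_line R -> R) x) by apply: gKO; exists x.
  have : nbhs ((g : half_line R -> R) x) O by exact: open_nbhs_nbhs.
  move=> /near_dist[e e0 he]; set y := (g : half_line R -> R) x in Ogx he.
  have [|c] := @rat_in_itvoo R (y - e) y; first by lra.
  rewrite in_itv/= => /andP[c1 c2].
  have [|dd] := @rat_in_itvoo R y (y + e); first by lra.
  rewrite in_itv/= => /andP[d1 d2].
  have oV : nbhs y ([set z : R | ratr c < z] `&` [set z : R | z < ratr dd]).
    by apply: open_nbhs_nbhs; split => //; apply: openI; [exact: open_gt|exact: open_lt].
  have [_ [[B' oB' <-] B'x hB]] := cg x _ oV.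
  have /near_dist[e' e'0 he'] : nbhs (set_val x : R) B' by exact: open_nbhs_nbhs.
  set vx := (set_val x : R) in he'.
  have [|a] := @rat_in_itvoo R (vx - e') vx; first by lra.
  rewrite in_itv/= => /andP[a1 a2].
  have [|b] := @rat_in_itvoo R vx (vx + e'); first by lra.
  rewrite in_itv/= => /andP[b1 b2].
  exists (a, b, c, dd); last by split.
  split.
    move=> a' b' c' d'; rewrite mem_seq1 => /eqP[-> -> -> ->] s sa sb.
    have Bs : B' (set_val s : R).
      by apply: he'; rewrite ltr_norml; apply/andP; split; lra.
    have [/= ? ?] := hB s Bs.
    by split; exact: ltW.
  move=> z /= z1 z2; apply: he; rewrite ltr_norml; apply/andP; split; lra.
- move=> D' D'D KD'; exists (finmap.enum_fset D'); split.
    move=> a b c d /D'D; rewrite inE => -[/(_ a b c d) h _]; apply: h.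
    by rewrite mem_seq1.
  move=> f lf _ [x Kx <-].
  case: (KD' (set_val x)) => [|[[[a b] c] d] /= D'i [/= ax xb]]; first by exists x.
  have /set_mem[_] := D'D _ D'i; apply.
    by have [] := lf a b c d D'i x (ltW ax) (ltW xb).
  by have [] := lf a b c d D'i x (ltW ax) (ltW xb).
Qed.

(** The trace of [box l] at rational times, which makes it a cylinder event; [box_traj] shows that
    nothing is lost on continuous paths. *)
Definition rational_box l : set (R -> R) := [set p | forall a b c d : rat, (a, b, c, d) \in l ->
  forall r : rat, 0 <= ratr r :> R -> ratr a <= ratr r :> R -> ratr r <= ratr b :> R ->
  ratr c <= p (ratr r) /\ p (ratr r) <= ratr d].

Lemma rational_box_cylinder l : cyl (rational_box l).
Proof.
pose T := g_sigma_algebraType cyl.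
have sT : sigma_algebra [set: R -> R] cyl by exact: smallest_sigma_algebra.
elim: l => [|[[[a b] c] d] l ih].
  rewrite (_ : rational_box _ = setT); last by apply/seteqP.
  rewrite -(sigma_algebra_id sT); exact: (@measurableT _ T).
pose E1 := \bigcap_(r in [set r : rat | [/\ 0 <= ratr r :> R, ratr a <= ratr r :> R
   & ratr r <= ratr b :> R]]) ((fun p : R -> R => p (ratr r)) @^-1` `[ratr c, ratr d]).
rewrite (_ : rational_box _ = E1 `&` rational_box l); last first.
  apply/seteqP; split => [p h|p [h1 h2] a' b' c' d'].
    split; last by move=> a' b' c' d' h'; apply: h; rewrite in_cons h' orbT.
    move=> r /= [r0 ar rb]; rewrite in_itv/=.
    by have [|-> ->] := h a b c d _ r r0 ar rb; rewrite ?mem_head.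
  rewrite in_cons => /predU1P[[-> -> -> ->] r r0 ar rb|]; last exact: h2.
  by have := h1 r; rewrite /= in_itv/= => /(_ _)/andP; apply.
rewrite -(sigma_algebra_id sT); apply: (@measurableI _ T); last first.
  by rewrite /measurable/= (sigma_algebra_id sT).
rewrite /E1 -[X in measurable X]setCK setC_bigcap bigcup_mkcond.
apply: (@measurableC _ T); apply: (@bigcupT_measurable_rat _ T) => r.
case: ifPn => [/set_mem[r0 _ _]|_]; last exact: (@measurable0 _ T).
apply: (@measurableC _ T).
rewrite -[X in measurable X]setTI; apply: (@cylinders_eval R `[0, +oo[ (ratr r)) => //.
by rewrite /= in_itv/= r0.
Qed.
Lemma box_traj l p (f : path_space R) : {within `[0, +oo[, continuous p} ->
  (forall t : half_line R, (f : half_line R -> R) t = p (set_val t)) ->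
  box l (f : half_line R -> R) <-> rational_box l p.
Proof.
move=> cp fp; split => [h a b c d al r r0 ar rb|h a b c d al s sa sb].
  have r0' : `[0, +oo[%classic (ratr r : R) by rewrite /= in_itv/= r0.
  have := h a b c d al (SigSub (mem_set r0') : half_line R); rewrite !fp /=; exact.
rewrite fp; set x := (set_val s : R) in sa sb *.
have x0 : 0 <= x by exact: half_line_ge0.
have cq := within_ge0_continuous cp.
pose q (t : R) := p (Num.max 0 t); have qE t : 0 <= t -> q t = p t by move=> t0; rewrite /q max_r.
have ax : Num.max 0 (ratr a) <= x by rewrite ge_max x0.
(* In a nondegenerate time interval rational times are dense; otherwise [x] equals [ratr b], which
   is itself a rational time. *)
have [ab|ab] := ltP (Num.max 0 (ratr a) : R) (ratr b).
  have cC : closed ([set y : R | ratr c <= y] `&` [set y : R | y <= ratr d]).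
    by apply: closedI; [exact: closed_ge|exact: closed_le].
  rewrite -qE//.
  have := @dense_closed R q _ _ _ cq cC ab _ x ax sb; apply => r; rewrite gt_max => /andP[r0 ar] rb.
  by rewrite qE ?ltW//; apply: (h a b c d al); exact: ltW.
have xb : x = ratr b by apply/eqP; rewrite eq_le sb (le_trans ab).
by rewrite xb; apply: (h a b c d al) => //; rewrite -xb.
Qed.

(** The sets with this property form a sigma-algebra, complements being handled by the existence and
    uniqueness of the trajectory of [p]. An open set is the union of the countably many boxes inside
    it. *)
Lemma borel_traj A : borel_paths A ->
  exists E, cyl E /\ forall p, {within `[0, +oo[, continuous p} -> traj p A <-> E p.
Proof.
pose T := g_sigma_algebraType cyl.
have sT : sigma_algebra [set: R -> R] cyl by exact: smallest_sigma_algebra.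
pose L := [set A | exists E, cyl E /\
  forall p, {within `[0, +oo[, continuous p} -> traj p A <-> E p].
suff: borel_paths (R := R) `<=` L by exact.
have tE p (f : path_space R) B : (forall t, (f : half_line R -> R) t = p (set_val t)) ->
    traj p B <-> B f.
  move=> fp; split => [[g Bg gp]|Bf]; last by exists f.
  by have -> // : f = g; apply: path_eq => t; rewrite fp gp.
have [T0 TC TU] := sT.
apply: smallest_sub.
  split.
  - by exists set0; split => // p _; split => // -[].
  - move=> B [E [cE hE]]; exists (setT `\` E); split; first exact: TC.
    move=> p cp; have [f fp] := traj_exists cp.
    rewrite (tE p f)//; rewrite !setTD /= -(hE p cp) (tE p f)//.
  - move=> B hB; have /choice[E hE] : forall n, exists E, cyl E /\
      forall p, {within `[0, +oo[, continuous p} -> traj p (B n) <-> E p by exact: hB.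
    exists (\bigcup_n E n); split; first by apply: TU => n; have [] := hE n.
    move=> p cp; split.
      by move=> [f [n _ Bf] fp]; exists n => //; apply/(hE n).2 => //; exists f.
    by move=> [n _ /((hE n).2 p cp)[f Bf fp]]; exists f => //; exists n.
move=> _ [B oB <-].
(* The code [n] contributes its box if that box lies in [B], and nothing otherwise. *)
pose E n := if unpickle n is Some l
  then if `[< box l `<=` B >] then rational_box l else set0 else set0.
exists (\bigcup_n E n); split.
  apply: TU => n; rewrite /E; case: unpickle => [l|//].
  by case: ifP => // _; exact: rational_box_cylinder.
move=> p cp; have [f fp] := traj_exists cp.
rewrite (tE p f)//; split => [Bf|[n _]].
  have [l [lf lB]] : exists l, box l (f : half_line R -> R) /\ box l `<=` B.
    by apply: box_nbhs; exact: open_nbhs_nbhs.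
  exists (pickle l) => //; rewrite /E pickleK; case: asboolP => // _.
  exact/(box_traj _ cp fp).
rewrite /E; case: unpickle => [l|//]; case: asboolP => // lB cl.
by apply: lB; exact/(box_traj _ cp fp).
Qed.
End path_space.

(** * Finite-dimensional laws of the driving path *)

Section finite_dimensional_laws.
Context {R : realType}.
Implicit Types (l : seq (R * set R)) (t x : R).

Fixpoint cylset l : set (R -> R) :=
  if l is (u, A) :: l' then (@^~ u) @^-1` A `&` cylset l' else setT.

(** Times may repeat, so that a new constraint is inserted into a list without merging it with one
    at the same time. *)
Fixpoint increasing_from t l : Prop :=
  if l is (u, A) :: l' then [/\ t <= u, measurable A & increasing_from u l'] else True.

(* The conditional probability, given that a Brownian motion is at [x] at time
   [t], that it belongs to [cylset l]. *)
Fixpoint transition t l x : \bar R :=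
  if l is (u, A) :: l' then
    if t < u then (\int[normal_prob 0 (Num.sqrt (u - t))]_y
        ((\1_A (x + y) : R)%:E * transition u l' (x + y)%R))%E
    else ((\1_A x : R)%:E * transition u l' x)%E
  else 1%E.

Lemma transition_ge0 t l x : (0 <= transition t l x)%E.
Proof.
elim: l t x => [|[u A] l ih] t x /=; first exact: lee01.
by case: ifP => _; [apply: integral_ge0 => y _|]; rewrite mule_ge0.
Qed.

Lemma step_measurable (A : set R) (h : R -> \bar R) : measurable A ->
  measurable_fun [set: R] h ->
  measurable_fun [set: R * measurableTypeR R]
    (fun z : R * measurableTypeR R => (\1_A (z.1 + z.2) : R)%:E * h (z.1 + z.2)%R)%E.
Proof.
move=> mA mh.
have ms : measurable_fun [set: R * measurableTypeR R]
    (fun z : R * measurableTypeR R => z.1 + z.2 : R).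
  by apply: measurable_funD; [exact: measurable_fst|exact: measurable_snd].
apply: emeasurable_funM; last exact: (measurableT_comp mh ms).
apply/measurable_EFinP.
by apply: (measurableT_comp _ ms); exact: measurable_indic.
Qed.

Lemma transition_measurable t l : increasing_from t l ->
  measurable_fun [set: R] (transition t l).
Proof.
elim: l t => [|[u A] l ih] t /=; first by move=> _; exact: measurable_cst.
move=> [tu mA lu]; have mh := ih u lu.
case: (t < u); last first.
  by apply: emeasurable_funM => //; apply/measurable_EFinP; exact: measurable_indic.
apply: (@measurable_fun_fubini_tonelli_F _ _ R (measurableTypeR R) _
  (normal_prob 0 (Num.sqrt (u - t))) _ (step_measurable mA mh)) => z.
by rewrite mule_ge0// transition_ge0.
Qed.
End finite_dimensional_laws.

Section driving_path_law.
Context (R : realType) d (Omega : measurableType d) (P : probability Omega R).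
Context (F : R -> set_system Omega) (zeta : Omega -> R) (W : R -> Omega -> R).
Hypotheses (hF : is_filtration F) (hW : is_brownian P F W) (hz : smeas (F 0) zeta).
Local Notation Z := (driving_path zeta W).

Let Zs t : 0 <= t -> smeas (F t) (fun w => Z w t).
Proof. by move=> t0; exact: (driving_path_smeas hF hW hz t0 (lexx t)). Qed.

Let sF t : 0 <= t -> sigma_algebra [set: Omega] (F t).
Proof. by case: hF => h _ _; exact: h. Qed.

Let Fm t : 0 <= t -> F t `<=` measurable.
Proof. by case: hF => _ h _; exact: h. Qed.

Let Zm t : 0 <= t -> measurable_fun [set: Omega] (fun w => Z w t).
Proof. by move=> t0; exact: smeas_measurable (Fm t0) (Zs t0). Qed.

Let F_setI t A B : 0 <= t -> F t A -> F t B -> F t (A `&` B).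
Proof.
move=> t0 FA FB; have [_ _ _ sI] := (sigma_algebraP (fun X _ => @subsetT _ X)).1 (sF t0).
exact: sI.
Qed.

(** The Markov property. Each induction step absorbs the first constraint into the past event [E]
    and integrates out the increment from [t] to [u], independent of [F t]. *)
Lemma cylset_transition l t E : 0 <= t -> F t E -> increasing_from t l ->
  (P (E `&` [set w | cylset l (Z w)]) =
   \int[P]_w ((\1_E w : R)%:E * transition t l (Z w t)))%E.
Proof.
elim: l t E => [|[u A] l ih] t E t0 FE /=.
  move=> _; under eq_integral do rewrite mule1.
  by rewrite integral_indic ?setIT//; exact: (Fm t0).
move=> [tu mA lu]; have u0 := le_trans t0 tu.
have FE' : F u (E `&` (Z^~ u) @^-1` A).
  apply: F_setI => //; first by case: hF => _ _ h; exact: (h _ _ t0 tu).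
  exact: smeas_set (sF u0) (Zs u0) mA.
have -> : E `&` [set w | ((@^~ u) @^-1` A `&` cylset l) (Z w)] =
    E `&` (Z^~ u) @^-1` A `&` [set w | cylset l (Z w)] by rewrite -setIA.
rewrite (ih u _ u0 FE' lu).
have E1 w : (\1_(E `&` (Z^~ u) @^-1` A) w : R) = \1_E w * \1_A (Z w u).
  by rewrite indicI; congr (_ * _); rewrite !indicE.
under eq_integral do rewrite E1.
move: tu; rewrite le_eqVlt => /predU1P[<-|tu].
  by rewrite ltxx; apply: eq_integral => w _; rewrite EFinM muleA.
rewrite tu.
pose N : probability (measurableTypeR R) R := normal_prob 0 (Num.sqrt (u - t)).
pose U w : R * R := (\1_E w, Z w t).
pose V w : measurableTypeR R := W u w - W t w.
(* The first coordinate stands for the indicator of [E]; its absolute value keeps [f] nonnegative on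
   the whole product space, as [ge0_integral_indep] requires. *)
pose f (z : (R * R) * measurableTypeR R) : \bar R :=
  (`|z.1.1|%:E * ((\1_A (z.1.2 + z.2) : R)%:E * transition u l (z.1.2 + z.2)%R))%E.
have mh := transition_measurable lu.
have mf : measurable_fun [set: (R * R) * measurableTypeR R] f.
  apply: emeasurable_funM.
    apply/measurable_EFinP; apply: measurableT_comp => //.
    by apply: measurableT_comp; [exact: measurable_fst|exact: measurable_fst].
  have m2 : measurable_fun [set: (R * R) * measurableTypeR R]
      (fun z : (R * R) * measurableTypeR R => (z.1.2, z.2)).
    apply: measurable_fun_pair; last exact: measurable_snd.
    by apply: measurableT_comp; [exact: measurable_snd|exact: measurable_fst].
  exact: (measurableT_comp (step_measurable mA mh) m2).
have f0 z : (0 <= f z)%E by rewrite !mule_ge0// transition_ge0.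
have mE : measurable E by exact: (Fm t0).
have Us : measurable_fun [set: g_sigma_algebraType (F t)] (U : g_sigma_algebraType (F t) -> R * R).
  by apply: measurable_fun_pair; [exact: smeas_indic|exact: Zs].
have mU : measurable_fun [set: Omega] U.
  by apply: measurable_fun_pair; [exact: measurable_indic|exact: Zm].
have mV : measurable_fun [set: Omega] V by exact: (increment_measurable hF hW t0 u0).
have PN A0 B : measurable A0 -> measurable B ->
    (P (U @^-1` A0 `&` V @^-1` B) = P (U @^-1` A0) * N B)%E.
  move=> mA0 mB; have [_ _ _ Wi Wn] := hW.
  have FA0 : F t (U @^-1` A0).
    by have := Us measurableT _ mA0; rewrite setTI /measurable/= (sigma_algebra_id (sF t0)).
  rewrite (Wi t u t0 tu _ _ FA0); last by exists B; rewrite ?setTI.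
  by congr (_ * _)%E; exact: (Wn t u t0 tu B mB).
transitivity (\int[P]_w f (U w, V w))%E.
  apply: eq_integral => w _; rewrite /f/= ger0_norm// EFinM muleA.
  by have -> : Z w t + V w = Z w u by rewrite /driving_path /V; ring.
rewrite (ge0_integral_indep mU mV PN mf f0).
apply: eq_integral => w _; rewrite /f/= ger0_norm// ge0_integralZl//.
- exact: (measurableT_comp (step_measurable mA mh) (pair1_measurable (Z w t))).
- by move=> y _; rewrite mule_ge0// transition_ge0.
Qed.

Lemma cylset_law l : increasing_from 0 l ->
  (P [set w | cylset l (Z w)] = \int[P]_w transition 0 l (zeta w))%E.
Proof.
move=> hl; rewrite -[X in P X]setTI (cylset_transition (lexx 0) _ hl).
  apply: eq_integral => w _.
  by rewrite indicT mul1e /driving_path subrr addr0.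
have [+ _ _ _] := (sigma_algebraP (fun X _ => @subsetT _ X)).1 (sF (lexx 0)).
exact.
Qed.
End driving_path_law.

Section cylinder_pi_system.
Context {R : realType}.
Implicit Types (l : seq (R * set R)) (t : R).

Definition cylinder_sets : set_system (R -> R) :=
  [set cylset l | l in [set l | increasing_from 0 l]].

Lemma cylset_insert l t u (A : set R) : measurable A -> t <= u -> increasing_from t l ->
  exists l', increasing_from t l' /\ cylset l' = (@^~ u) @^-1` A `&` cylset l.
Proof.
move=> mA; elim: l t => [|[v B] l ih] t tu /=.
  by move=> _; exists [:: (u, A)].
move=> [tv mB hl]; have [uv|/ltW vu] := leP u v.
  by exists [:: (u, A), (v, B) & l].
have [l' [hl' E]] := ih v vu hl.
by exists ((v, B) :: l'); split => //=; rewrite E setICA.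
Qed.

Lemma cylinder_sets_setI : setI_closed cylinder_sets.
Proof.
move=> _ _ [l hl <-] [l' hl' <-].
suff h k t : 0 <= t -> increasing_from t k ->
    exists2 k', increasing_from 0 k' & cylset k' = cylset k `&` cylset l'.
  by have [k hk <-] := h l 0 (lexx 0) hl; exists k.
elim: k t => [|[u A] k ih] t t0 /=; first by move=> _; exists l'; rewrite ?setTI.
move=> [tu mA hk]; have u0 := le_trans t0 tu.
have [k' hk' E] := ih u u0 hk.
have [k2 [hk2 E2]] := cylset_insert mA u0 hk'.
by exists k2 => //; rewrite E2 E setIA.
Qed.

Lemma cylinders_cylinder_sets : cylinders (R := R) `[0, +oo[ `<=` <<s cylinder_sets >>.
Proof.
apply: sub_sigma_algebra2 => _ [u /= + [A mA <-]]; rewrite in_itv/= andbT => u0.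
by exists [:: (u, A)] => //=; rewrite setIT setTI.
Qed.

Lemma cylinder_sets_cylinders : cylinder_sets `<=` cylinders (R := R) `[0, +oo[.
Proof.
move=> _ [l hl <-]; pose T := g_sigma_algebraType (cylinders (R := R) `[0, +oo[).
have sT : sigma_algebra [set: R -> R] (cylinders `[0, +oo[) by exact: smallest_sigma_algebra.
rewrite -(sigma_algebra_id sT); change (@measurable _ T (cylset l)).
have := lexx (0 : R); move: {1 3}0 hl => t.
elim: l t => [|[u A] l ih] t /=; first by move=> _ _; exact: (@measurableT _ T).
move=> [tu mA hl] t0; have u0 := le_trans t0 tu.
apply: (@measurableI _ T); last exact: ih hl u0.
rewrite -[X in measurable X]setTI; apply: (@cylinders_eval R `[0, +oo[ u) => //.
by rewrite /= in_itv/= u0.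
Qed.
End cylinder_pi_system.

Section law_uniqueness.
Context (R : realType).

Lemma pi_system_law (T : Type) (S : set_system T)
  d1 (O1 : measurableType d1) (P1 : probability O1 R) (Z1 : O1 -> T)
  d2 (O2 : measurableType d2) (P2 : probability O2 R) (Z2 : O2 -> T) : setI_closed S ->
  (forall E, S E -> [/\ measurable (Z1 @^-1` E), measurable (Z2 @^-1` E)
    & P1 (Z1 @^-1` E) = P2 (Z2 @^-1` E)]) ->
  forall E, <<s S >> E -> P1 (Z1 @^-1` E) = P2 (Z2 @^-1` E).
Proof.
move=> SI hS.
pose L := [set E | [/\ measurable (Z1 @^-1` E), measurable (Z2 @^-1` E)
    & P1 (Z1 @^-1` E) = P2 (Z2 @^-1` E)]].
suff : <<s S >> `<=` L by move=> h E /h[].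
rewrite -setI_closed_g_dynkin_g_sigma_algebra//.
apply: smallest_sub => //; split => [|C [m1 m2 CE]|C tC LC].
- by split; rewrite ?preimage_setT// !probability_setT.
- split; rewrite -?preimage_setC; [exact: measurableC|exact: measurableC|].
  by rewrite !probability_setC// CE.
have m1 n : measurable (Z1 @^-1` C n) by case: (LC n).
have m2 n : measurable (Z2 @^-1` C n) by case: (LC n).
split; rewrite ?preimage_bigcup; [exact: bigcupT_measurable|exact: bigcupT_measurable|].
rewrite !measure_bigcup//.
- by apply: eq_eseriesr => n _; case: (LC n).
- apply/trivIsetP => i j _ _ ij.
  by rewrite -preimage_setI; move/trivIsetP: tC => ->//; rewrite preimage_set0.
- apply/trivIsetP => i j _ _ ij.
  by rewrite -preimage_setI; move/trivIsetP: tC => ->//; rewrite preimage_set0.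
Qed.

Lemma eq_law_ge0_integral d1 (O1 : measurableType d1) (P1 : probability O1 R) (z1 : O1 -> R)
  d2 (O2 : measurableType d2) (P2 : probability O2 R) (z2 : O2 -> R) (f : R -> \bar R) :
  measurable_fun [set: O1] z1 -> measurable_fun [set: O2] z2 ->
  (forall A : set R, measurable A -> P1 (z1 @^-1` A) = P2 (z2 @^-1` A)) ->
  measurable_fun [set: R] f -> (forall x, 0 <= f x)%E ->
  (\int[P1]_w f (z1 w) = \int[P2]_w f (z2 w))%E.
Proof.
move=> m1 m2 law mf f0.
pose Z1 : {mfun O1 >-> R} := HB.pack z1 (isMeasurableFun.Build _ _ _ _ _ m1).
pose Z2 : {mfun O2 >-> R} := HB.pack z2 (isMeasurableFun.Build _ _ _ _ _ m2).
rewrite -(@ge0_integral_distribution _ _ _ _ _ P1 Z1)//.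
rewrite -(@ge0_integral_distribution _ _ _ _ _ P2 Z2)//.
by apply: eq_measure_integral => A mA _; exact: law.
Qed.

Lemma path_law_cylinder d (Omega : measurableType d) (P : probability Omega R)
  (X : R -> Omega -> R) (A : set (path_space R)) (E : set (R -> R)) : continuous_paths X ->
  (forall p : R -> R, {within `[0, +oo[, continuous p} -> traj p A <-> E p) ->
  path_law P X A = P [set w | E (X^~ w)].
Proof.
move=> cX hE; congr (P _); apply/seteqP; split => w /=.
  exact: (hE _ (@cX w)).1.
exact: (hE _ (@cX w)).2.
Qed.

Lemma cylinder_event_measurable d (Omega : measurableType d) (X : R -> Omega -> R)
  (E : set (R -> R)) : (forall t, 0 <= t -> measurable_fun [set: Omega] (X t)) ->
  cylinders `[0, +oo[ E -> measurable [set w | E (X^~ w)].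
Proof.
move=> mX; apply: (@cylinders_preimage R Omega measurable `[0, +oo[ (fun w t => X t w)).
  exact: sigma_algebra_measurable.
by move=> u /=; rewrite in_itv/= andbT => u0 _ [B mB <-]; exact: mX.
Qed.

Lemma indistinguishable_path_law d (Omega : measurableType d) (P : probability Omega R)
  (X Y : R -> Omega -> R) (A : set (path_space R)) :
  continuous_paths X -> continuous_paths Y ->
  (forall t, 0 <= t -> measurable_fun [set: Omega] (X t)) ->
  (forall t, 0 <= t -> measurable_fun [set: Omega] (Y t)) ->
  indistinguishable P X Y -> borel_paths A -> path_law P X A = path_law P Y A.
Proof.
move=> cX cY mX mY XY /borel_traj[E [cE hE]].
rewrite (path_law_cylinder P cX hE) (path_law_cylinder P cY hE).
have mEX := cylinder_event_measurable mX cE.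
have mEY := cylinder_event_measurable mY cE.
rewrite -[X in P X]setIT -[X in _ = P X]setIT -!integral_indic//.
apply: ae_eq_integral => //; try by apply/measurable_EFinP; exact: measurable_indic.
apply: filterS XY => w XYw _; congr (_%:E); rewrite !indicE; congr (_%:R).
congr nat_of_bool; apply/idP/idP => /set_mem/= EX; apply/mem_set => /=.
  by apply/(hE _ (@cY w)); apply: traj_ext XYw _; apply/(hE _ (@cX w)).
apply/(hE _ (@cX w)); apply: (traj_ext (p := Y^~ w)); first by move=> t t0; rewrite XYw.
exact/(hE _ (@cY w)).
Qed.

(** Both processes are the same measurable functional [stopped] of their driving paths, whose laws
    on the cylinder pi-system are the same functional of the initial law. *)
Lemma stopped_process_law
  d1 (O1 : measurableType d1) (P1 : probability O1 R) (F1 : R -> set_system O1)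
  (z1 : O1 -> R) (W1 : R -> O1 -> R)
  d2 (O2 : measurableType d2) (P2 : probability O2 R) (F2 : R -> set_system O2)
  (z2 : O2 -> R) (W2 : R -> O2 -> R) (A : set (path_space R)) :
  is_filtration F1 -> is_brownian P1 F1 W1 -> smeas (F1 0) z1 ->
  is_filtration F2 -> is_brownian P2 F2 W2 -> smeas (F2 0) z2 ->
  (forall B : set R, measurable B -> P1 (z1 @^-1` B) = P2 (z2 @^-1` B)) ->
  borel_paths A ->
  path_law P1 (stopped_process z1 W1) A = path_law P2 (stopped_process z2 W2) A.
Proof.
move=> hF1 hW1 hz1 hF2 hW2 hz2 law /borel_traj[E [cE hE]].
have c1 : continuous_paths (stopped_process z1 W1) by exact: (stopped_process_continuous hW1).
have c2 : continuous_paths (stopped_process z2 W2) by exact: (stopped_process_continuous hW2).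
rewrite (path_law_cylinder P1 c1 hE) (path_law_cylinder P2 c2 hE).
have cE' : cylinders `[0, +oo[ [set p : R -> R | E (stopped p)].
  apply: (@cylinders_preimage R (R -> R) (cylinders `[0, +oo[) `[0, +oo[ stopped) => //.
    exact: smallest_sigma_algebra.
  move=> u; rewrite /= in_itv/= andbT => u0; apply/smeasP; first exact: smallest_sigma_algebra.
  apply: stopped_smeas => // s /=; rewrite !in_itv/= => /andP[-> _]//.
have mZ d (O : measurableType d) (P : probability O R) F z W (l : seq (R * set R)) :
    is_filtration F -> is_brownian P F W -> smeas (F 0) z -> increasing_from 0 l ->
    measurable (driving_path z W @^-1` cylset l).
  move=> hF hW hz hl.
  apply: (@cylinder_event_measurable _ _ (fun t w => driving_path z W w t)).
    move=> t t0; case: (hF) => _ Fm _.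
    exact: smeas_measurable (Fm t t0) (driving_path_smeas hF hW hz t0 (lexx t)).
  by apply: cylinder_sets_cylinders; exists l.
apply: (pi_system_law (S := cylinder_sets) cylinder_sets_setI _
  (cylinders_cylinder_sets cE')) => _ [l hl <-].
split; [exact: (mZ _ _ _ _ _ _ _ hF1 hW1)|exact: (mZ _ _ _ _ _ _ _ hF2 hW2)|].
rewrite (cylset_law hF1 hW1 hz1 hl) (cylset_law hF2 hW2 hz2 hl).
have [_ Fm1 _] := hF1; have [_ Fm2 _] := hF2.
apply: eq_law_ge0_integral => //.
- exact: smeas_measurable (Fm1 0 (lexx 0)) hz1.
- exact: smeas_measurable (Fm2 0 (lexx 0)) hz2.
- exact: transition_measurable.
- exact: transition_ge0.
Qed.
End law_uniqueness.

Theorem theorem2 (R : realType) (d : measure_display)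
    (Omega : measurableType d) (P : probability Omega R)
    (F : R -> set_system Omega) (W : R -> Omega -> R) (zeta : {RV P >-> R})
    (hF : is_filtration F) (hW : is_brownian P F W)
    (hind : independent_systems P (sigma_of zeta) (sigma_process W)) :
  exists X : R -> Omega -> R,
    [/\ is_solution P (generated_filtration zeta W) zeta W X,
        forall w, X 0 w = zeta w,
        forall X' : R -> Omega -> R,
          is_solution P (generated_filtration zeta W) zeta W X' ->
          indistinguishable P X' X
      & forall (d' : measure_display) (Omega' : measurableType d')
          (P' : probability Omega' R) (F' : R -> set_system Omega')
          (B Y : R -> Omega' -> R),
          is_weak_solution P' F' (distribution P zeta) B Y ->
          forall A : set (path_space R), borel_paths A ->
          path_law P' Y A = path_law P X A].
Proof.
have hG := generated_is_filtration zeta hF hW.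
have hWG := brownian_generated hF hW hind.
have hz : smeas (generated_filtration zeta W 0) zeta by exact: generated_smeas0.
exists (stopped_process zeta W); split.
- exact: stopped_process_is_solution.
- exact: stopped_process0.
- by move=> X' solX'; exact: (pathwise_uniqueness hG hWG hz).
move=> d' Omega' P' F' B Y [hF' hB solY lawY] A bA.
have [cY aY _] := solY.
have Ys t : 0 <= t -> smeas (F' t) (Y t).
  by move=> t0; apply/smeasP; [case: hF' => h _ _; exact: h|exact: aY].
have Ym t : 0 <= t -> measurable_fun [set: Omega'] (Y t).
  by move=> t0; apply: smeas_measurable (Ys t t0); case: hF' => _ h _; exact: h.
(* Adaptedness lets [Y 0] play the role of [zeta] on the second space; pathwise uniqueness there
   replaces [Y] by its own stopped driving path, and only two laws of [stopped_process] remain to be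
   compared. *)
have hY0 := Ys 0 (lexx 0).
have cS : continuous_paths (stopped_process (Y 0) B) by exact: (stopped_process_continuous hB).
rewrite (indistinguishable_path_law cY cS Ym
  (stopped_process_measurable hF' hB hY0) (pathwise_uniqueness hF' hB hY0 solY) bA).
exact: (stopped_process_law hF' hB hY0 hG hWG hz lawY bA).
Qed.
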